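(* Let $n\geq 3$ and $2\leq s<\infty$ be integers, let $\{4,3^{n-2}\}$ denote the $n$-cube, and let $\rho_0,\dots,\rho_n$ be the distinguished generators of $G(2^{\{4,3^{n-2}\},\mathcal{G}(s)})$. Put $\tilde{\rho}_0:=\rho_0\rho_1\rho_0$ and $H:=H(2^{\{4,3^{n-2}\},\mathcal{G}(s)})=\langle\tilde{\rho}_0,\rho_1,\dots,\rho_n\rangle$. Then the incidence system $\mathcal{H}(2^{\{4,3^{n-2}\},\mathcal{G}(s)})=\Gamma(H;(H_i)_{i\in\{0,\dots,n\}})$ is a regular hypertope, and its automorphism group $H$, of order $(2s)^{2^{n-1}}2^{n-1}n!$, is defined on the generators $\tilde{\rho}_0,\rho_1,\dots,\rho_n$ by the Coxeter relations $$\tilde{\rho}_0^2=\rho_i^2=id\ (1\leq i\leq n),\quad (\tilde{\rho}_0\rho_2)^4=(\rho_1\rho_2)^4=id,\quad (\rho_i\rho_{i+1})^3=id\ (2\leq i\leq n-1),$$ with all other pairs of distinct generators commuting, and the extra relations $$(\tilde{\beta}^{-i}\beta^i)^2=id\ \text{ for } 2\leq i\leq n-1,\qquad (\tilde{\beta}^n\beta^n)^s=id,$$ where $\beta=\rho_1\rho_2\cdots\rho_n$ and $\tilde{\beta}=\tilde{\rho}_0\rho_2\cdots\rho_n$. Moreover, the toroidal residue is the map $\{4,4\}_{(2,2)}$.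
   Context: C-groups and polytopes: a C-group of rank $m$ is a group $G$ with generating involutions $\rho_0,\dots,\rho_{m-1}$ satisfying $\langle\rho_i\mid i\in I\rangle\cap\langle\rho_j\mid j\in J\rangle=\langle\rho_k\mid k\in I\cap J\rangle$ for all $I,J\subseteq\{0,\dots,m-1\}$; it is a string C-group if $(\rho_i\rho_j)^2=id$ whenever $|i-j|\geq 2$. Abstract regular polytopes $\mathcal{P}$ of rank $m$ are in one-to-one correspondence with string C-groups $G(\mathcal{P})$ of rank $m$: the $i$-faces are the right cosets of $\langle\rho_j\mid j\neq i\rangle$, and vertices are the $0$-faces. Construction of $2^{\mathcal{P},\mathcal{G}(s)}$: let $\mathcal{P}$ be a centrally symmetric regular $n$-polytope with group $G(\mathcal{P})=\langle\tau_0,\dots,\tau_{n-1}\rangle$, i.e. $G(\mathcal{P})$ has a proper central involution $\alpha$ fixing no vertex. Let $F_0$ be the base vertex, stabilized by $\langle\tau_1,\dots,\tau_{n-1}\rangle$. Let $W$ be the Coxeter group generated by involutions $\sigma_F$, one for each vertex $F$ of $\mathcal{P}$, with defining relations $\sigma_F^2=id$, $(\sigma_F\sigma_{F\alpha})^s=id$, and $(\sigma_F\sigma_{F'})^2=id$ for $F'\notin\{F,F\alpha\}$. The group $G(\mathcal{P})$ acts on $W$ by $\tau^{-1}\sigma_F\tau=\sigma_{F\tau}$. Then $2^{\mathcal{P},\mathcal{G}(s)}$ is the regular $(n+1)$-polytope with group $G(2^{\mathcal{P},\mathcal{G}(s)}):=W\rtimes G(\mathcal{P})=\langle\rho_0,\dots,\rho_n\rangle$,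 where $\rho_0:=\sigma_{F_0}$ and $\rho_i:=\tau_{i-1}$ for $1\leq i\leq n$. For the $n$-cube, $G(\mathcal{P})$ is the Coxeter group $[4,3^{n-2}]$ (a $4$ followed by $n-2$ threes), of order $2^nn!$, and $\alpha=(\tau_0\tau_1\cdots\tau_{n-1})^n$. Hypertopes and halving: for a group $H$ with subgroups $(H_i)_{i\in I}$, $\Gamma(H;(H_i)_{i\in I})$ is the incidence system whose elements of type $i$ are the right cosets of $H_i$, two elements being incident iff the cosets intersect. A flag is a set of pairwise incident elements and a chamber is a flag containing an element of every type. A regular hypertope is an incidence system in which every flag lies in a chamber (a geometry) and which is thin (every flag missing exactly one type lies in exactly two chambers), residually connected (every residue of rank at least $2$ has connected incidence graph) and flag-transitive (type-preserving automorphisms are transitive on flags of each given type). Its automorphism group here means the group of type-preserving automorphisms. For a regular $(n+1)$-polytope with group $\langle\rho_0,\dots,\rho_n\rangle$, the halving group is $\langle\tilde{\rho}_0,\rho_1,\dots,\rho_n\rangle$ with $\tilde{\rho}_0=\rho_0\rho_1\rho_0$; $H_i$ is the subgroup generated by all these generators except the $i$-th one ($\tilde{\rho}_0$ being number $0$). The toroidal residue is the rank $3$ residue with group $\langle\tilde{\rho}_0,\rho_2,\rho_1\rangle$ (a map with generators in this order). The map $\{4,4\}_{(2,2)}$ is the regular toroidal map whose group is the quotient of the Coxeter group $[4,4]=\langle r_0,r_1,r_2\rangle$ by the relation $(r_0r_1r_2)^4=id$. *)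

(* Defs.v *)
From HB Require Import structures.
From mathcomp Require Import all_boot boolp classical_sets cardinality.
From Stdlib Require Import Relation_Operators.

Set Implicit Arguments.
Unset Strict Implicit.
Unset Printing Implicit Defensive.

Local Open Scope classical_set_scope.
Local Open Scope quotient_scope.
Local Open Scope group_scope.

(* The groups below are not known to be finite in advance, so they are        *)
(* [groupType]s (monoid.v) rather than [finGroupType]s.                       *)

(* The letter (i, true) stands for the generator x_i, (i, false) for x_i^-1.  *)
Definition word (I : Type) := seq (I * bool).

Definition letter (I : Type) (i : I) : word I := [:: (i, true)].

Definition winv (I : Type) (w : word I) : word I :=
  rev [seq (a.1, ~~ a.2) | a <- w].

Definition wexp (I : Type) (w : word I) (k : nat) : word I :=
  flatten (nseq k w).

Definition wmap (I J : Type) (f : I -> J) (w : word I) : word J :=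
  [seq (f a.1, a.2) | a <- w].

(* Equality of the images of two words in F(I) / <<R>>.                       *)
Inductive weq (I : Type) (R : set (word I)) : word I -> word I -> Prop :=
| weq_refl u : weq R u u
| weq_sym u v : weq R u v -> weq R v u
| weq_trans v u w : weq R u v -> weq R v w -> weq R u w
| weq_cancel u v i b : weq R (u ++ (i, b) :: (i, ~~ b) :: v) (u ++ v)
| weq_relator u v r : R r -> weq R (u ++ r ++ v) (u ++ v).

Section WordCongruence.
Variables (I : Type) (R : set (word I)).
Implicit Types u v w : word I.

Lemma weq_cat2l w u v : weq R u v -> weq R (w ++ u) (w ++ v).
Proof.
elim=> [a|a b _|b a c _ ab _ bc|a b i e|a b r Rr].
- exact: weq_refl.
- exact: weq_sym.
- exact: weq_trans ab bc.
- by rewrite !catA; apply: weq_cancel.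
- by rewrite !(catA w); apply: weq_relator.
Qed.

Lemma weq_cat2r w u v : weq R u v -> weq R (u ++ w) (v ++ w).
Proof.
elim=> [a|a b _|b a c _ ab _ bc|a b i e|a b r Rr].
- exact: weq_refl.
- exact: weq_sym.
- exact: weq_trans ab bc.
- by rewrite -!catA; apply: weq_cancel.
- by rewrite -!catA; apply: weq_relator.
Qed.

Lemma weq_cat u u' v v' : weq R u u' -> weq R v v' -> weq R (u ++ v) (u' ++ v').
Proof. by move=> uu' vv'; apply: weq_trans (weq_cat2r _ uu') (weq_cat2l _ vv'). Qed.

Lemma weq_mulV w : weq R (w ++ winv w) [::].
Proof.
elim: w => [|[i b] w IHw]; first exact: weq_refl.
rewrite /winv /= rev_cons -cats1 catA -cat1s -(cat1s (i, b)) -catA.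
apply: weq_trans (weq_cancel R [::] [::] i b).
exact: weq_cat2l [:: (i, b)] _ _ (weq_cat2r [:: (i, ~~ b)] IHw).
Qed.

Lemma winvK : involutive (@winv I).
Proof.
move=> w; rewrite /winv map_rev revK -map_comp -[RHS]map_id.
by apply: eq_map => -[i b] /=; rewrite negbK.
Qed.

Lemma weq_mulVw w : weq R (winv w ++ w) [::].
Proof. by rewrite -{2}(winvK w); apply: weq_mulV. Qed.

Lemma weq_inv u v : weq R u v -> weq R (winv u) (winv v).
Proof.
move=> uv; have h1 := weq_cat2l (winv u) (weq_sym (weq_mulV v)).
rewrite cats0 in h1; apply: weq_trans h1 _.
rewrite catA -[X in weq R _ X]cat0s; apply: weq_cat2r.
by apply: weq_trans (weq_mulVw u); apply: weq_cat2l; apply: weq_sym.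
Qed.

End WordCongruence.

Section Presented.
Variables (I : choiceType) (R : set (word I)).

Definition weqb : rel (word I) := fun u v => `[< weq R u v >].

Lemma weqb_refl : reflexive weqb.
Proof. by move=> u; apply/asboolP/weq_refl. Qed.
Lemma weqb_sym : symmetric weqb.
Proof. by move=> u v; apply/asboolP/asboolP; apply: weq_sym. Qed.
Lemma weqb_trans : transitive weqb.
Proof. by move=> v u w /asboolP uv /asboolP vw; apply/asboolP/(weq_trans uv vw). Qed.

Canonical weqb_equiv := EquivRel weqb weqb_refl weqb_sym weqb_trans.

Definition presented := {eq_quot weqb_equiv}.

HB.instance Definition _ := Choice.on presented.
HB.instance Definition _ := EqQuotient.on presented.

Definition pclass (w : word I) : presented := \pi_presented w.

Lemma pclassE u v : pclass u = pclass v <-> weq R u v.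
Proof.
by split=> [/(@eqquotP _ weqb_equiv presented)/asboolP|uv] //;
   apply/(@eqquotP _ weqb_equiv presented)/asboolP.
Qed.

Lemma pclass_repr x : pclass (repr x) = x.
Proof. exact: reprK. Qed.

Lemma weq_repr u : weq R (repr (pclass u)) u.
Proof. by apply/pclassE; rewrite pclass_repr. Qed.

Definition pone : presented := pclass [::].
Definition pmul (x y : presented) : presented := pclass (repr x ++ repr y).
Definition pinv (x : presented) : presented := pclass (winv (repr x)).

Lemma pmulA : associative pmul.
Proof.
move=> x y z; apply/pclassE.
apply: weq_trans (weq_cat2l _ (weq_repr _)) _; rewrite catA.
exact: weq_cat2r (weq_sym (weq_repr _)).
Qed.

Lemma pmul1 : left_id pone pmul.
Proof.
by move=> x; rewrite -[RHS]pclass_repr; apply/pclassE/(weq_cat2r _ (weq_repr [::])).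
Qed.

Lemma pmulr1 : right_id pone pmul.
Proof.
move=> x; rewrite -[RHS]pclass_repr; apply/pclassE.
by apply: weq_trans (weq_cat2l _ (weq_repr _)) _; rewrite cats0; apply: weq_refl.
Qed.

Lemma pmulV : left_inverse pone pinv pmul.
Proof.
move=> x; apply/pclassE.
by apply: weq_trans (weq_cat2r _ (weq_repr _)) _; apply: weq_mulVw.
Qed.

Lemma pmulrV : right_inverse pone pinv pmul.
Proof.
move=> x; apply/pclassE.
by apply: weq_trans (weq_cat2l _ (weq_repr _)) _; apply: weq_mulV.
Qed.

HB.instance Definition _ :=
  isGroup.Build presented pmulA pmul1 pmulr1 pmulV pmulrV.

Definition pgen (i : I) : presented := pclass (letter i).

Lemma piM u v : pclass (u ++ v) = pclass u * pclass v.
Proof. by apply/pclassE/weq_cat; apply: weq_sym; apply: weq_repr. Qed.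

Lemma pi_relator r : R r -> pclass r = 1.
Proof. by move=> Rr; apply/pclassE; have := weq_relator [::] [::] Rr; rewrite cats0. Qed.

Lemma pi_exp u k : pclass (wexp u k) = (pclass u) ^+ k.
Proof. by elim: k => // k IHk; rewrite expgS -IHk -piM. Qed.

Lemma pi_inv_letter i : pclass [:: (i, false)] = (pgen i)^-1.
Proof.
apply: (mulgI (pgen i)); rewrite mulgV -piM.
by apply/pclassE; apply: (weq_cancel R [::] [::] i true).
Qed.

Lemma presented_ind (Q : presented -> Prop) :
    Q 1 -> (forall i x, Q x -> Q (pgen i * x)) ->
    (forall i x, Q x -> Q ((pgen i)^-1 * x)) ->
  forall x, Q x.
Proof.
move=> Q1 Qg QV x; rewrite -[x]pclass_repr.
elim: (repr x) => [|[i []] w IHw]; first exact: Q1.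
- by rewrite -cat1s piM; apply: Qg.
- by rewrite -cat1s piM pi_inv_letter; apply: QV.
Qed.

End Presented.

Arguments pgen {I} R i.

(* The generators x_i of the subgroup A satisfy R, and every relation between *)
(* them is a consequence of R.                                                *)
Definition has_presentation (K : groupType) (A : set K) (I : choiceType)
    (x : I -> K) (R : set (word I)) : Prop :=
  exists f : presented R -> K,
    [/\ {morph f : a b / a * b}, forall i, f (pgen R i) = x i,
        injective f & range f = A].

(* The matrices below have diagonal 1, so that i = j gives the relator x_i^2. *)
Definition coxeter_rels (I : Type) (m : I -> I -> nat) : set (word I) :=
  [set w | exists i j, w = wexp (letter i ++ letter j) (m i j)].

(* Coxeter matrix of the string diagram [p 0, p 1, ..., p (n - 2)].           *)
Definition string_matrix (p : nat -> nat) (n : nat) (i j : 'I_n) : nat :=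
  if i == j then 1%N
  else if i.+1 == j :> nat then p i
  else if j.+1 == i :> nat then p j
  else 2.

Record subgroup (K : groupType) := Subgroup {
  subgroup_set :> set K;
  subgroup1 : subgroup_set 1;
  subgroupM : forall x y, subgroup_set x -> subgroup_set y -> subgroup_set (x * y);
  subgroupV : forall x, subgroup_set x -> subgroup_set x^-1 }.

Section Generated.
Variables (K : groupType) (A : set K).

Definition gen_set : set K := [set g | forall L : subgroup K, A `<=` L -> (L : set K) g].

Lemma gen_set1 : gen_set 1.
Proof. by move=> L _; apply: subgroup1. Qed.
Lemma gen_setM x y : gen_set x -> gen_set y -> gen_set (x * y).
Proof. by move=> hx hy L AL; apply: subgroupM; [apply: hx|apply: hy]. Qed.
Lemma gen_setV x : gen_set x -> gen_set x^-1.
Proof. by move=> hx L AL; apply: subgroupV; apply: hx. Qed.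

Definition generated : subgroup K := Subgroup gen_set1 gen_setM gen_setV.
End Generated.

Definition rcoset (K : groupType) (A : set K) (g : K) : set K :=
  [set a * g | a in A].

Lemma rcosetM (K : groupType) (A : set K) (g h : K) :
  rcoset (rcoset A g) h = rcoset A (g * h).
Proof.
rewrite /rcoset; apply/seteqP; split=> x /=.
- by case=> _ [a Aa <-] <-; exists a => //; rewrite mulgA.
- by case=> a Aa <-; exists (a * g); [exists a|rewrite mulgA].
Qed.

Lemma rcoset1 (K : groupType) (A : set K) : rcoset A 1 = A.
Proof.
apply/seteqP; split=> x /=; first by case=> a Aa <-; rewrite mulg1.
by move=> Ax; exists x => //; rewrite mulg1.
Qed.

Definition parabolic (I : Type) (K : groupType) (x : I -> K) (J : set I) :=
  generated (x @` J).

Record group_action (W G : groupType) := GroupAction {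
  gact :> W -> G -> W;
  gactMl : forall g, {morph gact^~ g : v w / v * w};
  gact1 : forall w, gact w 1 = w;
  gactM : forall w g h, gact w (g * h) = gact (gact w g) h }.

(* (w, g) stands for w g, and g^-1 w g = a w g.                               *)
Definition semidirect (W G : groupType) (a : group_action W G) : Type :=
  (W * G)%type.

Section SemiDirect.
Variables (W G : groupType) (a : group_action W G).

HB.instance Definition _ := Choice.copy (semidirect a) (W * G)%type.

Definition sd_one : semidirect a := (1, 1).
Definition sd_mul (x y : semidirect a) : semidirect a :=
  (x.1 * a y.1 x.2^-1, x.2 * y.2).
Definition sd_inv (x : semidirect a) : semidirect a := (a x.1^-1 x.2, x.2^-1).

Lemma gact1l g : a 1 g = 1.
Proof. by apply: (mulgI (a 1 g)); rewrite -gactMl !mulg1. Qed.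

Lemma sd_mulA : associative sd_mul.
Proof.
move=> x y z; congr pair => /=; last exact: mulgA.
by rewrite gactMl invgM gactM mulgA.
Qed.
Lemma sd_mul1 : left_id sd_one sd_mul.
Proof. by case=> w g; rewrite /sd_mul /= invg1 gact1 !mul1g. Qed.
Lemma sd_mulr1 : right_id sd_one sd_mul.
Proof. by case=> w g; rewrite /sd_mul /= gact1l !mulg1. Qed.
Lemma sd_mulV : left_inverse sd_one sd_inv sd_mul.
Proof.
case=> w g; rewrite /sd_mul /= invgK mulVg -gactMl mulVg.
by rewrite gact1l.
Qed.
Lemma sd_mulrV : right_inverse sd_one sd_inv sd_mul.
Proof. by case=> w g; rewrite /sd_mul /= mulgV -gactM mulgV gact1 mulgV. Qed.

HB.instance Definition _ :=
  isGroup.Build (semidirect a) sd_mulA sd_mul1 sd_mulr1 sd_mulV sd_mulrV.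

Definition sd_inl (w : W) : semidirect a := (w, 1).
Definition sd_inr (g : G) : semidirect a := (1, g).

End SemiDirect.

(* The part of a centrally symmetric regular polytope that the construction   *)
(* of the group of 2^{P, G(s)} uses.  That the alpha of the cube is an        *)
(* involution without fixed vertices is a consequence of its definition.      *)
Record central_polytope_group (n : nat) := CentralPolytopeGroup {
  cp_group :> groupType;
  cp_tau : 'I_n -> cp_group;
  cp_alpha : cp_group;
  cp_central : forall g, commute cp_alpha g }.

Section Power2.
Variables (n : nat) (P : central_polytope_group n) (s : nat).

Definition base_vertex_stab : subgroup P :=
  parabolic (@cp_tau n P) [set i | i != 0 :> nat].

Definition vertex : Type :=
  {F : set P | exists g, F = rcoset base_vertex_stab g}.

HB.instance Definition _ := gen_eqMixin vertex.
HB.instance Definition _ := gen_choiceMixin vertex.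

Lemma base_vertex_subproof :
  exists g, rcoset base_vertex_stab 1 = rcoset base_vertex_stab g.
Proof. by exists 1. Qed.

Definition base_vertex : vertex := exist _ _ base_vertex_subproof.

Lemma vertex_act_subproof (F : vertex) (g : P) :
  exists h, rcoset (sval F) g = rcoset base_vertex_stab h.
Proof. by case: F => F [h e] /=; exists (h * g); rewrite e rcosetM. Qed.

Definition vertex_act (g : P) (F : vertex) : vertex :=
  exist _ _ (vertex_act_subproof F g).

Definition antipode : vertex -> vertex := vertex_act (cp_alpha P).

Lemma vertex_inj (F F' : vertex) : sval F = sval F' -> F = F'.
Proof. by case: F F' => [F hF] [F' hF'] /= e; apply: eq_exist. Qed.

Lemma vertex_act1 F : vertex_act 1 F = F.
Proof. by apply: vertex_inj; rewrite /= rcoset1. Qed.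

Lemma vertex_actM g h F : vertex_act (g * h) F = vertex_act h (vertex_act g F).
Proof. by apply: vertex_inj; rewrite /= rcosetM. Qed.

Lemma vertex_act_inj g : injective (vertex_act g).
Proof.
apply: (can_inj (g := vertex_act g^-1)) => F.
by rewrite -vertex_actM mulgV vertex_act1.
Qed.

Lemma antipode_act g F : antipode (vertex_act g F) = vertex_act g (antipode F).
Proof. by rewrite /antipode -!vertex_actM (cp_central g). Qed.

Definition W_rels : set (word vertex) := [set w |
  [\/ exists F, w = wexp (letter F) 2,
      exists F, w = wexp (letter F ++ letter (antipode F)) s
    | exists F F', [/\ F' <> F, F' <> antipode F
                     & w = wexp (letter F ++ letter F') 2]]].

Definition W_group : groupType := presented W_rels.

Lemma wmap_cat (I J : Type) (f : I -> J) u v :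
  wmap f (u ++ v) = wmap f u ++ wmap f v.
Proof. exact: map_cat. Qed.

Lemma wmap_exp (I J : Type) (f : I -> J) u k :
  wmap f (wexp u k) = wexp (wmap f u) k.
Proof. by rewrite /wmap /wexp map_flatten map_nseq. Qed.

Lemma W_rels_act g w : W_rels w -> W_rels (wmap (vertex_act g) w).
Proof.
case=> [[F ->]|[F ->]|[F [F' [h1 h2 ->]]]].
- by apply: Or31; exists (vertex_act g F); rewrite wmap_exp.
- by apply: Or32; exists (vertex_act g F); rewrite wmap_exp wmap_cat antipode_act.
- apply: Or33; exists (vertex_act g F), (vertex_act g F').
  split; last by rewrite wmap_exp wmap_cat.
  + by move/vertex_act_inj.
  + by rewrite antipode_act => /vertex_act_inj.
Qed.

Lemma weq_W_act g u v :
  weq W_rels u v -> weq W_rels (wmap (vertex_act g) u) (wmap (vertex_act g) v).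
Proof.
elim=> [a|a b _|b a c _ ab _ bc|a b i e|a b r Rr].
- exact: weq_refl.
- exact: weq_sym.
- exact: weq_trans ab bc.
- by rewrite !wmap_cat; apply: weq_cancel.
- by rewrite !wmap_cat; apply: weq_relator; apply: W_rels_act.
Qed.

(* sigma_F |-> sigma_{F g}                                                    *)
Definition W_act (x : W_group) (g : P) : W_group :=
  pclass W_rels (wmap (vertex_act g) (repr x)).

Lemma W_act_pi u g : W_act (pclass W_rels u) g = pclass W_rels (wmap (vertex_act g) u).
Proof. by apply/pclassE/weq_W_act/weq_repr. Qed.

Lemma W_actMl g : {morph W_act^~ g : v w / v * w}.
Proof.
move=> v w /=; rewrite -[v]pclass_repr -[w]pclass_repr.
by rewrite -piM !W_act_pi wmap_cat piM.
Qed.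

Lemma W_act1 w : W_act w 1 = w.
Proof.
rewrite -[w in LHS]pclass_repr W_act_pi -[RHS]pclass_repr; congr pclass.
rewrite /wmap -[RHS]map_id; apply: eq_map => -[F b] /=.
by rewrite vertex_act1.
Qed.

Lemma W_actM w g h : W_act w (g * h) = W_act (W_act w g) h.
Proof.
rewrite -[w]pclass_repr !W_act_pi; congr pclass; rewrite /wmap -map_comp.
by apply: eq_map => -[F b] /=; rewrite vertex_actM.
Qed.

Definition W_action : group_action W_group P :=
  GroupAction W_actMl W_act1 W_actM.

Definition power2_group : groupType := semidirect W_action.

Definition power2_rho (i : 'I_n.+1) : power2_group :=
  if unlift ord0 i is Some j then sd_inr W_action (cp_tau P j)
  else sd_inl W_action (pgen W_rels base_vertex).

End Power2.

Definition cube_rels (n : nat) : set (word 'I_n) :=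
  coxeter_rels (string_matrix (fun i => if i == 0 then 4 else 3) (n := n)).

Arguments cube_rels : clear implicits.

Definition cube_group (n : nat) : groupType := presented (cube_rels n).

Definition cube_tau (n : nat) (i : 'I_n) : cube_group n := pgen (cube_rels n) i.

Definition cube_alpha (n : nat) : cube_group n :=
  (\prod_(i < n) cube_tau i) ^+ n.

Section CubeCentral.

Section Abstract.
Variables (K : groupType) (t : nat -> K) (m : nat).
Hypothesis t2 : forall i, i < m.+2 -> t i * t i = 1.
Hypothesis t4 : (t 0 * t 1) ^+ 4 = 1.
Hypothesis t3 : forall i, 0 < i -> i.+1 < m.+2 -> (t i * t i.+1) ^+ 3 = 1.
Hypothesis tC : forall i j, i.+1 < j -> j < m.+2 -> (t i * t j) ^+ 2 = 1.

Let c := \prod_(0 <= i < m.+2) t i.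

Lemma t_inv i : i < m.+2 -> (t i)^-1 = t i.
Proof. by move=> hi; apply: (mulgI (t i)); rewrite mulgV t2. Qed.

Lemma t_comm i j : i.+1 < j -> j < m.+2 -> commute (t i) (t j).
Proof.
move=> ij jm; have im : i < m.+2 by apply: ltn_trans jm; apply: ltnW.
have := tC ij jm; rewrite expgS expg1 => e.
have : (t i * t j)^-1 = t i * t j by apply: (mulgI (t i * t j)); rewrite mulgV e.
by rewrite invgM !t_inv // => <-.
Qed.

Lemma t_braid i : 0 < i -> i.+1 < m.+2 -> t i * t i.+1 * t i = t i.+1 * t i * t i.+1.
Proof.
move=> i0 im; have hi : i < m.+2 by apply: ltnW.
have := t3 i0 im; rewrite !expgS expg0 mulg1 => e.
apply: (mulIg (t i.+1 * t i * t i.+1)).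
have -> : t i * t i.+1 * t i * (t i.+1 * t i * t i.+1) = 1 by rewrite -e !mulgA.
by rewrite -!mulgA (mulgA (t i.+1) (t i.+1)) t2 // mul1g (mulgA (t i) (t i)) t2 // mul1g t2.
Qed.

Lemma prod_comm a b j : (forall i, a <= i < b -> commute (t i) (t j)) ->
  commute (\prod_(a <= i < b) t i) (t j).
Proof.
move=> h; rewrite big_nat; elim/big_ind: _ => [|x y hx hy|i /h //].
- by rewrite /commute mul1g mulg1.
- by rewrite /commute -mulgA hy mulgA hx mulgA.
Qed.

Lemma c_shift i : 0 < i -> i.+1 < m.+2 -> c * t i = t i.+1 * c.
Proof.
move=> i0 im; have hi : i < m.+2 by apply: ltnW.
rewrite /c (big_cat_nat (n := i)) 1?ltnW //=.
set A := \prod_(0 <= k < i) t k; rewrite big_ltn // big_ltn //.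
set B := \prod_(i.+2 <= k < m.+2) t k.
have hB : B * t i = t i * B.
  apply: prod_comm => k /andP[ik km]; apply/esym; exact: t_comm.
have hA : A * t i.+1 = t i.+1 * A.
  apply: prod_comm => k /andP[_ ki]; exact: t_comm.
rewrite -!mulgA hB.
have -> : t i * (t i.+1 * (t i * B)) = t i.+1 * (t i * (t i.+1 * B)).
  by rewrite !mulgA t_braid.
by rewrite [LHS]mulgA hA !mulgA.
Qed.

Lemma c_shift_prod k : k <= m ->
  c * \prod_(1 <= i < k.+1) t i = \prod_(2 <= i < k.+2) t i * c.
Proof.
elim: k => [|k IHk] km; first by rewrite !big_geq // mulg1 mul1g.
rewrite big_nat_recr //= mulgA IHk 1?ltnW // -mulgA c_shift //.
by rewrite [in RHS]big_nat_recr //= mulgA.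
Qed.

Lemma c_wrap : c * c * t m.+1 = t 1 * (c * c).
Proof.
have h0 : 0 < m.+2 by []. have h1 : 1 < m.+2 by [].
have h01 : t 1 * t 0 * t 1 * t 0 * t 1 = t 0 * t 1 * t 0.
  have := t4; rewrite !expgS expg0 mulg1 => e.
  apply: (mulgI (t 0)); apply: (mulIg (t 0 * t 1)).
  have -> : t 0 * (t 1 * t 0 * t 1 * t 0 * t 1) * (t 0 * t 1) = 1 by rewrite -e !mulgA.
  rewrite -!mulgA (mulgA (t 0) (t 0)) t2 // mul1g.
  by rewrite (mulgA (t 0) (t 0)) t2 // mul1g t2.
set e := \prod_(2 <= i < m.+2) t i.
have ce : c = t 0 * t 1 * e by rewrite /c big_ltn // big_ltn // mulgA.
have cl : c * t m.+1 = t 0 * \prod_(1 <= i < m.+1) t i.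
  by rewrite /c big_nat_recr //= -mulgA t2 // mulg1 big_ltn.
have et0 : e * t 0 = t 0 * e.
  apply: prod_comm => k /andP[k1 km]; apply/esym; exact: t_comm.
have ct0 : c * t 0 = t 1 * t 0 * t 1 * c.
  by rewrite ce -mulgA et0 !mulgA h01.
rewrite -mulgA cl mulgA ct0 -!mulgA c_shift_prod // -/e.
by rewrite ce !mulgA.
Qed.

Lemma c_shift_exp k i : 0 < i -> (i + k < m.+2)%N ->
  c ^+ k * t i = t (i + k)%N * c ^+ k.
Proof.
move=> i0; elim: k => [|k IHk] ik; first by rewrite addn0 expg0 mulg1 mul1g.
rewrite addnS in ik *; rewrite !expgS -mulgA IHk 1?ltnW // !mulgA c_shift //.
by rewrite addn_gt0 i0.
Qed.

Lemma c_exp_central i : i < m.+2 -> commute (c ^+ m.+2) (t i).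
Proof.
have hpos j : 0 < j -> j < m.+2 -> commute (c ^+ m.+2) (t j).
  case: j => // j _ jm; rewrite /commute.
  have em : m.+2 = (j + (2 + (m - j)))%N by rewrite addnCA subnKC.
  have e1 : c ^+ (m - j) * t j.+1 = t m.+1 * c ^+ (m - j).
    by rewrite c_shift_exp // addSn subnKC.
  have e2 : c ^+ 2 * t m.+1 = t 1 * c ^+ 2 by rewrite !expgS expg0 mulg1 c_wrap.
  have e3 : c ^+ j * t 1 = t j.+1 * c ^+ j by rewrite c_shift_exp.
  rewrite em !expgnDr.
  move: (c ^+ j) (c ^+ 2) (c ^+ (m - j)) e1 e2 e3 => a b d e1 e2 e3.
  by rewrite -!mulgA e1 (mulgA b) e2 -!mulgA (mulgA a) e3 -!mulgA.
case: i => [_|i]; last exact: hpos.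
have e : c = t 0 * \prod_(1 <= i < m.+2) t i by rewrite /c big_ltn.
have hB : commute (c ^+ m.+2) (\prod_(1 <= i < m.+2) t i).
  rewrite big_nat; elim/big_ind: _ => [|x y|i /andP[i1 im]].
  - exact: commute1.
  - exact: commuteM.
  - exact: hpos.
have -> : t 0 = c * (\prod_(1 <= i < m.+2) t i)^-1.
  by rewrite [X in X * _]e -mulgA mulgV mulg1.
apply: commuteM; last exact: commuteV.
by apply: commute_sym; apply: commuteX.
Qed.

End Abstract.

Lemma cube_alpha_tau n (i : 'I_n) : commute (cube_alpha n) (cube_tau i).
Proof.
case: n i => [[] //|[i|m i]].
  rewrite /cube_alpha big_ord_recl big_ord0 mulg1 expg1.
  by rewrite (ord1 i).
pose t j : cube_group m.+2 := cube_tau (inord j).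
have rel (j k : 'I_m.+2) :
    (cube_tau j * cube_tau k) ^+
      string_matrix (fun i => if i == 0 then 4 else 3) j k = 1.
  by rewrite /cube_tau -piM -pi_exp; apply: pi_relator; exists j, k.
have -> : cube_alpha m.+2 = (\prod_(0 <= j < m.+2) t j) ^+ m.+2.
  rewrite /cube_alpha big_mkord; congr (_ ^+ _).
  by apply: eq_bigr => j _; rewrite /t inord_val.
have -> : cube_tau i = t i by rewrite /t inord_val.
apply: c_exp_central => //= [j jm||j j0 jm|j k jk km].
- by have := rel (inord j) (inord j); rewrite /string_matrix eqxx expg1.
- have := rel (inord 0) (inord 1).
  by rewrite /string_matrix -val_eqE /= !inordK.
- have jm' : j < m.+2 by apply: ltnW.
  have := rel (inord j) (inord j.+1).
  rewrite /string_matrix -val_eqE /= !inordK // eqxx -[j == j.+1]negbK neq_ltn.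
  by rewrite ltnSn /= (gtn_eqF j0).
- have jm : j < m.+2 by apply: ltn_trans km; apply: ltnW.
  have := rel (inord j) (inord k).
  rewrite /string_matrix -val_eqE /= !inordK //.
  rewrite (ltn_eqF (ltnW jk)) (ltn_eqF jk) gtn_eqF //.
  by rewrite ltnS ltnW // ltnW.
Qed.

Lemma cube_alpha_central n (g : cube_group n) : commute (cube_alpha n) g.
Proof.
elim/(@presented_ind _ (cube_rels n)): g => [|i x hx|i x hx].
- exact: commute1.
- by apply: commuteM => //; apply: cube_alpha_tau.
- by apply: commuteM => //; apply: commuteV; apply: cube_alpha_tau.
Qed.

End CubeCentral.

Definition cube (n : nat) : central_polytope_group n :=
  CentralPolytopeGroup (@cube_tau n) (@cube_alpha_central n).

Record incidence_system (I : Type) := IncidenceSystem {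
  elt :> Type;
  typ : elt -> I;
  inc : elt -> elt -> Prop;
  inc_refl : forall x, inc x x;
  inc_sym : forall x y, inc x y -> inc y x;
  inc_typ : forall x y, inc x y -> typ x = typ y -> x = y }.

Arguments typ {I i}.
Arguments inc {I i}.

Section Hypertope.
Variables (I : finType) (X : incidence_system I).
Implicit Types F C : set X.

Definition is_flag F : Prop := forall x y, F x -> F y -> inc x y.

Definition is_chamber C : Prop := is_flag C /\ forall i, exists2 x, C x & typ x = i.

(* Number of types missing from F, i.e. the rank of the residue of F.         *)
Definition corank F : nat := #|finset (fun i : I => ~~ `[< (typ @` F) i >])|.

Definition residue_elt F : Type :=
  {x : X | ~ F x /\ forall y, F y -> inc x y}.

Lemma residue_inc_typ F (x y : residue_elt F) :
  inc (sval x) (sval y) -> typ (sval x) = typ (sval y) -> x = y.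
Proof.
by case: x y => [x hx] [y hy] /= ixy txy; apply: eq_exist; apply: inc_typ ixy txy.
Qed.

Definition residue F : incidence_system I :=
  @IncidenceSystem I (residue_elt F) (fun x => typ (sval x))
    (fun x y => inc (sval x) (sval y)) (fun x => inc_refl (sval x))
    (fun x y => @inc_sym _ _ (sval x) (sval y)) (@residue_inc_typ F).

Definition is_geometry : Prop :=
  forall F, is_flag F -> exists2 C, is_chamber C & F `<=` C.

Definition is_thin : Prop :=
  forall F, is_flag F -> corank F = 1%N ->
    ([set C | is_chamber C /\ F `<=` C] #= `I_2)%card.

Definition type_automorphism (f : X -> X) : Prop :=
  [/\ bijective f, forall x, typ (f x) = typ x
    & forall x y, inc (f x) (f y) <-> inc x y].

Definition is_flag_transitive : Prop :=
  forall F F', is_flag F -> is_flag F' -> typ @` F = typ @` F' ->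
    exists2 f, type_automorphism f & f @` F = F'.

End Hypertope.

Definition inc_connected (I : Type) (X : incidence_system I) : Prop :=
  forall x y : X, clos_refl_trans X inc x y.

Definition is_residually_connected (I : finType) (X : incidence_system I) : Prop :=
  forall F : set X, is_flag F -> 2 <= corank F -> inc_connected (residue F).

Definition regular_hypertope (I : finType) (X : incidence_system I) : Prop :=
  [/\ is_geometry X, is_thin X, is_residually_connected X
    & is_flag_transitive X].

(* Isomorphism that identifies the type j of Y with the type k j of X.        *)
Definition iso_along (I J : Type) (k : J -> I)
    (X : incidence_system I) (Y : incidence_system J) : Prop :=
  exists f : X -> Y,
    [/\ bijective f, forall x, typ x = k (typ (f x))
      & forall x y, inc (f x) (f y) <-> inc x y].

Section CosetSystem.
Variables (I : Type) (K : groupType) (H : subgroup K) (Hi : I -> subgroup K).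

Record coset_elt := CosetElt {
  ce_typ : I;
  ce_set : set K;
  ce_coset : exists2 h, (H : set K) h & ce_set = rcoset (Hi ce_typ) h }.

Definition coset_inc (x y : coset_elt) : Prop := ce_set x `&` ce_set y !=set0.

Lemma coset_inc_refl x : coset_inc x x.
Proof.
case: x => i S [h Hh e]; exists h; rewrite /= e.
by split; exists 1; rewrite ?mul1g //; apply: subgroup1.
Qed.

Lemma coset_inc_sym x y : coset_inc x y -> coset_inc y x.
Proof. by rewrite /coset_inc setIC. Qed.

Lemma rcoset_sub (L : subgroup K) (g h z : K) :
  rcoset L g z -> rcoset L h z -> rcoset L g `<=` rcoset L h.
Proof.
move=> [a La <-] [b Lb e] _ [d Ld <-]; exists (d * a^-1 * b).
  by do 2?[apply: subgroupM => //]; apply: subgroupV.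
by rewrite -mulgA e !mulgA -(mulgA d) mulVg mulg1.
Qed.

Lemma coset_inc_typ x y : coset_inc x y -> ce_typ x = ce_typ y -> x = y.
Proof.
case: x y => i S [h Hh e] [j T [h' Hh' e']] [z /= [Sz Tz]] ij.
case: _ / ij e' => e'; subst S T.
have E : rcoset (Hi i) h = rcoset (Hi i) h'.
  by apply/seteqP; split; apply: rcoset_sub; eassumption.
move: (ex_intro2 _ _ h Hh _) (ex_intro2 _ _ h' Hh' _) => p q.
move: p q; rewrite E => p q; congr CosetElt; exact: Prop_irrelevance.
Qed.

Definition coset_system : incidence_system I :=
  IncidenceSystem coset_inc_refl coset_inc_sym coset_inc_typ.

Lemma base_elt_subproof i : exists2 h, (H : set K) h & (Hi i : set K) = rcoset (Hi i) h.
Proof. by exists 1; [exact: subgroup1|rewrite rcoset1]. Qed.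

Definition base_elt (i : I) : coset_system := CosetElt (base_elt_subproof i).

Definition acts_as_translation (f : coset_system -> coset_system) (h : K) : Prop :=
  forall x, ce_typ (f x) = ce_typ x /\ ce_set (f x) = rcoset (ce_set x) h.

End CosetSystem.

(* The group of type-preserving automorphisms is H, acting faithfully on the  *)
(* cosets by right translations.                                              *)
Definition automorphism_group_is (I : finType) (K : groupType)
    (H : subgroup K) (Hi : I -> subgroup K) : Prop :=
  (forall h, (H : set K) h -> exists2 f, type_automorphism f &
     @acts_as_translation I K H Hi f h) /\
  (forall f, type_automorphism f ->
     exists! h, (H : set K) h /\ @acts_as_translation I K H Hi f h).

(* Gamma (<x_i | i>; (<x_j | j <> i>)_i)                                      *)
Definition coset_geometry (I : Type) (K : groupType) (x : I -> K) :=
  coset_system (parabolic x setT) (fun i => parabolic x [set j | j <> i]).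

Definition map44_22_rels : set (word 'I_3) :=
  coxeter_rels (string_matrix (fun=> 4) (n := 3)) `|`
  [set wexp [seq (i, true) | i <- enum 'I_3] 4].

Definition map44_22 : incidence_system 'I_3 :=
  coset_geometry (pgen map44_22_rels).

Definition halving_gen (n : nat) (K : groupType) (rho : 'I_n.+1 -> K)
    (i : 'I_n.+1) : K :=
  if i == ord0 then rho ord0 * rho (inord 1) * rho ord0 else rho i.

(* Coxeter diagram: 0 and 1 are both joined to 2 by edges labelled 4, and     *)
(* 2 - 3 - ... - n is a path of edges labelled 3.                             *)
Definition halving_matrix (n : nat) (i j : 'I_n.+1) : nat :=
  let a := minn i j in let b := maxn i j in
  if a == b then 1%N
  else if (a < 2) && (b == 2) then 4
  else if (2 <= a) && (b == a.+1) then 3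
  else 2.

(* rho_1 rho_2 ... rho_n, and ~rho_0 rho_2 ... rho_n                          *)
Definition beta_word (n : nat) : word 'I_n.+1 :=
  [seq (i, true) | i <- [seq i : 'I_n.+1 <- enum 'I_n.+1 | i != 0 :> nat]].

Definition tbeta_word (n : nat) : word 'I_n.+1 :=
  [seq (i, true) | i <- [seq i : 'I_n.+1 <- enum 'I_n.+1 | i != 1%N :> nat]].

Definition halving_rels (n s : nat) : set (word 'I_n.+1) :=
  coxeter_rels (@halving_matrix n) `|`
  [set w | exists2 i, 2 <= i <= n.-1 &
     w = wexp (wexp (winv (tbeta_word n)) i ++ wexp (beta_word n) i) 2] `|`
  [set wexp (wexp (tbeta_word n) n ++ wexp (beta_word n) n) s].

Arguments halving_rels : clear implicits.

(* The generators of the toroidal residue are numbers 0, 2, 1, in this order. *)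
Definition toroidal_type (n : nat) (j : 'I_3) : 'I_n.+1 :=
  inord (nth 0 [:: 0; 2; 1] j)%N.

(* Main.v *)
Require Import Defs.
From HB Require Import structures.
From mathcomp Require Import all_boot boolp classical_sets cardinality zify.
From Stdlib Require Import Relation_Operators.

(** Let G be the group of the n-cube, W the product over the 2^(n-1) diagonals
    of the dihedral groups of order 2 s that are generated by the reflections
    sigma_F in the two ends F of the diagonal, and H the halving group in
    W x| G, with generators x_0 = rho_0 rho_1 rho_0 and x_i = rho_i for i > 0.

    The hypertope. A coset geometry of a group generated by involutions is a regular
    hypertope on which the group acts as the full group of
    type-preserving automorphisms as soon as two conditions hold: the
    intersection property, and the flag condition that cosets which meet
    pairwise have an element in common (coset_regular_hypertope,
    coset_automorphism_group). In the diagram of H the generators 0 and 1 are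
    both joined to the head of the string 2, 3, .., n. Deleting a node i >= 2
    disconnects this diagram, and an element of the parabolic subgroup H_i is a
    product of a part below i and a part above i, which commute. Both conditions
    reduce in this way to a few statements about the types 0, 1 and i
    (fork_intersection, fork_common). The essential one, H0_HiH1, says that a
    face of the polytope which contains two adjacent vertices contains the edge
    that joins them; it comes down to the fact that sigma_F lies in the subgroup
    generated by the reflections in the vertices of a face of the cube only if F
    is a vertex of that face (sigma_in), which is seen in the action of W on a
    cycle of length 2 s.

    The order. The group defined by the Coxeter relations [4,3^(n-2)] acts on
    the signed coordinate vectors. Cosets of <tau_0, .., tau_(k-1)> in
    <tau_0, .., tau_k> are represented by 2 k + 2 explicit words, which the
    images of the k-th coordinate vector distinguish; so the group has order
    2^n n! and acts faithfully (seg_order, act_faithful). The order of W is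
    obtained in the same way, one diagonal at a time (W_order). Finally H is the
    subgroup of index 2 of the elements whose component in W is a product of an
    even number of reflections (halvingE).

    The presentation. One has ~beta = rho_0 beta rho_0, and therefore
    ~beta^(-i) beta^i = rho_0 rho_0^(beta^i) is the product of the reflections in
    F_0 and F_0 beta^i. Every vertex of the cube is equivalent to some
    F_0 beta^i under the stabilizer of F_0, where i = n gives the antipode
    (vertex_beta); so the extra relators express the defining relations of W.
    More precisely, let P be the abstract group with the given presentation.
    Exchanging its generators 0 and 1 is an automorphism, and rho_0 may be
    mapped to the corresponding involution of P x| C_2: this extends to a
    morphism from W x| G to P x| C_2 (power2_lift), whose composite with P -> H
    is the inclusion of P.

    The toroidal residue. By the two conditions above it is the coset geometry
    of the subgroup <x_0, x_2, x_1> (coset_residue). The group of {4,4}_(2,2) is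
    shown to consist of at most 8 * 8 normal forms, a product of three commuting
    involutions followed by an element of a dihedral group of order 8; these
    have distinct images in H, where the three involutions are the products of
    the reflection in one vertex of a square with those in the other three
    (torus_decomposition, toroidal_kernel). *)

Set Implicit Arguments.
Unset Strict Implicit.
Unset Printing Implicit Defensive.

Local Open Scope classical_set_scope.
Local Open Scope group_scope.

Notation "g \inG L" := (subgroup_set L g) (at level 70, no associativity).

#[global] Arguments subgroup_set : simpl never.

(** * Morphisms, generated subgroups and presentations *)

Section Morphisms.
Variables (K L : groupType) (f : K -> L).
Hypothesis fM : {morph f : a b / a * b}.

Lemma morph1 : f 1 = 1.
Proof. by apply: (mulgI (f 1)); rewrite -fM !mulg1. Qed.

Lemma morphV a : f a^-1 = (f a)^-1.
Proof. by apply: (mulgI (f a)); rewrite -fM !mulgV morph1. Qed.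

Lemma morphX a k : f (a ^+ k) = f a ^+ k.
Proof. by elim: k => [|k IHk]; rewrite ?expg0 ?morph1 // !expgS fM IHk. Qed.

Lemma morph_injP : (forall a, f a = 1 -> a = 1) -> injective f.
Proof.
move=> k1 a b e; apply: (mulIg b^-1); rewrite mulgV.
by apply: k1; rewrite fM morphV e mulgV.
Qed.

Definition preim_subgroup (A : subgroup L) : subgroup K.
Proof.
exists [set g | f g \inG A] => /=.
- by rewrite morph1; exact: subgroup1.
- by move=> a b ha hb; rewrite fM; exact: subgroupM.
- by move=> a ha; rewrite morphV; exact: subgroupV.
Defined.

End Morphisms.

Section GeneratedTheory.
Variable K : groupType.
Implicit Types (A B : set K) (L : subgroup K).

Lemma mem_gen A a : A a -> a \inG generated A.
Proof. by move=> Aa L; apply. Qed.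

Lemma gen_subgroup A L : A `<=` L -> generated A `<=` L.
Proof. by move=> AL g; apply. Qed.

Lemma gen_mono A B : A `<=` B -> generated A `<=` generated B.
Proof. by move=> AB; apply: gen_subgroup => a /AB; apply: mem_gen. Qed.

Lemma gen_morph (K' : groupType) (f : K -> K') A (L : subgroup K') :
    {morph f : a b / a * b} -> (forall a, A a -> f a \inG L) ->
  forall g, g \inG generated A -> f g \inG L.
Proof. by move=> fM fA; apply: (@gen_subgroup A (preim_subgroup fM L)). Qed.

(** As the generators are involutions, the products of generators already
    form a subgroup, and no inverses occur in the induction. *)
Lemma gen_ind (Q : K -> Prop) A : (forall a, A a -> a * a = 1) ->
    Q 1 -> (forall g a, Q g -> A a -> Q (g * a)) ->
  forall g, g \inG generated A -> Q g.
Proof.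
move=> A2 Q1 QM g Ag.
have S1 h : Q h <-> Q (h * 1) by rewrite mulg1.
have SM a b : (forall h, Q h <-> Q (h * a)) -> (forall h, Q h <-> Q (h * b)) ->
    forall h, Q h <-> Q (h * (a * b)).
  by move=> ha hb h; rewrite mulgA -hb.
have SV a : (forall h, Q h <-> Q (h * a)) -> forall h, Q h <-> Q (h * a^-1).
  by move=> ha h; rewrite (ha (h * a^-1)) mulgVK.
pose S := Subgroup (subgroup_set := [set a | forall h, Q h <-> Q (h * a)]) S1 SM SV.
have /(_ 1) : g \inG S.
  apply: (gen_subgroup _ Ag) => a Aa h /=; split => [Qh|Qha]; first exact: QM.
  by rewrite -[h]mulg1 -(A2 a Aa) mulgA; apply: QM.
by rewrite mul1g => -[+ _]; apply.
Qed.

Lemma gen_commute A (b : K) : (forall a, A a -> commute b a) ->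
  forall g, g \inG generated A -> commute b g.
Proof.
move=> Ab.
pose C := Subgroup (subgroup_set := [set g | commute b g]) (commute1 b)
  (fun x y => @commuteM _ b x y) (fun x => @commuteV _ b x).
exact: (gen_subgroup (L := C)).
Qed.

Lemma gen_commute2 A B : (forall a b, A a -> B b -> commute a b) ->
  forall g h, g \inG generated A -> h \inG generated B -> commute g h.
Proof.
move=> AB g h Ag Bh; apply/commute_sym; apply: gen_commute Ag => a Aa.
by apply/commute_sym; apply: gen_commute Bh => b; apply: AB.
Qed.

Lemma gen_prod A B : (forall a b, A a -> B b -> commute a b) ->
  forall g, g \inG generated (A `|` B) ->
  exists a b, [/\ a \inG generated A, b \inG generated B & g = a * b].
Proof.
move=> AB.
pose S := [set g | exists a b, [/\ a \inG generated A, b \inG generated B & g = a * b]].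
have S1 : S 1 by exists 1, 1; split; rewrite ?mulg1 //; apply: gen_set1.
have SM x y : S x -> S y -> S (x * y).
  move=> [a [b [ha hb ->]]] [c [d [hc hd ->]]]; exists (a * c), (b * d).
  split; [exact: gen_setM|exact: gen_setM|].
  by rewrite !mulgA -(mulgA a b c) -(gen_commute2 AB hc hb) !mulgA.
have SV x : S x -> S x^-1.
  move=> [a [b [ha hb ->]]]; exists a^-1, b^-1.
  split; [exact: gen_setV|exact: gen_setV|].
  by rewrite -invgM (gen_commute2 AB ha hb).
apply: (gen_subgroup (L := Subgroup S1 SM SV)) => x [Ax|Bx] /=.
- by exists x, 1; split; rewrite ?mulg1 //; [exact: mem_gen|exact: gen_set1].
- by exists 1, x; split; rewrite ?mul1g //; [exact: gen_set1|exact: mem_gen].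
Qed.

End GeneratedTheory.

Section ParabolicTheory.
Variables (I : Type) (K : groupType) (x : I -> K).
Implicit Types J : set I.

Lemma mem_par J i : J i -> x i \inG parabolic x J.
Proof. by move=> Ji; apply: mem_gen; exists i. Qed.

Lemma par_mono J J' : J `<=` J' -> parabolic x J `<=` parabolic x J'.
Proof. by move=> JJ'; apply/gen_mono/image_subset. Qed.

Lemma par_sub J (L : subgroup K) : (forall i, J i -> x i \inG L) -> parabolic x J `<=` L.
Proof. by move=> h; apply: gen_subgroup => _ [i Ji <-]; apply: h. Qed.

Lemma par_morph (K' : groupType) (f : K -> K') J (L : subgroup K') :
    {morph f : a b / a * b} -> (forall i, J i -> f (x i) \inG L) ->
  forall g, g \inG parabolic x J -> f g \inG L.
Proof. by move=> fM h; apply: gen_morph => // _ [i Ji <-]; apply: h. Qed.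

End ParabolicTheory.

Section Presentations.
Variables (I : choiceType) (R : set (word I)).

(** A generator and its inverse act in the same way by an involution, so a
    word acts by folding over its letters, whatever the signs. *)
Section Action.
Variables (T : Type) (a : I -> T -> T).

Definition wact (w : word I) (p : T) : T := foldl (fun q l => a l.1 q) p w.

Definition pact (p : T) (g : presented R) : T := wact (repr g) p.

Lemma wact_cat u v p : wact (u ++ v) p = wact v (wact u p).
Proof. exact: foldl_cat. Qed.

Lemma wact_exp u k p : wact (wexp u k) p = iter k (wact u) p.
Proof.
elim: k p => // k IHk p; rewrite iterSr -IHk.
by rewrite /wexp /= wact_cat.
Qed.

Hypothesis aK : forall i, involutive (a i).
Hypothesis aR : forall r p, R r -> wact r p = p.

Lemma wact_weq u v : weq R u v -> forall p, wact u p = wact v p.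
Proof.
elim=> [//|u1 v1 _ IH p|v1 u1 w1 _ IH1 _ IH2 p|u1 v1 i b p|u1 v1 r Rr p].
- by rewrite IH.
- by rewrite IH1.
- by rewrite !wact_cat /wact /= aK.
- by rewrite !wact_cat (aR _ Rr).
Qed.

Lemma pact_class p w : pact p (pclass R w) = wact w p.
Proof. by apply: wact_weq; apply: weq_repr. Qed.

Lemma pact1 p : pact p 1 = p.
Proof. exact: (pact_class p [::]). Qed.

Lemma pactM p g h : pact p (g * h) = pact (pact p g) h.
Proof. by rewrite -[g]pclass_repr -[h]pclass_repr -piM !pact_class wact_cat. Qed.

Lemma pact_gen p i : pact p (pgen R i) = a i p.
Proof. exact: pact_class. Qed.

End Action.

Section Lift.
Variables (K : groupType) (y : I -> K).

Definition wval (w : word I) : K :=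
  \prod_(l <- w) (if l.2 then y l.1 else (y l.1)^-1).

Lemma wval_cat u v : wval (u ++ v) = wval u * wval v.
Proof. by rewrite /wval big_cat. Qed.

Lemma wval_exp u k : wval (wexp u k) = wval u ^+ k.
Proof.
elim: k => [|k IHk]; first by rewrite /wval big_nil.
by rewrite expgS -IHk /wexp /= wval_cat.
Qed.

Lemma wval_letter i : wval (letter i) = y i.
Proof. by rewrite /wval big_seq1. Qed.

Lemma wval_inv w : wval (winv w) = (wval w)^-1.
Proof.
elim: w => [|[i b] w IHw]; first by rewrite /winv /wval /= !big_nil invg1.
rewrite /winv /= rev_cons -cats1 wval_cat IHw -[(i, b) :: w]cat1s [wval (_ ++ w)]wval_cat invgM.
by congr (_ * _); rewrite /wval !big_seq1 /=; case: b; rewrite //= invgK.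
Qed.

Lemma wval_coxeter i j k : wval (wexp (letter i ++ letter j) k) = (y i * y j) ^+ k.
Proof. by rewrite wval_exp wval_cat !wval_letter. Qed.

Lemma wval_seq (s : seq I) : wval [seq (i, true) | i <- s] = \prod_(i <- s) y i.
Proof. by rewrite /wval big_map. Qed.

Lemma wval_class (f : presented R -> K) w :
    {morph f : a b / a * b} -> (forall i, f (pgen R i) = y i) ->
  f (pclass R w) = wval w.
Proof.
move=> fM fg; elim: w => [|[i b] w IHw]; first by rewrite /wval big_nil (morph1 fM).
rewrite -cat1s piM fM wval_cat IHw; congr (_ * _); rewrite /wval big_seq1 /=.
by case: b; rewrite ?pi_inv_letter ?(morphV fM) -fg.
Qed.

Lemma presented_lift : (forall r, R r -> wval r = 1) ->
  exists f : presented R -> K,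
    {morph f : a b / a * b} /\ forall i, f (pgen R i) = y i.
Proof.
move=> yR.
have E u v : weq R u v -> wval u = wval v.
  elim=> // [b a c _ -> _ ->|a b i e|a b r Rr] //.
  - rewrite /wval !big_cat !big_cons /=; congr (_ * _).
    by rewrite mulgA; case: e => /=; [rewrite mulgV|rewrite mulVg]; rewrite mul1g.
  - by rewrite !wval_cat (yR _ Rr) mul1g.
exists (fun g => wval (repr g)); split=> [a b|i].
- by rewrite -wval_cat; apply: E; rewrite -{1}[a]pclass_repr -{1}[b]pclass_repr -piM; exact: weq_repr.
- by rewrite -wval_letter; apply: E; apply: weq_repr.
Qed.

End Lift.

Lemma presented_morph_eq (K : groupType) (f h : presented R -> K) :
    {morph f : a b / a * b} -> {morph h : a b / a * b} ->
  (forall i, f (pgen R i) = h (pgen R i)) -> f =1 h.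
Proof.
move=> fM hM e; apply: presented_ind => [|i a IHa|i a IHa].
- by rewrite !morph1.
- by rewrite fM hM IHa e.
- by rewrite fM hM IHa !morphV // e.
Qed.

Lemma pgen_full g : g \inG parabolic (pgen R) setT.
Proof.
elim/presented_ind: g => [|i g IHg|i g IHg]; first exact: gen_set1.
- by apply: gen_setM => //; apply: mem_par.
- by apply: gen_setM => //; apply: gen_setV; apply: mem_par.
Qed.

End Presentations.

Arguments pact {I R T} a p g.

Lemma lift_presentation (I : choiceType) (R : set (word I)) (K : groupType) (x : I -> K)
    (f : presented R -> K) :
    {morph f : a b / a * b} -> (forall i, f (pgen R i) = x i) -> (forall i, x i * x i = 1) ->
  injective f -> has_presentation (parabolic x setT) x R.
Proof.
move=> fM fx x2 finj; exists f; split=> //; apply/seteqP; split=> [_ [p _ <-]|].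
  by move: p (pgen_full p); apply: par_morph => // i _; rewrite fx; apply: mem_par.
apply: gen_ind => [_ [i _ <-]||_ _ [p _ <-] [i _ <-]]; first exact: x2.
- by exists 1; rewrite ?(morph1 fM).
- by exists (p * pgen R i); rewrite // fM fx.
Qed.

(** * Orders of finite subsets, by counting cosets *)

(** An order is given with an enumeration by a finite type: such
    enumerations can be multiplied and restricted. *)
Definition has_order (K : Type) (A : set K) (N : nat) : Prop :=
  exists (T : finType) (f : T -> K),
    [/\ injective f, forall g, A g <-> exists t, f t = g & #|T| = N].

Lemma has_order_card (K : Type) (A : set K) N : has_order A N -> (A #= `I_N)%card.
Proof.
move=> [T [f [finj fA <-]]].
have -> : A = f @` setT.
  by apply/seteqP; split=> g; [move/fA => -[t <-]; exists t|case=> t _ <-; apply/fA; exists t].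
apply: card_eq_trans (inj_card_eq _) _; first by move=> a b _ _; apply: finj.
apply: (card_eq_trans (B := [set: 'I_#|T|])); last by rewrite card_eq_sym; apply: card_II.
have -> : [set: 'I_#|T|] = enum_rank @` [set: T].
  by apply/seteqP; split=> // i _; exists (enum_val i) => //; apply: enum_valK.
by rewrite card_eq_sym; apply: inj_card_eq => a b _ _; apply: enum_rank_inj.
Qed.

Lemma has_order1 (K : groupType) : has_order [set (1 : K)] 1.
Proof.
exists unit, (fun=> 1); split; rewrite ?card_unit //; first by case=> -[].
by move=> g; split=> [->|[_ <-]] //; exists tt.
Qed.

Lemma has_order_prod (K L : Type) (A : set K) (B : set L) N M :
  has_order A N -> has_order B M -> has_order [set p : K * L | A p.1 /\ B p.2] (N * M).
Proof.
move=> [T [f [finj fA <-]]] [U [h [hinj hB <-]]].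
exists (T * U)%type, (fun p => (f p.1, h p.2)); split; last exact: card_prod.
- by move=> [a b] [c d] [/finj -> /hinj ->].
- move=> [a b]; split=> [[/= /fA[t <-] /hB[u <-]]|[[t u] /= [<- <-]]].
    by exists (t, u).
  by split=> /=; [apply/fA; exists t|apply/hB; exists u].
Qed.

(** The separation hypothesis is typically checked on an invariant of the
    representatives that A does not change, such as the image of a point
    fixed by A. *)
Lemma has_order_cosets (K : groupType) (A A' : subgroup K) (r : nat -> K) N M :
    has_order A N -> A `<=` A' -> (forall i, (i < M)%N -> r i \inG A') ->
    (forall g, g \inG A' -> exists a i, [/\ a \inG A, (i < M)%N & g = a * r i]) ->
    (forall a i j, a \inG A -> (i < M)%N -> (j < M)%N -> r i = a * r j -> i = j) ->
  has_order A' (N * M).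
Proof.
move=> [T [f [finj fA <-]]] AA' Ar cov sep.
exists (T * 'I_M)%type, (fun p : T * 'I_M => f p.1 * r p.2); split; last by rewrite card_prod card_ord.
- move=> [t i] [u j] /= e.
  have Aa : (f t)^-1 * f u \inG A.
    apply: subgroupM; last by apply/fA; exists u.
    by apply: subgroupV; apply/fA; exists t.
  have ij : i = j.
    apply/val_inj/(sep _ _ _ Aa (ltn_ord i) (ltn_ord j)).
    by rewrite -mulgA -e mulKg.
  by subst j; move/mulIg/finj: e => ->.
- move=> g; split=> [/cov[a [i [/fA[t <-] iM ->]]]|[[t i] /= <-]].
    by exists (t, Ordinal iM).
  by apply: subgroupM; [apply/AA'/fA; exists t|exact: Ar].
Qed.

(** Right multiplication by c exchanges A and its complement. *)
Lemma has_order_half (K : groupType) (A : subgroup K) (c : K) N :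
    has_order [set: K] N -> (forall g, g * c \inG A <-> ~ g \inG A) ->
  has_order A N./2.
Proof.
move=> [T [f [finj fA <-]]] Ac.
have [h hK] : exists h : K -> T, forall g, f (h g) = g.
  have /choice[h hK] g : exists t, f t = g by exact: (fA g).1 I.
  by exists h.
pose S := [set t : T | `[< f t \inG A >]]%SET.
exists {t | t \in S}, (fun t => f (sval t)); split.
- by move=> a b /finj/val_inj.
- move=> g; split=> [Ag|[[t tS] /= <-]]; last by move: tS; rewrite inE => /asboolP.
  have hS : h g \in S by rewrite inE hK; apply/asboolP.
  by exists (exist _ (h g) hS) => /=; rewrite hK.
rewrite card_sig.
pose m t := h (f t * c).
have minj : injective m.
  by move=> a b /(congr1 f); rewrite !hK => /mulIg/finj.
have e : #|S| = #|(~: S)%SET|.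
  rewrite -(card_imset _ minj); apply: eq_card => t.
  have inS u : (u \in S) = `[< f u \inG A >] by rewrite finset.in_set.
  rewrite finset.in_setC inS; apply/imsetP/asboolPn => [[u + ->] /=|nA].
    by rewrite inS /m hK => /asboolP Au /Ac/(_ Au).
  exists (h (f t * c^-1)); last by apply: finj; rewrite /m !hK mulgVK.
  rewrite inS hK; apply/asboolP; apply: contrapT => /Ac.
  by rewrite mulgVK.
have -> : #|[pred x in S]| = #|S| by apply: eq_card.
by rewrite -(cardsC S) -e addnn doubleK.
Qed.

(** * Coset geometries *)

Lemma gen_ind_l (K : groupType) (Q : K -> Prop) (A : set K) :
    (forall a, A a -> a * a = 1) ->
    Q 1 -> (forall g a, Q g -> A a -> Q (a * g)) ->
  forall g, g \inG generated A -> Q g.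
Proof.
move=> A2 Q1 QM g Ag; rewrite -[g]invgK.
apply: (gen_ind (Q := fun h => Q h^-1) A2) (subgroupV Ag); first by rewrite invg1.
move=> h a Qh Aa; rewrite invgM (mulg1_eq (A2 a Aa)); exact: QM.
Qed.

Lemma rcosetE (K : groupType) (A : set K) g z : rcoset A g z = A (z * g^-1).
Proof.
rewrite propeqE; split=> [[a Aa <-]|Az]; first by rewrite mulgK.
by exists (z * g^-1) => //; rewrite mulgVK.
Qed.

Lemma rcoset_id (K : groupType) (L : subgroup K) g : rcoset L g g.
Proof. by rewrite rcosetE mulgV; apply: subgroup1. Qed.

Lemma bij_exists (T U : Type) (f : T -> U) :
  injective f -> (forall y, exists x, f x = y) -> bijective f.
Proof. by move=> finj /choice[g gK]; exists g => // x; apply: finj; rewrite gK. Qed.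

Section CosetElements.
Variables (I : Type) (K : groupType) (x : I -> K).

Let H := parabolic x setT.
Let Hi i := parabolic x [set j | j <> i].
Let X := coset_system H Hi.

(** Total in g, so that no proof of membership has to be carried along; the
    base element is a default value outside H. *)
Definition celt (i : I) (g : K) : X :=
  match pselect (g \inG H) with
  | left hg => @CosetElt I K H Hi i _ (ex_intro2 _ _ g hg (erefl (rcoset (Hi i) g)))
  | right _ => base_elt H Hi i
  end.

Lemma typ_elt i g : typ (celt i g) = i.
Proof. by rewrite /celt; case: pselect. Qed.

Lemma set_elt i g : g \inG H -> ce_set (celt i g) = rcoset (Hi i) g.
Proof. by rewrite /celt; case: pselect. Qed.

Lemma Hi_sub i : Hi i `<=` H.
Proof. exact: par_mono. Qed.

Lemma elt_of (e : X) z : ce_set e z -> z \inG H /\ e = celt (typ e) z.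
Proof.
case: e => i S [h hh es] /= Sz.
have Hz : z \inG H.
  move: Sz; rewrite es => -[a ha <-]; apply: subgroupM => //; exact: Hi_sub ha.
split=> //; apply: coset_inc_typ; last by rewrite [RHS]typ_elt.
by exists z; split=> //=; rewrite set_elt //; apply: rcoset_id.
Qed.

Lemma elt_ex (e : X) : exists2 z, z \inG H & e = celt (typ e) z.
Proof.
have [z [ez _]] := coset_inc_refl e.
by have [Hz ->] := elt_of ez; exists z; rewrite ?typ_elt.
Qed.

Lemma eltE i g h : g \inG H -> h \inG H -> celt i g = celt i h <-> h * g^-1 \inG Hi i.
Proof.
move=> Hg Hh; split=> [e|e].
  by rewrite -[_ \inG _](rcosetE (Hi i) g h) -set_elt // e set_elt //; apply: rcoset_id.
have [|_ ->] := @elt_of (celt i g) h; last by rewrite typ_elt.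
by rewrite set_elt // rcosetE.
Qed.

Lemma elt_inc i j g : g \inG H -> inc (celt i g) (celt j g).
Proof. by move=> Hg; exists g; rewrite !set_elt //; split; apply: rcoset_id. Qed.

End CosetElements.

Section CosetGeometry.
Variables (I : finType) (K : groupType) (x : I -> K).

Let H := parabolic x setT.
Let Hi i := parabolic x [set j | j <> i].
Let X := coset_system H Hi.
Local Notation celt := (celt x).

Lemma tr_subproof (h : K) (hh : h \inG H) (e : X) :
  exists2 g, g \inG H & rcoset (ce_set e) h = rcoset (Hi (ce_typ e)) g.
Proof.
case: e => i S [g hg /= ->]; exists (g * h); first exact: subgroupM.
exact: rcosetM.
Qed.

Definition translate h (hh : h \inG H) (e : X) : X := CosetElt (tr_subproof hh e).

Lemma translate_elt h (hh : h \inG H) i g : g \inG H -> translate hh (celt i g) = celt i (g * h).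
Proof.
move=> hg; have [|_ ->] := @elt_of _ _ x (translate hh (celt i g)) (g * h).
  by rewrite /= set_elt // rcosetM; apply: rcoset_id.
by congr celt; apply: typ_elt.
Qed.

Lemma translate_auto h (hh : h \inG H) : type_automorphism (translate hh).
Proof.
have trK g k (hg : g \inG H) (hk : k \inG H) : g * k = 1 -> cancel (translate hg) (translate hk).
  move=> gk e; have [z Hz ->] := elt_ex e.
  rewrite !translate_elt //; last exact: subgroupM.
  by rewrite -mulgA gk mulg1.
have hV := subgroupV hh.
have trM g (hg : g \inG H) a b : inc a b -> inc (translate hg a) (translate hg b).
  by move=> [z [az bz]]; exists (z * g); split; exists z.
split=> // [|a b].
  by exists (translate hV); apply: trK; rewrite ?mulgV ?mulVg.
split; last exact: trM.
by move/(trM _ hV); rewrite !trK ?mulgV.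
Qed.

Hypothesis x2 : forall i, x i * x i = 1.
Hypothesis xN1 : forall i, x i <> 1.

(** The intersection property makes the stabilizer of a flag the parabolic
    subgroup of the missing types. *)
Hypothesis IP : forall (J : set I) g, g \inG H ->
  (forall j, J j -> g \inG Hi j) -> g \inG parabolic x (~` J).

(** The flag condition makes every flag consist of cosets of one element, so
    that translations are transitive on the flags of each type. *)
Hypothesis FC : forall (J : set I) (c : I -> K), (forall j, J j -> c j \inG H) ->
  (forall i j, J i -> J j -> exists z, rcoset (Hi i) (c i) z /\ rcoset (Hi j) (c j) z) ->
  exists2 z, z \inG H & forall j, J j -> rcoset (Hi j) (c j) z.

Lemma flag_common (F : set X) : is_flag F ->
  exists2 z, z \inG H & forall e, F e -> ce_set e z.
Proof.
move=> flF.
have /choice[c hc] : forall j, exists g, forall e, F e -> typ e = j ->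
    g \inG H /\ e = celt j g.
  move=> j; have [[e Fe ej]|nF] := pselect (exists2 e, F e & typ e = j); last first.
    by exists 1 => e Fe ej; case: nF; exists e.
  have [g Hg eE] := elt_ex e; exists g => e' Fe' e'j; split=> //.
  by rewrite -ej -eE; apply: inc_typ; [apply: flF|rewrite ej].
have [j [e Fe <-]|i j [e Fe ei] [e' Fe' ej]|z Hz Jz] := @FC (typ @` F) c.
- by have [] := hc (typ e) e Fe erefl.
- have [Hc eE] := hc i e Fe ei; have [Hc' eE'] := hc j e' Fe' ej.
  have [z [ez ez']] := flF _ _ Fe Fe'; exists z.
  by move: ez ez'; rewrite eE eE' !set_elt.
- exists z => // e Fe; have [Hc eE] := hc (typ e) e Fe erefl.
  by rewrite eE set_elt //; apply: Jz; exists e.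
Qed.

Definition flag (J : set I) (z : K) : set X := [set celt j z | j in J].

Lemma flagE (F : set X) : is_flag F ->
  exists2 z, z \inG H & F = flag (typ @` F) z.
Proof.
move=> /flag_common[z Hz Fz]; exists z => //.
have E e : F e -> e = celt (typ e) z by move/Fz/elt_of => [].
apply/seteqP; split=> e; first by move=> Fe; exists (typ e); [exists e|rewrite -E].
by move=> [_ [e' Fe' <-] <-]; rewrite -E.
Qed.

Lemma flag_flag J z : z \inG H -> is_flag (flag J z).
Proof. by move=> Hz _ _ [i _ <-] [j _ <-]; apply: elt_inc. Qed.

Lemma flag_typ J z : typ @` flag J z = J.
Proof.
apply/seteqP; split=> [_ [_ [j Jj <-] <-]|j Jj]; first by rewrite typ_elt.
by exists (celt j z); rewrite ?typ_elt //; exists j.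
Qed.

Lemma flag_elt J z j w : z \inG H -> J j -> flag J z (celt j w) -> celt j w = celt j z.
Proof.
move=> Hz Jj [i Ji e]; rewrite -e; congr celt.
by move/(congr1 typ): e; rewrite !typ_elt.
Qed.

Lemma flag_chamber z : z \inG H -> is_chamber (flag setT z).
Proof.
move=> Hz; split; first exact: flag_flag.
by move=> i; exists (celt i z); [exists i|apply: typ_elt].
Qed.

Lemma chamberE (C : set X) : is_chamber C -> exists2 z, z \inG H & C = flag setT z.
Proof.
move=> [/flagE[z Hz CE] Ct]; exists z => //; rewrite CE; congr flag.
by apply/seteqP; split=> // i _; have [e Ce <-] := Ct i; exists e.
Qed.

Lemma elt_eq_par (J : set I) z w : z \inG H -> w \inG H ->
  (forall j, J j -> celt j z = celt j w) -> exists2 a, a \inG parabolic x (~` J) & w = a * z.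
Proof.
move=> Hz Hw e; exists (w * z^-1); last by rewrite mulgVK.
apply: IP => [|j Jj]; first by apply: subgroupM => //; apply: subgroupV.
by apply/eltE => //; apply: e.
Qed.

Lemma par0 : forall g, g \inG parabolic x set0 -> g = 1.
Proof. by apply: gen_ind => // [a [i []]|g a _ [i []]]. Qed.

Lemma par1 i : forall g, g \inG parabolic x [set i] -> g = 1 \/ g = x i.
Proof.
apply: gen_ind => [_ [j _ <-]||g _ gi [_ -> <-]]; [exact: x2|by left|].
by case: gi => ->; rewrite ?mul1g ?x2; [right|left].
Qed.

Lemma x_notin i : ~ x i \inG Hi i.
Proof.
move=> xi; apply: (xN1 (i := i)); apply: par0; rewrite -setCT; apply: IP.
  exact: mem_par.
by move=> j _; have [<- //|ij] := pselect (i = j); apply: mem_par.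
Qed.

Lemma coset_is_geometry : is_geometry X.
Proof.
move=> F /flagE[z Hz ->]; exists (flag setT z); first exact: flag_chamber.
by apply: image_subset.
Qed.

Lemma x_in i : x i \inG H.
Proof. exact: mem_par. Qed.

Lemma elt_x_neq i j z : z \inG H -> i <> j -> celt i (x j * z) = celt i z.
Proof.
move=> Hz ij; apply/esym/eltE => //; first by apply: subgroupM => //; apply: x_in.
by rewrite mulgK; apply: mem_par => /esym.
Qed.

Lemma elt_x_eq i z : z \inG H -> celt i (x i * z) <> celt i z.
Proof.
move=> Hz /esym/eltE; rewrite mulgK => h; apply: (x_notin (i := i)).
by apply: h => //; apply: subgroupM => //; apply: x_in.
Qed.

(** By the intersection property the stabilizer of such a flag is <x_i> =
    {1, x_i}, which permutes the chambers through the flag simply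
    transitively. *)
Lemma coset_is_thin : is_thin X.
Proof.
move=> F flF.
rewrite /corank => /eqP; set S := finset _ => /cards1P[i Si].
have JE : typ @` F = [set j | j <> i].
  apply/seteqP; split=> j.
    move=> Fj ji; have : j \in S by rewrite Si ji finset.in_set1.
    by rewrite finset.in_set => /asboolPn; apply.
  move=> ji; apply: contrapT => Fj.
  have : j \in S by rewrite finset.in_set; apply/asboolPn.
  by rewrite Si finset.in_set1 => /eqP.
have [z Hz] := flagE flF; rewrite {}JE => FE.
have Hxz : x i * z \inG H by apply: subgroupM => //; apply: x_in.
apply: has_order_card.
exists bool, (fun b => flag setT (if b then x i * z else z)).
have e01 : flag setT (x i * z) <> flag setT z.
  move=> e; apply: (elt_x_eq Hz (i := i)).
  by apply: (@flag_elt setT) => //; rewrite -e; exists i.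
split; last by rewrite card_bool.
- by move=> [] [] // /esym.
move=> C; split; last first.
  move=> [b <-]; split; first by apply: flag_chamber; case: b.
  move=> e; rewrite FE => -[j ji <-]; exists j => //.
  by case: b => //; apply: elt_x_neq.
move=> [/chamberE[w Hw ->] FC'].
have [j ji|a] := @elt_eq_par [set j | j <> i] z w Hz Hw.
  by apply: (@flag_elt setT) => //; apply: FC'; rewrite FE; exists j.
have -> : ~` [set j | j <> i] = [set i].
  by apply/seteqP; split=> j; [exact: contrapT|move=> -> /(_ erefl)].
move/par1 => [->|->] ->; [exists false|exists true] => //.
by rewrite mul1g.
Qed.

Lemma par_corank (J : set I) : #|finset (fun i : I => ~~ `[< J i >])| >= 2 ->
  (exists i, ~ J i) /\ forall k, exists2 i, ~ J i & i <> k.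
Proof.
move=> c2; split=> [|k].
  have /card_gt0P[i] := ltnW c2.
  by rewrite finset.in_set => /asboolPn Ji; exists i.
apply: contrapT => nex.
suff : #|finset (fun i : I => ~~ `[< J i >])| <= 1 by rewrite leqNgt c2.
rewrite -(cards1 k); apply: subset_leq_card; apply/fintype.subsetP => i.
rewrite finset.in_set finset.in_set1 => /asboolPn Ji; apply/eqP.
by apply: contrapT => ik; apply: nex; exists i.
Qed.

(** Multiplication by the generator x_k does not change the coset of a type
    other than k. Since there is always another missing type, one can pass
    to a coset of that type, remove a letter x_k, and so walk to the base
    element. *)
Lemma coset_is_residually_connected : is_residually_connected X.
Proof.
move=> F flF cF.
have [z Hz] := flagE flF; move: cF; rewrite /corank.
move: (typ @` F) => J /par_corank[[i0 Ji0] cJ] FE.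
have resE (e : residue_elt F) : exists i a,
    [/\ ~ J i, a \inG parabolic x (~` J) & sval e = celt i (a * z)].
  case: e => e [nFe eF] /=.
  have flFe : is_flag (F `|` [set e]).
    move=> a b [Fa|->] [Fb|->]; [exact: flF|apply: inc_sym; exact: eF|exact: eF|exact: inc_refl].
  have [w Hw Fw] := flag_common flFe.
  have [_ eE] := elt_of (Fw e (or_intror erefl)).
  have [j Jj|a Ja wE] := @elt_eq_par J z w Hz Hw.
    have Fj : F (celt j z) by rewrite FE; exists j.
    by have [_] := elt_of (Fw _ (or_introl Fj)); rewrite typ_elt.
  exists (typ e), a; split=> //; last by rewrite -wE.
  move=> Jt; apply: nFe; rewrite FE eE; exists (typ e) => //.
  have Fj : F (celt (typ e) z) by rewrite FE; exists (typ e).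
  by have [_] := elt_of (Fw _ (or_introl Fj)); rewrite typ_elt.
have parH a : a \inG parabolic x (~` J) -> a \inG H by apply: par_mono.
have res i a : ~ J i -> a \inG parabolic x (~` J) ->
    exists e : residue F, sval e = celt i (a * z).
  move=> Ji Ja; have Haz : a * z \inG H by apply: subgroupM => //; apply: parH.
  suff h : ~ F (celt i (a * z)) /\ forall y, F y -> inc (celt i (a * z)) y.
    by exists (exist (fun e : X => ~ F e /\ forall y, F y -> inc e y) _ h).
  split=> [|y]; rewrite FE => -[j Jj].
    by move/(congr1 typ); rewrite !typ_elt => ji; apply: Ji; rewrite -ji.
  move=> <-; have <- : celt j (a * z) = celt j z.
    apply/esym/eltE => //; rewrite mulgK; apply: par_mono Ja => k /= Jk kj.
    by apply: Jk; rewrite kj.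
  exact: elt_inc.
have conn1 i j a (e e' : residue F) : a \inG parabolic x (~` J) ->
    sval e = celt i (a * z) -> sval e' = celt j (a * z) ->
    clos_refl_trans _ inc e e'.
  move=> Ja ei ej; apply: rt_step; rewrite /= ei ej.
  by apply: elt_inc; apply: subgroupM => //; apply: parH.
have J1 : (1 : K) \inG parabolic x (~` J) by apply: gen_set1.
have [e0 e0E] := res i0 1 Ji0 J1.
have conn0 a : a \inG parabolic x (~` J) ->
    a \inG parabolic x (~` J) /\ forall i (e : residue F), ~ J i ->
    sval e = celt i (a * z) ->
    clos_refl_trans (residue F) inc e e0 /\ clos_refl_trans (residue F) inc e0 e.
  move: a; apply: gen_ind_l => [_ [k _ <-]||a _ [Ja IH] [k Jk <-]].
  - exact: x2.
  - by split=> // i e Ji eE; split; apply: conn1 J1 _ _; eassumption.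
  - have Jka : x k * a \inG parabolic x (~` J) by apply: subgroupM => //; apply: mem_par.
    split=> // i e Ji eE; have [i' Ji' ik] := cJ k.
    have [e' e'E] := res i' a Ji' Ja; have [c1 c2] := IH i' e' Ji' e'E.
    have {}e'E : sval e' = celt i' (x k * a * z).
      by rewrite e'E -mulgA elt_x_neq //; apply: subgroupM => //; apply: parH.
    split; [apply: rt_trans (conn1 _ _ _ _ _ Jka eE e'E) c1|].
    exact: rt_trans c2 (conn1 _ _ _ _ _ Jka e'E eE).
move=> e e'; have [i [a [Ji Ja eE]]] := resE e; have [j [b [Jj Jb e'E]]] := resE e'.
have [_ /(_ _ _ Ji eE)[c1 _]] := conn0 a Ja.
have [_ /(_ _ _ Jj e'E)[_ c2]] := conn0 b Jb.
exact: rt_trans c1 c2.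
Qed.

Lemma coset_is_flag_transitive : is_flag_transitive X.
Proof.
move=> F F' /flagE[z Hz ->] /flagE[z' Hz' ->]; rewrite !flag_typ => ->.
have hh : z^-1 * z' \inG H by apply: subgroupM => //; apply: subgroupV.
exists (translate hh); first exact: translate_auto.
have E j : translate hh (celt j z) = celt j z' by rewrite translate_elt // mulVKg.
apply/seteqP; split=> [_ [_ [j Jj <-] <-]|_ [j Jj <-]]; first by rewrite E; exists j.
by exists (celt j z); [exists j|exact: E].
Qed.

Theorem coset_regular_hypertope : regular_hypertope X.
Proof.
split; [exact: coset_is_geometry|exact: coset_is_thin| |exact: coset_is_flag_transitive].
exact: coset_is_residually_connected.
Qed.

(** Once the image of the base chamber is known, thinness forces the image
    of every adjacent chamber, hence of all of them. *)
Theorem coset_automorphism_group : automorphism_group_is H Hi.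
Proof.
split=> [h hh|f [fbij ft fi]]; first by exists (translate hh); [apply: translate_auto|].
have fch z : z \inG H -> exists2 w, w \inG H & forall i, f (celt i z) = celt i w.
  move=> Hz; have fl : is_flag (f @` flag setT z).
    by move=> _ _ [_ [i _ <-] <-] [_ [j _ <-] <-]; apply/fi/elt_inc.
  have [w Hw Fw] := flag_common fl; exists w => // i.
  have [|_ ->] := @elt_of _ _ x (f (celt i z)) w; last by rewrite ft typ_elt.
  by apply: Fw; exists (celt i z) => //; exists i.
have [h Hh h1] := fch 1 (subgroup1 H).
have fE g : g \inG H -> g \inG H /\ forall i, f (celt i g) = celt i (g * h).
  move: g; apply: gen_ind_l => [_ [k _ <-]||g _ [Hg IH] [k _ <-]].
  - exact: x2.
  - by split=> [|i]; [apply: subgroup1|rewrite mul1g].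
  have Hxg : x k * g \inG H by apply: subgroupM => //; apply: x_in.
  split=> // i; have [w Hw wE] := fch _ Hxg.
  have [j jk|a] := @elt_eq_par [set j | j <> k] (g * h) w (subgroupM Hg Hh) Hw.
    by rewrite -IH -wE elt_x_neq.
  have -> : ~` [set j | j <> k] = [set k].
    by apply/seteqP; split=> j; [exact: contrapT|move=> -> /(_ erefl)].
  move/par1=> [->|->] wa; last by rewrite wE wa mulgA.
  case: (@elt_x_eq k g) => //; apply: (bij_inj fbij).
  by rewrite wE IH wa mul1g.
exists h; split=> [|h' [Hh' fh']].
  split=> // e; have [z Hz eE] := elt_ex e.
  split; first exact: ft.
  have [_ fz] := fE z Hz.
  by rewrite eE fz !set_elt ?rcosetM //; apply: subgroupM.
have [j _|a] := @elt_eq_par setT h' h Hh' Hh.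
  have [_] := fh' (celt j 1).
  rewrite h1 (set_elt _ Hh) (set_elt _ (subgroup1 H)) rcosetM mul1g => e.
  have [|_ ->] := @elt_of _ _ x (celt j h') h; last by rewrite typ_elt.
  by rewrite set_elt // -e; apply: rcoset_id.
by rewrite setCT => /par0 -> ->; rewrite mul1g.
Qed.

End CosetGeometry.

Section Residue.
Variables (I : finType) (K : groupType) (x : I -> K).

Let H := parabolic x setT.
Let Hi i := parabolic x [set j | j <> i].

Hypothesis x2 : forall i, x i * x i = 1.
Hypothesis IP : forall (J : set I) g, g \inG H ->
  (forall j, J j -> g \inG Hi j) -> g \inG parabolic x (~` J).
Hypothesis FC : forall (J : set I) (c : I -> K), (forall j, J j -> c j \inG H) ->
  (forall i j, J i -> J j -> exists z, rcoset (Hi i) (c i) z /\ rcoset (Hi j) (c j) z) ->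
  exists2 z, z \inG H & forall j, J j -> rcoset (Hi j) (c j) z.

Variables (I' : Type) (P : groupType) (p : I' -> P) (k : I' -> I) (phi : P -> K).
Variable J : set I.
Hypothesis kinj : injective k.
Hypothesis kJ : ~` J = range k.
Hypothesis phiM : {morph phi : a b / a * b}.
Hypothesis phi_inj : injective phi.
Hypothesis phip : forall j, phi (p j) = x (k j).
Hypothesis pfull : forall q, q \inG parabolic p setT.

Lemma par_image (J' : set I') g : g \inG parabolic x (k @` J') <->
  exists2 q, q \inG parabolic p J' & phi q = g.
Proof.
split=> [|[q + <-]]; last first.
  by move: q; apply: par_morph => // j Jj; rewrite phip; apply: mem_par; exists j.
move: g; apply: gen_ind => [_ [i _ <-]||_ _ [q Jq <-] [_ [j Jj <-] <-]].
- exact: x2.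
- by exists 1; [apply: subgroup1|apply: morph1].
- exists (q * p j); last by rewrite phiM phip.
  by apply: subgroupM => //; apply: mem_par.
Qed.

Lemma phi_max j q : q \inG parabolic p [set j' | j' <> j] <-> phi q \inG Hi (k j).
Proof.
split=> hq.
  move: q hq; apply: par_morph => // j' jj; rewrite phip; apply: mem_par => /kinj.
  exact: jj.
have Yq : phi q \inG parabolic x (~` J) by rewrite kJ; apply/par_image; exists q.
have : phi q \inG parabolic x (~` (J `|` [set k j])).
  apply: IP => [|i [Ji|->//]]; first exact: par_mono Yq.
  by apply: par_mono Yq => i' /= Ji' ii; apply: Ji'; rewrite ii.
rewrite setCU kJ.
have -> : range k `&` ~` [set k j] = k @` [set j' | j' <> j].
  apply/seteqP; split=> [_ [[j' _ <-] jj]|_ [j' jj <-]].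
    by exists j' => // ej; apply: jj; rewrite ej.
  by split; [exists j'|move=> /kinj].
by move/par_image => [q' hq' /phi_inj <-].
Qed.

Let F : set (coset_system H Hi) := [set base_elt H Hi i | i in J].

Lemma base_eltE i : base_elt H Hi i = celt x i 1.
Proof. by have [|_] := @elt_of I K x (base_elt H Hi i) 1; first exact: subgroup1. Qed.

Lemma residueE (e : residue F) : exists s : I' * P, sval e = celt x (k s.1) (phi s.2).
Proof.
case: e => e [nFe eF] /=.
have flFe : is_flag (F `|` [set e]).
  have flF a b : F a -> F b -> inc a b.
    by move=> [i _ <-] [j _ <-]; rewrite !base_eltE; apply: elt_inc; apply: subgroup1.
  by move=> a b [Fa|->] [Fb|->]; [exact: flF|apply: inc_sym; exact: eF|exact: eF|exact: inc_refl].
have [w Hw Fw] := flag_common FC flFe.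
have [_ eE] := elt_of (Fw e (or_intror erefl)).
have hJ j : J j -> w \inG Hi j.
  move=> Jj; have Fj : F (base_elt H Hi j) by exists j.
  exact: Fw (or_introl Fj).
have : (~` J) (typ e).
  move=> Jt; apply: nFe; exists (typ e) => //; rewrite base_eltE eE typ_elt.
  by apply/eltE => //; [exact: subgroup1|rewrite invg1 mulg1; apply: hJ].
rewrite kJ => -[j _ jE].
have : w \inG parabolic x (~` J) by apply: IP.
rewrite kJ => /par_image[q _ qE].
by exists (j, q); rewrite jE qE.
Qed.

Lemma phi_in q : phi q \inG parabolic x (~` J).
Proof. by rewrite kJ; apply/par_image; exists q. Qed.

Lemma phi_H q : phi q \inG H.
Proof. by apply: par_mono (phi_in q). Qed.

Lemma phi_Hi j q : J j -> phi q \inG Hi j.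
Proof. by move=> Jj; apply: par_mono (phi_in q) => i Ji /= ij; apply: Ji; rewrite ij. Qed.

Lemma residue_inc j q j' q' :
  inc (celt x (k j) (phi q)) (celt x (k j') (phi q')) <-> inc (celt p j q) (celt p j' q').
Proof.
have cosetE i r w : rcoset (parabolic p [set i' | i' <> i]) r w <->
    rcoset (Hi (k i)) (phi r) (phi w).
  by rewrite !rcosetE -(morphV phiM) -phiM; apply: phi_max.
split; last first.
  move=> [w [w1 w2]]; exists (phi w); rewrite !set_elt; try exact: phi_H.
  by move: w1 w2; rewrite !set_elt // => /cosetE ? /cosetE ?.
move=> h.
have flFe : is_flag (F `|` [set celt x (k j) (phi q); celt x (k j') (phi q')]).
  have hF a i r : F a -> inc a (celt x i (phi r)).
    move=> [j0 Jj0 <-]; exists (phi r); rewrite set_elt; last exact: phi_H.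
    by split; [apply: phi_Hi|apply: rcoset_id].
  have flF a b : F a -> F b -> inc a b.
    by move=> [i _ <-] [i' _ <-]; rewrite !base_eltE; apply: elt_inc; apply: subgroup1.
  move=> a b [Fa|[->|->]] [Fb|[->|->]]; try exact: hF; try exact: inc_refl.
  - exact: flF.
  - by apply: inc_sym; apply: hF.
  - exact: h.
  - by apply: inc_sym; apply: hF.
  - exact: inc_sym.
have [w Hw Fw] := flag_common FC flFe.
have : w \inG parabolic x (~` J).
  apply: IP => // i Ji; have Fi : F (base_elt H Hi i) by exists i.
  exact: Fw (or_introl Fi).
rewrite kJ => /par_image[v _ vE]; exists v; rewrite !set_elt //.
have := Fw _ (or_intror (or_introl erefl)); have := Fw _ (or_intror (or_intror erefl)).
rewrite -vE !set_elt; try exact: phi_H.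
by move=> /cosetE ? /cosetE ?.
Qed.

(** By the flag condition an element of the residue is a coset H_i g with g
    in the parabolic subgroup of the missing types, and two such cosets that
    meet do so inside that subgroup. So the residue can be described in any
    group P isomorphic to it. *)
Theorem coset_residue : iso_along k (residue F) (coset_geometry p).
Proof.
have /choice[f fE] := residueE.
have te (e : residue F) : typ e = k (f e).1.
  exact: etrans (congr1 typ (fE e)) (typ_elt _ _ _).
exists (fun e => celt p (f e).1 (f e).2); split.
- apply: bij_exists => [e e' ee|y].
    apply: inc_typ; last by rewrite !te; move/(congr1 typ): ee; rewrite !typ_elt => ->.
    rewrite /= !fE.
    by apply/residue_inc; rewrite ee; apply: inc_refl.
  have [q _ ->] := elt_ex y; move: (typ y) => j.
  have he : ~ F (celt x (k j) (phi q)) /\ forall b, F b -> inc (celt x (k j) (phi q)) b.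
    split=> [[i Ji /(congr1 typ)]|_ [i Ji <-]].
      rewrite typ_elt /= => ik.
      have : (~` J) (k j) by rewrite kJ; exists j.
      by rewrite -ik.
    exists (phi q); rewrite set_elt; last exact: phi_H.
    by split; [apply: rcoset_id|apply: phi_Hi].
  pose e : residue F := exist (fun e : coset_system H Hi => ~ F e /\ forall y, F y -> inc e y) _ he.
  exists e; have e1 : celt x (k j) (phi q) = celt x (k (f e).1) (phi (f e).2) := fE e.
  apply: inc_typ; last by move/(congr1 typ): e1; rewrite !typ_elt => /kinj.
  by apply/residue_inc; rewrite -e1; apply: inc_refl.
- by move=> e; rewrite typ_elt te.
- by move=> e e'; rewrite /= !fE; apply: iff_sym; apply: residue_inc.
Qed.

End Residue.

(** * Forked string diagrams *)

(** The generators 0 and 1 are both attached to the head of the string 2, 3,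
    ..., n. Deleting i >= 2 disconnects the diagram, which reduces the
    intersection property and the flag condition to statements about the three
    types 0, 1 and i, and to the intersections of an initial segment of the
    generators with a final one. *)
Section Fork.
Variables (n : nat) (K : groupType) (x : 'I_n.+1 -> K).

Let H := parabolic x setT.
Let Hi i := parabolic x [set j | j <> i].
Let o1 : 'I_n.+1 := inord 1.
Let low (m : nat) := parabolic x [set i | (i < m)%N].
Let high (m : nat) := parabolic x [set i | (m < i)%N].

Hypothesis n1 : (1 < n)%N.
Hypothesis xC : forall k l : 'I_n.+1, (k.+1 < l)%N -> (2 < l)%N -> commute (x k) (x l).
Hypothesis low_H0 : forall (m : nat) g, (2 <= m <= n.+1)%N ->
  g \inG low m -> g \inG Hi ord0 -> g \inG parabolic x [set i | (0 < i < m)%N].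
Hypothesis low_H1 : forall (m : nat) g, (2 <= m <= n.+1)%N ->
  g \inG low m -> g \inG Hi o1 -> g \inG parabolic x [set i | i <> o1 /\ (i < m)%N].
Hypothesis low_H01 : forall (m : nat) g, (2 <= m <= n.+1)%N ->
  g \inG low m -> g \inG Hi ord0 -> g \inG Hi o1 ->
  g \inG parabolic x [set i | (1 < i < m)%N].
Hypothesis low_high : forall (i m : nat) g, (2 <= i < m)%N -> (m <= n.+1)%N ->
  g \inG low m -> g \inG high i -> g \inG parabolic x [set j | (i < j < m)%N].
Hypothesis H0_HiH1 : forall (i : 'I_n.+1) p q, (2 <= i)%N ->
  p \inG Hi i -> q \inG Hi o1 -> p * q \inG Hi ord0 ->
  exists u v, [/\ u \inG Hi i, v \inG high 1 & p * q = u * v].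

Let o1E : o1 = 1%N :> nat.
Proof. by rewrite /o1 inordK // ltnW. Qed.

Lemma Hi_prod (i : 'I_n.+1) g : (2 <= i)%N -> g \inG Hi i ->
  exists a b, [/\ a \inG low i, b \inG high i & g = a * b].
Proof.
move=> i2 gi; apply: gen_prod.
  by move=> _ _ [k ki <-] [l il <-]; apply: xC; apply: leq_ltn_trans il.
apply: gen_mono gi => _ [j /= ji <-].
have [jl|jg|e] := ltngtP j i; [by left; exists j|by right; exists j|].
by case: ji; apply: val_inj.
Qed.

Lemma low_Hi (m : nat) (j : 'I_n.+1) g : (m <= j)%N -> g \inG low m -> g \inG Hi j.
Proof. by move=> mj; apply: par_mono => k /= km kj; move: km; rewrite kj ltnNge mj. Qed.

Lemma high_Hi (m : nat) (j : 'I_n.+1) g : (j <= m)%N -> g \inG high m -> g \inG Hi j.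
Proof. by move=> jm; apply: par_mono => k /= km kj; move: km; rewrite kj ltnNge jm. Qed.

Lemma last_type (J : set 'I_n.+1) (m : nat) :
  (exists i : 'I_n.+1, [/\ J i, (2 <= i)%N, (i < m)%N &
     forall j : 'I_n.+1, J j -> (j < m)%N -> (j <= i)%N]) \/
  forall j : 'I_n.+1, J j -> (j < m)%N -> j = ord0 \/ j = o1.
Proof.
have [[i [Ji i2 im]]|none] :=
    pselect (exists i : 'I_n.+1, [/\ J i, (2 <= i)%N & (i < m)%N]); last first.
  right=> j Jj jm; have : ~~ (2 <= j)%N by apply/negP => j2; apply: none; exists j.
  by case: j {jm Jj} => [[|[|j]] hj] //= _; [left|right]; apply: val_inj; rewrite /= ?o1E.
left; pose P (j : 'I_n.+1) := `[< J j >] && (2 <= j < m)%N.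
have Pi : P i by apply/and3P; split=> //; apply/asboolP.
case: (@arg_maxnP _ i P (fun j => nat_of_ord j) Pi) => k /and3P[/asboolP Jk k2 km] kmax.
exists k; split=> // j Jj jm; have [j2|j2] := leqP 2 j; last exact: leq_trans (ltnW j2) k2.
by apply: kmax; apply/and3P; split=> //; apply/asboolP.
Qed.

(** Split g = a b at the last type i of J below m. The part b above i is
    generated by allowed generators by low_high, and the induction
    hypothesis applies to the part a below i. *)
Lemma fork_low_intersection (J : set 'I_n.+1) (m : nat) g : (2 <= m <= n.+1)%N ->
    g \inG low m -> (forall j, J j -> g \inG Hi j) ->
  g \inG parabolic x [set i | ~ J i /\ (i < m)%N].
Proof.
elim/ltn_ind: m g => m IH g mn gm gJ.
have m2 : (2 <= m)%N by case/andP: mn.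
have [[i [Ji i2 im imax]]|J01] := last_type J m.
  have [a [b [ha hb gE]]] := Hi_prod i2 (gJ i Ji).
  have am : a \inG low m by apply: par_mono ha => k /= ki; apply: ltn_trans im.
  rewrite gE; apply: subgroupM.
    suff : a \inG parabolic x [set k | ~ J k /\ (k < i)%N].
      by apply: par_mono => k /= [Jk ki]; split=> //; apply: ltn_trans im.
    apply: IH => // [|j Jj]; first by rewrite i2 ltnW.
    have [ij|ji] := leqP i j; first exact: low_Hi ha.
    rewrite (_ : a = g * b^-1); last by rewrite gE mulgK.
    apply: subgroupM; first exact: gJ.
    by apply: subgroupV; apply: high_Hi hb; apply: ltnW.
  have bm : b \inG low m.
    rewrite (_ : b = a^-1 * g); last by rewrite gE mulKg.
    by apply: subgroupM => //; apply: subgroupV.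
  have : b \inG parabolic x [set j | (i < j < m)%N].
    by apply: low_high => //; [rewrite i2|case/andP: mn].
  apply: par_mono => k /= /andP[ik km]; split=> // Jk.
  by move: ik; rewrite ltnNge imax.
have [J0|J0] := pselect (J ord0); have [J1|J1] := pselect (J o1).
- apply: par_mono (low_H01 mn gm (gJ _ J0) (gJ _ J1)) => k /= /andP[k1 km].
  split=> // Jk; case: (J01 k Jk km) => kE; move: k1; rewrite kE //.
  by rewrite o1E.
- apply: par_mono (low_H0 mn gm (gJ _ J0)) => k /= /andP[k1 km].
  split=> // Jk; case: (J01 k Jk km) => kE; first by move: k1; rewrite kE.
  by apply: J1; rewrite -kE.
- apply: par_mono (low_H1 mn gm (gJ _ J1)) => k /= [k1 km].
  split=> // Jk; case: (J01 k Jk km) => kE //.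
  by apply: J0; rewrite -kE.
- apply: par_mono gm => k /= km; split=> // Jk; case: (J01 k Jk km) => kE.
    by apply: J0; rewrite -kE.
  by apply: J1; rewrite -kE.
Qed.

Lemma fork_intersection (J : set 'I_n.+1) g : g \inG H ->
  (forall j, J j -> g \inG Hi j) -> g \inG parabolic x (~` J).
Proof.
move=> Hg gJ; have : g \inG parabolic x [set i | ~ J i /\ (i < n.+1)%N].
  apply: fork_low_intersection => //; first by rewrite leqnn andbT ltnW.
  by apply: par_mono Hg => i /= _.
by apply: par_mono => i [].
Qed.

(** Take the types in increasing order, with an element z common to the
    cosets of smaller types. If i >= 2 is the last of these types, the coset
    of the new type m can be compared with that of type i alone: it contains
    b z for some b generated by the generators above i, and b lies in all
    the H_j with j <= i. If the smaller types are 0 and 1, H0_HiH1 applies. *)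
Lemma fork_common (J : set 'I_n.+1) (c : 'I_n.+1 -> K) :
    (forall j, J j -> c j \inG H) ->
    (forall i j, J i -> J j -> exists z, rcoset (Hi i) (c i) z /\ rcoset (Hi j) (c j) z) ->
  exists2 z, z \inG H & forall j, J j -> rcoset (Hi j) (c j) z.
Proof.
move=> cH pw.
have HiH j : Hi j `<=` H by apply: par_mono.
have rH j z : J j -> rcoset (Hi j) (c j) z -> z \inG H.
  by move=> Jj [a /HiH Ha <-]; apply: subgroupM => //; apply: cH.
have rM j z u : u \inG Hi j -> rcoset (Hi j) (c j) z -> rcoset (Hi j) (c j) (u * z).
  by move=> uj; rewrite !rcosetE -mulgA; apply: subgroupM.
suff /(_ n.+1 (leqnn _))[z Hz zJ] : forall m, (m <= n.+1)%N -> exists2 z, z \inG H &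
    forall j : 'I_n.+1, J j -> (j < m)%N -> rcoset (Hi j) (c j) z.
  by exists z => // j Jj; apply: zJ.
have sub01 m (z : K) : z \inG H -> (J ord0 -> rcoset (Hi ord0) (c ord0) z) ->
    (J o1 -> rcoset (Hi o1) (c o1) z) ->
    (forall j : 'I_n.+1, J j -> (j < m)%N -> j = ord0 \/ j = o1) ->
    forall j : 'I_n.+1, J j -> (j < m)%N -> rcoset (Hi j) (c j) z.
  move=> Hz z0 z1 J01 j Jj jm.
  by case: (J01 j Jj jm) => e; rewrite e in Jj *; auto.
elim=> [|m IH] mn; first by exists 1 => //; apply: subgroup1.
have [z Hz zm] := IH (ltnW mn).
pose om : 'I_n.+1 := Ordinal mn.
have lt_om (j : 'I_n.+1) : (j < m.+1)%N -> j = om \/ (j < m)%N.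
  by rewrite ltnS leq_eqVlt => /orP[/eqP jm|]; [left; apply: val_inj|right].
have [Jm|Jm] := pselect (J om); last first.
  exists z => // j Jj /lt_om[e|]; last exact: zm.
  by rewrite e in Jj.
have [[i [Ji i2 im imax]]|J01] := last_type J m.
  have [w [wi wm]] := pw i om Ji Jm.
  have : w * z^-1 \inG Hi i.
    have := zm i Ji im; move: wi; rewrite !rcosetE => wi zi.
    rewrite (_ : w * z^-1 = (w * (c i)^-1) * (z * (c i)^-1)^-1).
      by apply: subgroupM => //; apply: subgroupV.
    by rewrite invgM invgK !mulgA mulgVK.
  move=> /(Hi_prod i2)[a [b [ha hb wE]]].
  have zE : b * z = a^-1 * w.
    by rewrite -[w](mulgVK z) wE !mulgA mulVg mul1g.
  exists (b * z).
    by apply: subgroupM => //; apply: HiH (high_Hi (leqnn i) hb).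
  move=> j Jj /lt_om[->|jm].
    by rewrite zE; apply: rM => //; apply: subgroupV; apply: low_Hi ha; apply: ltnW.
  by apply: rM; [apply: high_Hi hb; apply: imax|apply: zm].
have [m1|m2] := ltnP m 2.
  have J01' j : J j -> (j < m.+1)%N -> j = ord0 \/ j = o1.
    move=> Jj /lt_om[->|]; last exact: J01.
    move: m1; rewrite ltnS leq_eqVlt ltnS leqn0 => /orP[/eqP m1|/eqP m0].
      by right; apply: val_inj; rewrite /= o1E.
    by left; apply: val_inj.
  have [J0|J0] := pselect (J ord0); have [J1|J1] := pselect (J o1).
  - have [w [w0 w1]] := pw _ _ J0 J1; have Hw := rH _ _ J0 w0.
    by exists w => //; apply: sub01.
  - have [w [w0 _]] := pw _ _ J0 J0; have Hw := rH _ _ J0 w0.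
    by exists w => //; apply: sub01.
  - have [w [w0 _]] := pw _ _ J1 J1; have Hw := rH _ _ J1 w0.
    by exists w => //; apply: sub01.
  - exists 1; first exact: subgroup1.
    by apply: sub01 => //; apply: subgroup1.
have fin w : w \inG H -> rcoset (Hi om) (c om) w -> (J ord0 -> rcoset (Hi ord0) (c ord0) w) ->
    (J o1 -> rcoset (Hi o1) (c o1) w) ->
    exists2 z, z \inG H & forall j : 'I_n.+1, J j -> (j < m.+1)%N -> rcoset (Hi j) (c j) z.
  move=> Hw wm w0 w1; exists w => // j Jj /lt_om[->//|jm].
  exact: (sub01 m).
have [J0|J0] := pselect (J ord0); have [J1|J1] := pselect (J o1).
- have [w0 [w00 w0m]] := pw _ _ J0 Jm; have [w1 [w11 w1m]] := pw _ _ J1 Jm.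
  have z0 : rcoset (Hi ord0) (c ord0) z by apply: zm => //; apply: ltnW.
  have z1 : rcoset (Hi o1) (c o1) z by apply: zm => //; rewrite o1E.
  have quot j a b : rcoset (Hi j) (c j) a -> rcoset (Hi j) (c j) b -> a * b^-1 \inG Hi j.
    rewrite !rcosetE => ha hb.
    rewrite (_ : a * b^-1 = (a * (c j)^-1) * (b * (c j)^-1)^-1).
      by apply: subgroupM => //; apply: subgroupV.
    by rewrite invgM invgK !mulgA mulgVK.
  have [|u [v [hu hv uv]]] := @H0_HiH1 om _ _ m2 (quot om w0 w1 w0m w1m) (quot o1 w1 z w11 z1).
    by rewrite mulgA mulgVK; apply: quot.
  rewrite mulgA mulgVK in uv.
  have vE : v * z = u^-1 * w0.
    by rewrite -[w0](mulgVK z) uv !mulgA mulVg mul1g.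
  apply: (fin (v * z)).
  + by apply: subgroupM => //; apply: par_mono hv.
  + by rewrite vE; apply: rM => //; apply: subgroupV.
  + by move=> _; apply: rM => //; apply: high_Hi hv.
  + by move=> _; apply: rM => //; apply: high_Hi hv; rewrite o1E.
- have [w [w0 wm]] := pw _ _ J0 Jm.
  by apply: (fin w) => //; apply: rH w0.
- have [w [w0 wm]] := pw _ _ J1 Jm.
  by apply: (fin w) => //; apply: rH w0.
- have [w [wm _]] := pw _ _ Jm Jm.
  by apply: (fin w) => //; apply: rH wm.
Qed.

End Fork.

(** * The group of the cube *)

Section Involutions.
Variables (K : groupType) (a b : K).
Hypotheses (a2 : a * a = 1) (b2 : b * b = 1).

Lemma inv_comm : (a * b) ^+ 2 = 1 -> commute a b.
Proof. by rewrite /commute expg2 => /mulg1_eq <-; rewrite invgM (mulg1_eq a2) (mulg1_eq b2). Qed.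

Lemma inv_braid : (a * b) ^+ 3 = 1 -> a * b * a = b * a * b.
Proof.
move=> e; have /mulg1_eq <- : b * a * b * (a * b * a) = 1.
  have : b * (a * b) ^+ 3 * b^-1 = 1 by rewrite e mulg1 mulgV.
  by rewrite (mulg1_eq b2) !expgS expg0 mulg1 -!mulgA b2 mulg1 !mulgA.
by rewrite !invgM (mulg1_eq a2) (mulg1_eq b2) mulgA.
Qed.

Lemma inv_quad : (a * b) ^+ 4 = 1 -> a * b * a * b = b * a * b * a.
Proof.
move=> e; have /mulg1_eq : a * b * a * b * (a * b * a * b) = 1.
  by rewrite -e !expgS expg0 mulg1 !mulgA.
by rewrite !invgM (mulg1_eq a2) (mulg1_eq b2) !mulgA.
Qed.

End Involutions.

(** The cube is {-1, 1}^n, and (k, e) is the k-th coordinate vector, with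
    the sign - if e is true. *)
Definition signed (j : nat) (p : nat * bool) : nat * bool :=
  if j is j'.+1 then (if p.1 == j then j' else if p.1 == j' then j else p.1, p.2)
  else (p.1, p.2 (+) (p.1 == 0)).

(* Simplification does not use the hypotheses on the indices, so each
   equality test of the goal is replaced by the value that lia finds for it. *)
Ltac decide_eqs := repeat (match goal with |- context [?a == ?b] =>
    (have -> : (a == b) = false by apply/eqP; lia) ||
    (have -> : (a == b) = true by apply/eqP; lia)
  end; rewrite /=).

Lemma signedK j : involutive (signed j).
Proof.
move=> [k e]; case: j => [|j]; rewrite /signed /=; first by rewrite -addbA addbb addbF.
have [ki|kj] := eqVneq k j.+1; first by rewrite ?ki; decide_eqs.
by have [ki|kj'] := eqVneq k j; rewrite ?ki; decide_eqs.
Qed.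

Lemma signed_comm i j p : i.+1 < j -> signed j (signed i p) = signed i (signed j p).
Proof.
case: p j => k e [|[|j]] // ij; rewrite /signed /=.
case: i ij => [|i] ij /=.
  have [ki|kj] := eqVneq k j.+2; first by rewrite ?ki; decide_eqs.
  by have [ki|kj'] := eqVneq k j.+1; [rewrite ki; decide_eqs|].
have [ki|kj] := eqVneq k j.+2; first by rewrite ?ki; decide_eqs.
have [ki|kj'] := eqVneq k j.+1; first by rewrite ?ki; decide_eqs.
have [ki|kj2] := eqVneq k i.+1; first by rewrite ?ki; decide_eqs.
by have [ki|kj3] := eqVneq k i; rewrite ?ki; decide_eqs.
Qed.

Lemma signed_braid j p :
  iter 3 (fun p => signed j.+2 (signed j.+1 p)) p = p /\
  iter 3 (fun p => signed j.+1 (signed j.+2 p)) p = p.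
Proof.
case: p => k e; rewrite /signed /=.
have [ki|kj] := eqVneq k j; first by rewrite ?ki; split; decide_eqs.
have [ki|kj'] := eqVneq k j.+1; first by rewrite ?ki; split; decide_eqs.
by have [ki|kj2] := eqVneq k j.+2; rewrite ?ki; split; decide_eqs.
Qed.

Lemma signed_quad p :
  iter 4 (fun p => signed 1 (signed 0 p)) p = p /\
  iter 4 (fun p => signed 0 (signed 1 p)) p = p.
Proof. by case: p => [[|[|k]]] e; rewrite /signed /= ?addbF ?addbT ?negbK. Qed.

Lemma signed_flip j k e : signed j (k, ~~ e) = ((signed j (k, e)).1, ~~ (signed j (k, e)).2).
Proof. by case: j => [|j]; rewrite /signed //= addNb. Qed.

Section CubeGroup.
Variable n : nat.
Implicit Types g h : cube_group n.

Definition act : nat * bool -> cube_group n -> nat * bool :=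
  pact (fun i : 'I_n => signed i).

Lemma act_rel r p : cube_rels n r -> wact (fun i : 'I_n => signed i) r p = p.
Proof.
have E (i j : 'I_n) k q : wact (fun i : 'I_n => signed i) (wexp (letter i ++ letter j) k) q =
    iter k (fun p => signed j (signed i p)) q by rewrite wact_exp.
move=> [i [j ->]]; rewrite E /string_matrix; case: eqVneq => [->|ij].
  by rewrite /= signedK.
have [e|ij1] := eqVneq; first rewrite -e.
  by case: (nat_of_ord i) => [|k]; [apply: (signed_quad p).1|apply: (signed_braid k p).1].
have [e|ji1] := eqVneq; first rewrite -e.
  by case: (nat_of_ord j) => [|k]; [apply: (signed_quad p).2|apply: (signed_braid k p).2].
have [lt|lt|/val_inj e] := ltngtP i j; last by rewrite e eqxx in ij.
  by rewrite /= (signed_comm (i := i) (j := j)) ?signedK // ltn_neqAle ij1.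
by rewrite /= -(signed_comm (i := j) (j := i)) ?signedK // ltn_neqAle ji1.
Qed.

Lemma act1 p : act p 1 = p.
Proof. by apply: pact1 => [i|]; [exact: signedK|exact: act_rel]. Qed.

Lemma actM p g h : act p (g * h) = act (act p g) h.
Proof. by apply: pactM => [i|]; [exact: signedK|exact: act_rel]. Qed.

Lemma actK p g : act (act p g) g^-1 = p.
Proof. by rewrite -actM mulgV act1. Qed.

Lemma actVK p g : act (act p g^-1) g = p.
Proof. by rewrite -actM mulVg act1. Qed.

Lemma act_inj g : injective (act^~ g).
Proof. exact: can_inj (actK^~ g). Qed.

(** Total on nat, with the value 1 from n on, so that the subgroups below
    need no bound on their indices. *)
Definition tau (j : nat) : cube_group n := if insub j is Some i then cube_tau i else 1.

Lemma tau_ord (i : 'I_n) : tau i = cube_tau i.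
Proof. by rewrite /tau valK. Qed.

Lemma tau_ge j : n <= j -> tau j = 1.
Proof. by move=> nj; rewrite /tau insubN // -leqNgt. Qed.

Lemma act_tau p j : (j < n)%N -> act p (tau j) = signed j p.
Proof.
move=> jn; rewrite (tau_ord (Ordinal jn)).
by apply: pact_gen => [i|]; [exact: signedK|exact: act_rel].
Qed.

Lemma cube_rel (i j : 'I_n) : (tau i * tau j) ^+
  string_matrix (fun i => if i == 0 then 4 else 3) i j = 1.
Proof.
rewrite !tau_ord /cube_tau -piM -pi_exp; apply: pi_relator; by exists i, j.
Qed.

Lemma tau2 j : tau j * tau j = 1.
Proof.
have [jn|nj] := ltnP j n; last by rewrite tau_ge // mulg1.
by have := cube_rel (Ordinal jn) (Ordinal jn); rewrite /string_matrix eqxx expg1.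
Qed.

Lemma tauV j : (tau j)^-1 = tau j.
Proof. exact: mulg1_eq (tau2 j). Qed.

Lemma tau_comm i j : (i.+1 < j)%N -> commute (tau i) (tau j).
Proof.
move=> ij; have [jn|nj] := ltnP j n; last by rewrite (tau_ge nj); apply: commute1.
have lin : (i < n)%N by lia.
apply: inv_comm; try exact: tau2.
have := cube_rel (Ordinal lin) (Ordinal jn); rewrite /string_matrix -val_eqE /=.
by decide_eqs.
Qed.

Lemma tau_braid j : (0 < j)%N -> (j.+1 < n)%N ->
  tau j * tau j.+1 * tau j = tau j.+1 * tau j * tau j.+1.
Proof.
move=> j0 jn; have jn' := ltnW jn; apply: inv_braid; try exact: tau2.
have := cube_rel (Ordinal jn') (Ordinal jn); rewrite /string_matrix -val_eqE /=.
by decide_eqs.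
Qed.

Lemma tau_quad : tau 0 * tau 1 * tau 0 * tau 1 = tau 1 * tau 0 * tau 1 * tau 0.
Proof.
have [n1|n1] := ltnP 1 n; last by rewrite (tau_ge n1) !mulg1 mul1g.
apply: inv_quad; try exact: tau2.
by have := cube_rel (Ordinal (ltnW n1)) (Ordinal n1); rewrite /string_matrix -val_eqE.
Qed.

Definition seg (b a : nat) : subgroup (cube_group n) :=
  parabolic (@cube_tau n) [set i | (b <= i < a)%N].

Lemma mem_seg b a j : (b <= j < a)%N -> tau j \inG seg b a.
Proof.
move=> jab; have [jn|nj] := ltnP j n; last by rewrite tau_ge //; apply: subgroup1.
by rewrite (tau_ord (Ordinal jn)); apply: mem_par.
Qed.

Lemma seg_mono b a b' a' : (b' <= b)%N -> (a <= a')%N -> seg b a `<=` seg b' a'.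
Proof. by move=> hb ha; apply: par_mono => i /=; lia. Qed.

Lemma seg_ind (Q : cube_group n -> Prop) b a : Q 1 ->
    (forall g j, Q g -> (b <= j < a)%N -> (j < n)%N -> Q (g * tau j)) ->
  forall g, g \inG seg b a -> Q g.
Proof.
move=> Q1 QM; apply: gen_ind => // [_ [i _ <-]|g _ Qg [i ia <-]].
  by rewrite -tau_ord tau2.
by rewrite -tau_ord; apply: QM.
Qed.

Lemma seg_full g : g \inG seg 0 n.
Proof. by apply: par_mono (pgen_full g) => i _ /=. Qed.

Lemma seg_empty b a g : (a <= b)%N -> g \inG seg b a -> g = 1.
Proof. by move=> ab; move: g; apply: seg_ind => // g j _; lia. Qed.

Lemma act_neg k e g : act (k, ~~ e) g = ((act (k, e) g).1, ~~ (act (k, e) g).2).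
Proof.
move: g (seg_full g); apply: seg_ind => [|g j IH _ jn]; first by rewrite !act1.
by rewrite !actM !act_tau // IH signed_flip -surjective_pairing.
Qed.

Lemma act_sign k e g : act (k, e) g = ((act (k, false) g).1, (act (k, false) g).2 (+) e).
Proof.
case: e; last by rewrite addbF -surjective_pairing.
by rewrite -[true]/(~~ false) act_neg addbT.
Qed.

Lemma seg_fix k e b a g : (a <= k)%N || (k.+1 < b)%N -> g \inG seg b a -> act (k, e) g = (k, e).
Proof.
move=> kab; move: g; apply: seg_ind => [|g j IH ja jn]; first exact: act1.
rewrite actM act_tau // IH /signed /=.
by case: j ja jn => [|j] ja jn; decide_eqs; rewrite ?addbF.
Qed.

Lemma seg_sign p b a g : (0 < b)%N -> g \inG seg b a -> (act p g).2 = p.2.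
Proof.
move=> b0; move: g; apply: seg_ind => [|g j IH ja jn]; first by rewrite act1.
by rewrite actM act_tau // -IH; case: j ja jn => // ja; lia.
Qed.

(** ** Cosets of a standard subgroup in the next one *)

(** The representatives of the cosets of <tau_0, .., tau_(k-1)> in
    <tau_0, .., tau_k> are the 2 k + 2 prefixes of the word
    tau_k .. tau_1 tau_0 tau_1 .. tau_k. *)
Definition letter_at (k i : nat) := if (i <= k)%N then (k - i)%N else (i - k)%N.

Fixpoint rep (k i : nat) : cube_group n :=
  if i is i'.+1 then rep k i' * tau (letter_at k i') else 1.

Arguments rep : simpl never.

Lemma repS k i : rep k i.+1 = rep k i * tau (letter_at k i).
Proof. by []. Qed.

Lemma repS_down k i : (i <= k)%N -> rep k i.+1 = rep k i * tau (k - i).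
Proof. by rewrite repS /letter_at => ->. Qed.

Lemma repS_up k e : rep k (k + e).+2 = rep k (k + e).+1 * tau e.+1.
Proof.
rewrite repS /letter_at; congr (_ * tau _).
by rewrite ltnNge leq_addr /= -addnS addKn.
Qed.

Lemma act_rep k i : (k < n)%N -> (i < k.*2.+2)%N -> act (k, false) (rep k i) =
  if (i <= k)%N then ((k - i)%N, false) else ((i - k.+1)%N, true).
Proof.
move=> kn; elim: i => [|i IH] ik; first by rewrite act1 subn0.
have ln : (letter_at k i < n)%N by rewrite /letter_at; case: ifP; lia.
rewrite repS actM (IH (ltnW ik)) act_tau // /letter_at {IH ln}.
case: (ltngtP i k) => [lt|gt|->].
- have -> : (k - i = (k - i).-1.+1)%N by lia.
  rewrite /signed /=; decide_eqs; congr pair; lia.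
- have -> : (i - k = (i - k).-1.+1)%N by lia.
  rewrite /signed /=; decide_eqs; congr pair; lia.
- by rewrite subnn /signed /= subnn.
Qed.

Lemma rep_low k i j : (j < k - i)%N -> rep k i * tau j = tau j * rep k i.
Proof.
elim: i => [|i IH] ji; first by rewrite mul1g mulg1.
rewrite repS_down; last by lia.
rewrite -mulgA -(@tau_comm j (k - i)); last by lia.
by rewrite mulgA IH ?mulgA //; lia.
Qed.

Lemma rep_high k i j : (k < n)%N -> (i <= k)%N -> ((k - i).+1 < j <= k)%N ->
  rep k i * tau j = tau j.-1 * rep k i.
Proof.
move=> kn; elim: i => [|i IH] ik jk; first by lia.
rewrite repS_down; last by lia.
have [lt|ge] := ltnP (k - i).+1 j.
  rewrite -mulgA (@tau_comm (k - i) j) // mulgA IH ?mulgA //; lia.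
case: i IH ik jk ge => [|i] IH ik jk ge; first by lia.
case: j {IH} jk ge => [|m] jk ge; first by lia.
rewrite repS_down; last by lia.
have -> : (k - i = m.+1)%N by lia.
have -> : (k - i.+1 = m)%N by lia.
have br : tau m.+1 * tau m * tau m.+1 = tau m * tau m.+1 * tau m.
  by rewrite tau_braid //; lia.
rewrite -!mulgA (mulgA (tau m.+1)) br !mulgA rep_low //; lia.
Qed.

Lemma rep_up_high k e j : (k < n)%N -> (e.+1 < j <= k)%N ->
  rep k (k + e).+1 * tau j = tau j.-1 * rep k (k + e).+1.
Proof.
move=> kn; elim: e => [|e IH] ej.
  rewrite addn0 repS_down // subnn -mulgA (@tau_comm 0 j); last by lia.
  by rewrite [LHS]mulgA (rep_high (j := j)) ?mulgA //; lia.
rewrite addnS repS_up -mulgA (@tau_comm e.+1 j); last by lia.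
by rewrite mulgA IH ?mulgA //; lia.
Qed.

Lemma rep_up_low k e j : (k < n)%N -> (0 < j < e)%N -> (e <= k)%N ->
  rep k (k + e).+1 * tau j = tau j * rep k (k + e).+1.
Proof.
move=> kn; elim: e => [|e IH] je ek; first by lia.
rewrite addnS repS_up.
have [lt|ge] := ltnP j e.
  rewrite -mulgA -(@tau_comm j e.+1); last by lia.
  by rewrite mulgA IH ?mulgA //; lia.
have {ge}jE : j = e by lia.
rewrite jE in je *; case: e IH je ek jE => [|e] IH je ek jE; first by lia.
rewrite addnS repS_up -!mulgA (mulgA (tau e.+1)) tau_braid //; last by lia.
by rewrite !mulgA rep_up_high /= ?mulgA //; lia.
Qed.

Lemma rep_up_0 k e : (0 < e <= k)%N ->
  rep k (k + e).+1 * tau 0 = tau 0 * rep k (k + e).+1.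
Proof.
elim: e => [|e IH] ek; first by lia.
rewrite addnS repS_up; case: e IH ek => [|e] IH ek; last first.
  rewrite -mulgA -(@tau_comm 0 e.+2); last by lia.
  by rewrite mulgA IH ?mulgA //; lia.
case: k {IH} ek => [//|k] _; rewrite addn0 repS_down // subnn repS_down // subSnn.
have q : tau 1 * tau 0 * tau 1 * tau 0 = tau 0 * tau 1 * tau 0 * tau 1 by rewrite tau_quad.
have -> : rep k.+1 k * tau 1 * tau 0 * tau 1 * tau 0 =
    rep k.+1 k * (tau 1 * tau 0 * tau 1 * tau 0) by rewrite !mulgA.
by rewrite q !mulgA rep_low //; lia.
Qed.

(** Multiplication by tau_j extends or shortens the word, or else the braid
    relations carry tau_j through the word, from which it emerges on the
    left as a generator of smaller index than k. *)
Lemma rep_tau k i j : (k < n)%N -> (i < k.*2.+2)%N -> (j <= k)%N ->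
  exists a i', [/\ a \inG seg 0 k, (i' < k.*2.+2)%N & rep k i * tau j = a * rep k i'].
Proof.
move=> kn ik jk.
have same j' : (j' < k)%N -> rep k i * tau j = tau j' * rep k i ->
    exists a i', [/\ a \inG seg 0 k, (i' < k.*2.+2)%N & rep k i * tau j = a * rep k i'].
  by move=> j'k ->; exists (tau j'), i; split=> //; apply: mem_seg.
have next i' : (i' < k.*2.+2)%N -> rep k i * tau j = rep k i' ->
    exists a i', [/\ a \inG seg 0 k, (i' < k.*2.+2)%N & rep k i * tau j = a * rep k i'].
  by move=> h ->; exists 1, i'; split; rewrite ?mul1g //; apply: subgroup1.
have [lt|ge] := leqP i k.
  have [jlt|jgt|jE] := ltngtP j (k - i)%N.
  - by apply: (same j); [lia|apply: rep_low].
  - have [jlt'|jge'] := ltnP (k - i).+1 j.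
      by apply: (same j.-1); [lia|apply: rep_high => //; lia].
    case: i {same ik} lt jgt next jge' => [|i] lt jgt next jge'; first by lia.
    apply: (next i); first by lia.
    rewrite repS_down; last by lia.
    have -> : (k - i = j)%N by lia.
    by rewrite -mulgA tau2 mulg1.
  - by apply: (next i.+1); [lia|rewrite repS_down // jE].
have iE : i = (k + (i - k.+1)).+1 by lia.
rewrite iE in ik same next *; move: (i - k.+1) => e in ik same next *.
have [j00|j0] := eqVneq j 0.
  case: (eqVneq e 0) same next => [->|e0] same next.
    apply: (next k); first by lia.
    by rewrite addn0 repS_down // subnn j00 -mulgA tau2 mulg1.
  by apply: (same j); rewrite j00; [lia|apply: rep_up_0; lia].
have [jlt|jgt|jE] := ltngtP j e.
- by apply: (same j); [lia|apply: rep_up_low => //; lia].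
- have [jE|jgt'] := eqVneq j e.+1.
    by apply: (next (k + e).+2); [lia|rewrite repS_up jE].
  by apply: (same j.-1); [lia|apply: rep_up_high => //; lia].
- rewrite jE in jk j0 same next *; case: e {jE} ik jk j0 same next => [|e] ik jk j0 same next //.
  apply: (next (k + e).+1); first by lia.
  by rewrite addnS repS_up -mulgA tau2 mulg1.
Qed.

Lemma rep_seg k i b : (i < k.*2.+2)%N -> (b <= k.+1 - i)%N -> rep k i \inG seg b k.+1.
Proof.
elim: i => [|i IH] ik bi; first exact: subgroup1.
apply: subgroupM; first by apply: IH; lia.
by apply: mem_seg; rewrite /letter_at; case: ifP; lia.
Qed.

Lemma seg_cosets k g : (k < n)%N -> g \inG seg 0 k.+1 ->
  exists a i, [/\ a \inG seg 0 k, (i < k.*2.+2)%N & g = a * rep k i].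
Proof.
move=> kn; move: g; apply: seg_ind => [|_ j [a [i [ha ik ->]]] jk _].
  by exists 1, 0; split; rewrite ?mulg1 //; apply: subgroup1.
have [b [i' [hb ik' E]]] := rep_tau kn ik (j := j) jk.
by exists (a * b), i'; split=> //; [apply: subgroupM|rewrite -mulgA E mulgA].
Qed.

(** The representatives are distinguished by their images of the k-th
    coordinate vector, which is fixed by tau_0, .., tau_(k-1). *)
Lemma seg_order k : (k <= n)%N -> has_order (seg 0 k) (2 ^ k * k`!).
Proof.
elim: k => [|k IH] kn.
  have -> : (seg 0 0 : set _) = [set 1].
    apply/seteqP; split=> [g /(seg_empty (leqnn 0))//|_ ->]; exact: subgroup1.
  exact: has_order1.
have -> : (2 ^ k.+1 * k.+1`! = 2 ^ k * k`! * k.*2.+2)%N.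
  rewrite expnS factS; move: (2 ^ k)%N (k`!) => p q; nia.
apply: (has_order_cosets (IH (ltnW kn)) (r := rep k)).
- exact: seg_mono.
- by move=> i ik; apply: rep_seg.
- by move=> g; apply: seg_cosets.
- move=> a i j ha ik jk /(congr1 (act (k, false))).
  rewrite actM (seg_fix _ _ ha) ?leqnn // !act_rep //.
  by case: ifP => ik'; case: ifP => jk' [] //; lia.
Qed.

Lemma cube_order : has_order [set: cube_group n] (2 ^ n * n`!).
Proof.
have -> : [set: cube_group n] = seg 0 n by apply/seteqP; split=> // g _; apply: seg_full.
exact: seg_order.
Qed.

(** Read the coset of <tau_0, .., tau_(a-2)> off the image of the coordinate
    a - 1: that image is positive and not below b, so the representative is
    a descending word that stops above b, and the other factor satisfies the
    hypotheses again. *)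
Lemma seg_stab a b g : (a <= n)%N -> g \inG seg 0 a ->
    (forall k, (act (k, false) g).2 = false) ->
    (forall k, (k < b)%N -> act (k, false) g = (k, false)) ->
  g \inG seg b.+1 a.
Proof.
elim: a g => [|a IH] g an ga gs gb; first by rewrite (seg_empty (leqnn 0) ga); apply: subgroup1.
have [u [i [hu ia gE]]] := seg_cosets an ga.
have gaE : act (a, false) g = act (a, false) (rep a i).
  by rewrite gE actM (seg_fix _ _ hu) // leqnn.
have ia' : (i <= a)%N.
  by have := gs a; rewrite gaE act_rep //; case: ifP.
have ri : rep a i \inG seg b.+1 a.+1.
  have [i0|i0] := eqVneq i 0; first by rewrite i0; apply: subgroup1.
  apply: rep_seg => //; have [ba|ab] := leqP b (a - i); first by lia.
  have : act (a, false) g = act ((a - i)%N, false) g.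
    by rewrite (gb _ ab) gaE act_rep // ia'.
  by move/act_inj => -[]; lia.
have uE : u = g * (rep a i)^-1 by rewrite gE mulgK.
rewrite gE; apply: subgroupM => //.
apply: (seg_mono (leqnn b.+1) (leqnSn a)); apply: IH => //; first exact: ltnW.
  by move=> k; rewrite uE actM (seg_sign _ _ (subgroupV ri)).
move=> k kb; rewrite uE actM gb //; apply: seg_fix (subgroupV ri).
by rewrite ltnS kb orbT.
Qed.

(** The generators above b are unsigned and fix the coordinates below b, so
    seg_stab applies. *)
Lemma seg_inter a b g : (a <= n)%N -> g \inG seg 0 a -> g \inG seg b.+1 n -> g \inG seg b.+1 a.
Proof.
move=> an ga gb; apply: seg_stab => // [k|k kb]; first exact: seg_sign gb.
by apply: seg_fix gb; rewrite ltnS kb orbT.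
Qed.

Lemma act_faithful g : (forall p, act p g = p) -> g = 1.
Proof.
move=> gp; apply: (@seg_empty n.+1 n) => //.
apply: seg_stab => //; first exact: seg_full.
by move=> k; rewrite gp.
Qed.

Lemma stabE g : g \inG base_vertex_stab (cube n) <-> forall k, (act (k, false) g).2 = false.
Proof.
have E : g \inG base_vertex_stab (cube n) <-> g \inG seg 1 n.
  by split; apply: par_mono => i /=; [rewrite lt0n => -> /=|rewrite lt0n => /andP[]].
rewrite E; split=> [g1 k|gs]; first exact: seg_sign g1.
by apply: seg_stab => //; apply: seg_full.
Qed.

(** * The vertices of the cube *)

(** The coordinates of the vertex F_0 g, where F_0 = (1, .., 1): the j-th
    one is negative if the preimage under g of the j-th vector is. *)
Definition signs g (j : nat) : bool := (act (j, false) g^-1).2.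

Definition vtx g : vertex (cube n) := @vertex_act n (cube n) g (base_vertex (cube n)).

Lemma vtxM g h : @vertex_act n (cube n) h (vtx g) = vtx (g * h).
Proof. by rewrite /vtx vertex_actM. Qed.

Lemma vtx1 : vtx 1 = base_vertex (cube n).
Proof. exact: vertex_act1. Qed.

Lemma vertex_ex (F : vertex (cube n)) : exists g, F = vtx g.
Proof.
case: F => F [g FE]; exists g; apply: vertex_inj => /=.
by rewrite rcosetM mul1g.
Qed.

Lemma vtx_eq g h : vtx g = vtx h <-> h * g^-1 \inG base_vertex_stab (cube n).
Proof.
split=> [/(congr1 sval) /= e|hg].
  rewrite -[_ \inG _](rcosetE (base_vertex_stab (cube n)) g h).
  by move: e; rewrite !rcosetM !mul1g => ->; apply: rcoset_id.
apply: vertex_inj; rewrite /= !rcosetM !mul1g.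
have gh : rcoset (base_vertex_stab (cube n)) g h by rewrite rcosetE.
have hh := rcoset_id (base_vertex_stab (cube n)) h.
by apply/seteqP; split; [apply: (rcoset_sub gh hh)|apply: (rcoset_sub hh gh)].
Qed.

Lemma vertex_eq g h : vtx g = vtx h <-> signs g =1 signs h.
Proof.
rewrite vtx_eq stabE; split=> [s1 j|s1 k].
  rewrite /signs; have := s1 (act (j, false) h^-1).1.
  have : act (act (j, false) h^-1) (h * g^-1) = act (j, false) g^-1 by rewrite actM actVK.
  case: (act (j, false) h^-1) => k e /=; rewrite act_sign => /(congr1 snd) /= <- ->.
  by rewrite addFb.
rewrite actM; have := actK (k, false) h; case: (act (k, false) h) => j e.
have := s1 j; rewrite /signs (act_sign j e h^-1) (act_sign j e g^-1) /= => ->.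
by move/(congr1 snd).
Qed.

Lemma signsM g h j : signs (g * h) j =
  (act (j, false) h^-1).2 (+) signs g (act (j, false) h^-1).1.
Proof. by rewrite /signs invgM actM; case: (act (j, false) h^-1) => k e; rewrite act_sign addbC. Qed.

Lemma signs_tau g i j : (i < n)%N ->
  signs (g * tau i) j = (i == 0) && (j == 0) (+) signs g (signed i (j, false)).1.
Proof.
move=> ilt; rewrite signsM tauV act_tau //; congr (_ (+) _).
by case: i {ilt} => //= i; rewrite addFb.
Qed.


(** ** The element beta, a Coxeter element *)

Definition beta : cube_group n := \prod_(i < n) cube_tau i.

Lemma betaE : beta = \prod_(0 <= i < n) tau i.
Proof. by rewrite big_mkord; apply: eq_bigr => i _; rewrite tau_ord. Qed.

Lemma act_beta j e : (j < n)%N ->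
  act (j, e) beta = if j == 0 then (n.-1, ~~ e) else (j.-1, e).
Proof.
move=> jn; rewrite betaE.
have : forall m, (0 < m <= n)%N -> act (j, e) (\prod_(0 <= i < m) tau i) =
    if j == 0 then (m.-1, ~~ e) else if (j < m)%N then (j.-1, e) else (j, e).
  elim=> [|[|m] IH] mn //.
    rewrite big_nat1 act_tau //= ltnS leqn0 /signed /=.
    by case: (eqVneq j 0) => [->|j0]; rewrite ?addbT ?addbF.
  rewrite big_nat_recr //= actM IH; last by lia.
  rewrite act_tau; last by lia.
  case: (eqVneq j 0) => [_|j0]; first by rewrite /signed /=; decide_eqs.
  have [lt|ge] := ltnP j m.+1.
    by rewrite /signed /= ltnW //; decide_eqs.
  have [->|jm] := eqVneq j m.+1; first by rewrite ltnSn /signed /=; decide_eqs.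
  have -> : (j < m.+2)%N = false by lia.
  by rewrite /signed /=; decide_eqs.
by move=> /(_ n) ->; [rewrite jn|lia].
Qed.

Lemma act_betaX j e i : (j < n)%N -> (i <= n)%N ->
  act (j, e) (beta ^+ i) = if (i <= j)%N then ((j - i)%N, e) else ((j + n - i)%N, ~~ e).
Proof.
move=> jn; elim: i => [|i IH] lei; first by rewrite expg0 act1 subn0.
rewrite expgSr actM IH; last by lia.
have [lt|gt|ij] := ltngtP i j; rewrite act_beta; try by lia.
- by decide_eqs; congr pair; lia.
- by decide_eqs; congr pair; lia.
- by rewrite ij subnn /=; congr pair; lia.
Qed.

Lemma act_alpha j e : (j < n)%N -> act (j, e) (beta ^+ n) = (j, ~~ e).
Proof. by move=> jn; rewrite act_betaX // leqNgt jn /= addnK. Qed.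

Lemma alpha2 : beta ^+ n * beta ^+ n = 1.
Proof.
apply: act_faithful => -[j e]; have [jn|nj] := ltnP j n.
  by rewrite actM !act_alpha // negbK.
by apply: seg_fix (seg_full _); rewrite nj.
Qed.

Lemma signs_alpha g j : (j < n)%N -> signs (g * beta ^+ n) j = ~~ signs g j.
Proof.
move=> jn; rewrite signsM (mulg1_eq alpha2) act_alpha //=.
Qed.

Lemma signs_beta i j : (i <= n)%N -> (j < n)%N -> signs (beta ^+ i) j = (n - i <= j)%N.
Proof.
move=> lei jn; rewrite /signs.
have act_inv p q : act p (beta ^+ i) = q -> act q (beta ^+ i)^-1 = p by move=> <-; apply: actK.
have [le|lt] := leqP (n - i) j.
  rewrite (act_inv ((j - (n - i))%N, true)) // act_betaX; try lia.
  have -> : (i <= j - (n - i))%N = false by lia.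
  by congr pair; lia.
rewrite (act_inv ((j + i)%N, false)) // act_betaX; try lia.
by rewrite leq_addl addnK.
Qed.

Lemma signs_ge g j : (n <= j)%N -> signs g j = false.
Proof. by move=> nj; rewrite /signs (seg_fix _ _ (seg_full _)) // nj. Qed.

Lemma signs_inj g h : (forall j, (j < n)%N -> signs g j = signs h j) ->
  vtx g = vtx h.
Proof.
move=> e; apply/vertex_eq => j; have [jn|nj] := ltnP j n; first exact: e.
by rewrite !signs_ge.
Qed.

Lemma antipode_base g : antipode (vtx g) = vtx (g * beta ^+ n).
Proof. exact: vtxM. Qed.

(** The reversal of the coordinate j, as a conjugate of tau_0. *)
Fixpoint flip (j : nat) : cube_group n :=
  if j is j'.+1 then tau j * flip j' * tau j else tau 0.

Lemma act_flip j k e : (j < n)%N -> act (k, e) (flip j) = (k, e (+) (k == j)).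
Proof.
elim: j k e => [|j IH] k e jn; first by rewrite act_tau.
rewrite [flip _]/= !actM !act_tau //.
have IHj p : act p (flip j) = (p.1, p.2 (+) (p.1 == j)) by case: p => *; apply: IH; apply: ltnW.
have [->|kj] := eqVneq k j.+1.
  by rewrite IHj /signed /=; decide_eqs.
rewrite IHj /signed /= (negbTE kj); have [->|kj'] := eqVneq k j; last by decide_eqs.
by decide_eqs; rewrite addbF.
Qed.

Lemma flip2 j : flip j * flip j = 1.
Proof.
elim: j => [|j IH] /=; first exact: tau2.
by rewrite !mulgA -(mulgA _ (tau j.+1) (tau j.+1)) tau2 mulg1 -(mulgA _ (flip j) (flip j)) IH mulg1 tau2.
Qed.

Lemma signs_ex (v : nat -> bool) : exists g, forall j, (j < n)%N -> signs g j = v j.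
Proof.
suff [g gE] : exists g, forall j, (j < n)%N -> signs g j = (j < n)%N && v j.
  by exists g => j jn; rewrite gE // jn.
have : forall m, (m <= n)%N -> exists g, forall j, (j < n)%N -> signs g j = (j < m)%N && v j.
  elim=> [|m IH] mn; first by exists 1 => j _; rewrite /signs invg1 act1.
  have [g gE] := IH (ltnW mn); exists (if v m then g * flip m else g) => j jn.
  rewrite ltnS leq_eqVlt; case: ifP => vm; last first.
    by rewrite gE //; case: (eqVneq j m) => [->|_]; rewrite ?vm ?ltnn.
  rewrite signsM (mulg1_eq (flip2 m)) act_flip //= gE //.
  by case: (eqVneq j m) => [->|_]; rewrite ?ltnn ?vm.
exact.
Qed.

(** Among the images of the vertex under the stabilizer of F_0, take one
    that minimizes the weighted number of negative signs. Then no negative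
    sign precedes a positive one, or the transposition of the two would
    decrease the weight. *)
Lemma signs_sorted g : exists2 u, u \inG seg 1 n & exists2 m, (m <= n)%N &
  forall j, (j < n)%N -> signs (g * u) j = (m <= j)%N.
Proof.
pose M h := (\sum_(j < n) (signs h j) * (n - j))%N.
have [u u1 umin] : exists2 u, u \inG seg 1 n &
    forall u', u' \inG seg 1 n -> (M (g * u)%g <= M (g * u')%g)%N.
  pose P k := `[< exists2 u, u \inG seg 1 n & M (g * u) = k >].
  have exP : exists k, P k by exists (M (g * 1)); apply/asboolP; exists 1 => //; apply: subgroup1.
  case: (ex_minnP exP) => k /asboolP[u u1 <-] kmin; exists u => // u' u'1.
  by apply: kmin; apply/asboolP; exists u'.
exists u => //.
have mono j : (j.+1 < n)%N -> signs (g * u) j -> signs (g * u) j.+1.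
  move=> jn sj; apply: contraT => sj1.
  have := umin (u * tau j.+1) (subgroupM u1 (mem_seg _)); rewrite jn /= => /(_ isT).
  rewrite mulgA leqNgt => /negP[]; rewrite /M.
  pose a : 'I_n := Ordinal (ltnW jn); pose b : 'I_n := Ordinal jn.
  have ab : b != a by rewrite -val_eqE /= gtn_eqF.
  rewrite (bigD1 a) //= (bigD1 b) //= [X in (_ < X)%N](bigD1 a) //= [X in (_ < _ + X)%N](bigD1 b) //=.
  rewrite !signs_tau // /signed /= eqxx; decide_eqs; rewrite sj (negbTE sj1).
  set X := (\sum_(_ < n | _) _)%N; set Y := (\sum_(_ < n | _) _)%N.
  suff -> : X = Y by lia.
  apply: eq_bigr => i /andP[ia ib]; rewrite signs_tau //= /signed /=.
  by rewrite -!val_eqE /= in ia ib; rewrite (negbTE ia) (negbTE ib).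
pose P m := (m == n) || signs (g * u) m.
have exP : exists m, P m by exists n; rewrite /P eqxx.
case: (ex_minnP exP) => m Pm mmin; exists m => [|j jn].
  by apply: mmin; rewrite /P eqxx.
have [mj|jm] := leqP m j; last first.
  by apply: contraTF jm => sj; rewrite -leqNgt; apply: mmin; rewrite /P sj orbT.
elim: j jn mj => [|j IH] jn mj.
  have m0 : m = 0 by lia.
  by move: Pm; rewrite m0 /P => /orP[/eqP|//]; lia.
have [mE|mj'] := eqVneq m j.+1; last by apply: mono => //; apply: IH; lia.
by move: Pm; rewrite mE /P => /orP[/eqP|//]; lia.
Qed.

(** The vertex F_0 beta^i has its last i signs negative, so it is the sorted
    form of the vertices with i negative signs. *)
Lemma vertex_beta g : exists i u, [/\ (i <= n)%N, u \inG base_vertex_stab (cube n) &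
  vtx g = vtx (beta ^+ i * u)].
Proof.
have [u u1 [m mn uE]] := signs_sorted g.
exists (n - m)%N, u^-1; split; first by lia.
  by apply/stabE => k; apply: seg_sign (subgroupV u1).
have e : vtx (g * u) = vtx (beta ^+ (n - m)).
  by apply: signs_inj => j jn; rewrite uE // signs_beta //; lia.
by rewrite -vtxM -e vtxM mulgK.
Qed.

End CubeGroup.

(** * The group W *)

Lemma iter_fixed (T : Type) (f : T -> T) k p : (forall q, f q = q) -> iter k f p = p.
Proof. by move=> fq; elim: k => // k IH; rewrite iterS IH. Qed.

Section WGroup.
Variables (n s : nat).
Hypothesis n1 : (1 < n)%N.
Hypothesis s1 : (1 < s)%N.

Let V := vertex (cube n).
Implicit Types F G : V.
Notation W := (W_group (cube n) s).
Notation RW := (@W_rels n (cube n) s).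

Definition sigma F : W := pgen RW F.

Lemma antipodeK : involutive (@antipode n (cube n)).
Proof.
by move=> F; have [g ->] := vertex_ex F; rewrite !antipode_base -mulgA alpha2 mulg1.
Qed.

Lemma antipode_neq F : antipode F <> F.
Proof.
have [g ->] := vertex_ex F; rewrite antipode_base => /vertex_eq/(_ 0).
by rewrite signs_alpha ?(ltnW n1) //; case: (signs g 0).
Qed.

Lemma sigma2 F : sigma F * sigma F = 1.
Proof.
rewrite -expg2 /sigma -pi_exp; apply: pi_relator; apply: Or31; by exists F.
Qed.

Lemma sigma_order F : (sigma F * sigma (antipode F)) ^+ s = 1.
Proof. by rewrite /sigma -piM -pi_exp; apply: pi_relator; apply: Or32; exists F. Qed.

Lemma sigma_comm F G : G <> F -> G <> antipode F -> commute (sigma F) (sigma G).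
Proof.
move=> h1 h2; apply: inv_comm; try exact: sigma2.
rewrite /sigma -piM -pi_exp; apply: pi_relator; apply: Or33; by exists F, G.
Qed.

Lemma W_ind (Q : W -> Prop) : Q 1 -> (forall w F, Q w -> Q (w * sigma F)) -> forall w, Q w.
Proof.
move=> Q1 QM w; move: w (pgen_full w).
by apply: gen_ind => // [_ [F _ <-]|v _ Qv [F _ <-]]; [exact: sigma2|exact: QM].
Qed.

Lemma W_rel_pair r (T : Type) (a : V -> T -> T) :
    (forall F p, a F (a F p) = p) ->
    (forall F p, iter s (fun p => a (antipode F) (a F p)) p = p) ->
    (forall F G p, G <> F -> G <> antipode F -> a G (a F p) = a F (a G p)) ->
  forall p, RW r -> wact a r p = p.
Proof.
move=> a2 ao ac p.
case=> [[F ->]|[F ->]|[F [G [h1 h2 ->]]]]; rewrite wact_exp /wact /=.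
- exact: a2.
- exact: ao.
- by rewrite (ac F G) // !a2.
Qed.

(** ** The dihedral quotients *)

(** The dihedral group <sigma_F, sigma_(F alpha)> acts on a cycle of length
    2 s, as the reflections in the edges of one and the other parity; the
    other generators act trivially. The vertices of the cycle are the pairs
    (q, e), in the order (0, false), (0, true), (1, false), (1, true), etc. *)
Definition dih F (G : V) (p : 'I_s * bool) : 'I_s * bool :=
  if `[< G = F >] then (p.1, ~~ p.2)
  else if `[< G = antipode F >] then (if p.2 then ordS p.1 else ord_pred p.1, ~~ p.2)
  else p.

Lemma dih1 F p : dih F F p = (p.1, ~~ p.2).
Proof. by rewrite /dih; case: asboolP. Qed.

Lemma dih2 F p : dih F (antipode F) p = (if p.2 then ordS p.1 else ord_pred p.1, ~~ p.2).
Proof.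
rewrite /dih; case: asboolP => [e|_]; first by case: (antipode_neq e).
by case: asboolP.
Qed.

Lemma dih3 F G p : G <> F -> G <> antipode F -> dih F G p = p.
Proof. by move=> h1 h2; rewrite /dih; case: asboolP => // _; case: asboolP. Qed.

Lemma dihK F G : involutive (dih F G).
Proof.
move=> [q e]; have [->|h1] := pselect (G = F); first by rewrite !dih1 /= negbK.
have [->|h2] := pselect (G = antipode F); last by rewrite !dih3.
by rewrite !dih2; case: e; rewrite /= ?ordSK ?ord_predK.
Qed.

Lemma iter_ordS (q : 'I_s) k : (iter k (@ordS s) q = (q + k) %% s :> nat)%N.
Proof.
elim: k => [|k IH]; first by rewrite addn0 modn_small.
by rewrite iterS /ordS /= IH -addn1 modnDml addn1 addnS.
Qed.

Lemma iter_ordSs (q : 'I_s) : iter s (@ordS s) q = q.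
Proof. by apply: val_inj; rewrite /= iter_ordS modnDr modn_small. Qed.

Lemma iter_ord_preds (q : 'I_s) : iter s (@ord_pred s) q = q.
Proof.
have E k q' : iter k (@ord_pred s) (iter k (@ordS s) q') = q'.
  by elim: k => // k IH; rewrite iterSr iterS ordSK IH.
by rewrite -[q in LHS]iter_ordSs E.
Qed.

Lemma dih_rel F r p : RW r -> wact (dih F) r p = p.
Proof.
apply: W_rel_pair => {p} [G p|G p|G G' p GF GF'].
- exact: dihK.
- have [->|GF] := pselect (G = F).
    have E k q e : iter k (fun p => dih F (antipode F) (dih F F p)) (q, e) =
        (if e then iter k (@ord_pred s) q else iter k (@ordS s) q, e).
      elim: k => [|k IH]; first by case: e.
      by rewrite iterS IH dih1 dih2 /=; case: (e).
    case: p => q e; rewrite E; case: e; rewrite ?iter_ordSs ?iter_ord_preds //.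
  have [->|GF'] := pselect (G = antipode F).
    have E k q e : iter k (fun p => dih F (antipode (antipode F)) (dih F (antipode F) p)) (q, e) =
        (if e then iter k (@ordS s) q else iter k (@ord_pred s) q, e).
      elim: k => [|k IH]; first by case: e.
      by rewrite iterS IH dih2 antipodeK dih1 /=; case: (e).
    case: p => q e; rewrite E; case: e; rewrite ?iter_ordSs ?iter_ord_preds //.
  have E q : dih F (antipode G) (dih F G q) = q.
    rewrite !dih3 // => e; first by apply: GF'; rewrite -e antipodeK.
    by apply: GF; rewrite -(antipodeK G) e antipodeK.
  exact: iter_fixed.
have out G1 : ~ (G1 = F \/ G1 = antipode F) -> forall q, dih F G1 q = q.
    by move=> h q; apply: dih3 => e; apply: h; [left|right].
  have [i1|/out o1] := pselect (G = F \/ G = antipode F); last by rewrite !o1.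
  have [i2|/out o2] := pselect (G' = F \/ G' = antipode F); last by rewrite !o2.
  case: i1 i2 GF GF' => -> [] ->; rewrite ?antipodeK //.
Qed.

(** In the action on the cycle of F, a reflection other than sigma_F is
    trivial or the reflection along the edges of the other kind, so it moves
    the point (0, false) along one edge only, and this is not the edge along
    which sigma_F moves it; the other ends of these two edges are distinct
    as s > 1. *)
Lemma sigma_in (Q : V -> Prop) F : sigma F \inG parabolic sigma [set G | Q G] -> Q F.
Proof.
move=> hF; apply: contrapT => nQ.
have s0 : (0 < s)%N by apply: ltnW.
pose o : 'I_s := Ordinal s0.
pose ac := pact (R := RW) (dih F).
have acM p g h : ac p (g * h) = ac (ac p g) h.
  by apply: pactM => [G|r q]; [exact: dihK|exact: dih_rel].
have acg p G : ac p (sigma G) = dih F G p.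
  by apply: pact_gen => [G'|r q]; [exact: dihK|exact: dih_rel].
have ac1 p : ac p 1 = p.
  by apply: pact1 => [G'|r q]; [exact: dihK|exact: dih_rel].
suff : ac (o, false) (sigma F) = (o, false) \/ ac (o, false) (sigma F) = (ord_pred o, true).
  rewrite acg dih1 /= => -[] // /(congr1 fst)/(congr1 val) /=.
  by rewrite add0n modn_small; lia.
move: (sigma F) hF; apply: gen_ind => [_ [G _ <-]||g _ IH [G QG <-]].
- exact: sigma2.
- by left.
- have GF : G <> F by move=> e; apply: nQ; rewrite -e.
  rewrite acM !acg; have [->|GF'] := pselect (G = antipode F); last by rewrite dih3.
  by case: IH => ->; rewrite dih2 /= ?ord_predK; [right|left].
Qed.

Lemma sigma_inj : injective sigma.
Proof.
move=> F G e; apply/esym; apply: (sigma_in (Q := fun F' => F' = F)).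
by rewrite -e; apply: mem_par.
Qed.

(** ** The parity of an element of W *)

Definition parity : bool -> W -> bool := pact (fun (F : V) b => ~~ b).

Lemma parity_rel r b : RW r -> wact (fun (F : V) b => ~~ b) r b = b.
Proof.
apply: W_rel_pair => [F p|F p|F G p _ _] //; first exact: negbK.
by apply: iter_fixed => q; apply: negbK.
Qed.

Lemma parity1 b : parity b 1 = b.
Proof. by apply: pact1 => [F|]; [exact: negbK|exact: parity_rel]. Qed.

Lemma parity_sigma w F b : parity b (w * sigma F) = ~~ parity b w.
Proof.
rewrite /parity pactM ?pact_gen //; try exact: parity_rel; move=> ?; exact: negbK.
Qed.

Lemma parityM v w : parity false (v * w) = parity false v (+) parity false w.
Proof.
move: w; apply: W_ind => [|w F IH]; first by rewrite mulg1 parity1 addbF.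
by rewrite mulgA !parity_sigma IH addbN.
Qed.

(** ** The order of W *)

Section Order.
Variable F : V.

(** The normal forms of the dihedral group of the diagonal of F. *)
Fixpoint alt (i : nat) : W :=
  if i is i'.+1 then alt i' * sigma (if odd i' then antipode F else F) else 1.

Lemma alt_double j : alt j.*2 = (sigma F * sigma (antipode F)) ^+ j.
Proof.
elim: j => [|j IH] //; rewrite doubleS [LHS]/= odd_double /= IH expgSr.
by rewrite mulgA.
Qed.

Lemma alt_full : alt s.*2 = 1.
Proof. by rewrite alt_double sigma_order. Qed.

Lemma alt_last : alt s.*2.-1 = sigma (antipode F).
Proof.
have s0 : (0 < s.*2)%N by rewrite double_gt0 ltnW.
have od : odd s.*2.-1.
  by have := odd_double s; rewrite -{1}(prednK s0) /= => /negbFE.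
have : alt s.*2.-1.+1 = alt s.*2.-1 * sigma (antipode F) by rewrite /= od.
rewrite prednK // alt_full => /esym e.
by rewrite -[LHS]mulg1 -(sigma2 (antipode F)) mulgA e mul1g.
Qed.

Lemma alt_next i G : (i < s.*2)%N -> G = F \/ G = antipode F ->
  exists2 i', (i' < s.*2)%N & alt i * sigma G = alt i'.
Proof.
move=> ilt GF; have s0 : (0 < s.*2)%N by rewrite double_gt0 ltnW.
have next H : H = (if odd i then antipode F else F) ->
    exists2 i', (i' < s.*2)%N & alt i * sigma H = alt i'.
  move=> ->; have [lt|ge] := ltnP i.+1 s.*2; first by exists i.+1.
  exists 0 => //; rewrite -[RHS]alt_full (_ : s.*2 = i.+1) //.
  by apply/eqP; rewrite eqn_leq ilt ge.
have prev H : H = (if odd i then F else antipode F) ->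
    exists2 i', (i' < s.*2)%N & alt i * sigma H = alt i'.
  move=> ->; case: i {next} ilt => [|i] ilt.
    by exists s.*2.-1; [rewrite prednK|rewrite mul1g alt_last].
  exists i; first exact: ltnW.
  by rewrite /=; case: (odd i); rewrite /= -mulgA sigma2 mulg1.
by case: GF next prev => ->; case: (odd i) => next prev; by [apply: next|apply: prev].
Qed.

Definition start : 'I_s * bool := (Ordinal (ltnW s1), false).

Lemma dih_alt i : (i < s.*2)%N ->
  val (pact (dih F) start (alt i)).1 = i./2 /\ (pact (dih F) start (alt i)).2 = odd i.
Proof.
elim: i => [|i IH] ilt; first by rewrite pact1 //; [exact: dihK|exact: dih_rel].
have [IH1 IH2] := IH (ltnW ilt).
rewrite /= pactM ?pact_gen; try exact: dihK; try exact: dih_rel.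
case: (pact (dih F) start (alt i)) IH1 IH2 => q e /= IH1 ->.
case: (boolP (odd i)) => oi; last by rewrite dih1 /= IH1 uphalf_half (negbTE oi).
rewrite dih2 /= IH1 uphalf_half oi add1n modn_small //.
by have := odd_double_half i; rewrite oi; lia.
Qed.

End Order.

Definition diag (L : seq V) : set V := [set G | exists2 F, F \in L & G = F \/ G = antipode F].

(** The reflections in the ends of a new diagonal commute with the previous
    ones, and the action on the cycle of F separates the alternating words. *)
Lemma diag_order (L : seq V) : uniq L -> (forall F G, F \in L -> G \in L -> G <> antipode F) ->
  has_order (parabolic sigma (diag L)) ((2 * s) ^ size L).
Proof.
elim: L => [_ _|F L IH /= /andP[FL Lu] Lanti].
  have -> : (parabolic sigma (diag [::]) : set W) = [set 1].
    apply/seteqP; split=> [w|_ ->]; last exact: subgroup1.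
    move: w; apply: gen_ind => // [_ [G _ <-]|g _ _ [G [F //]]].
    exact: sigma2.
  exact: has_order1.
rewrite expnSr -[X in (_ * X)%N]/(2 * s)%N [X in (_ * X)%N]mul2n.
have dFL : diag (F :: L) = diag L `|` [set G | G = F \/ G = antipode F].
  apply/seteqP; split=> G.
    by move=> [F' +]; rewrite inE => /orP[/eqP ->|F'L] GF; [right|left; exists F'].
  by move=> [[F' F'L GF]|GF]; [exists F'; rewrite // inE F'L orbT|exists F; rewrite // inE eqxx].
have out G : diag L G -> G <> F /\ G <> antipode F.
  move=> [F' F'L GF']; have F'F : F' <> F by move=> e; move: FL; rewrite -e F'L.
  have F'F2 : F' <> antipode F by apply: Lanti; rewrite inE ?eqxx ?F'L ?orbT.
  case: GF' => -> //; split=> [e|/(can_inj antipodeK) //].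
  by apply: F'F2; rewrite -e antipodeK.
have altC G i : diag L G -> commute (alt F i) (sigma G).
  move=> /out[GF GF']; elim: i => [|i IHi]; first exact/commute_sym/commute1.
  apply/commute_sym/commuteM; first exact/commute_sym.
  apply: sigma_comm; case: (odd i) => e.
  - by apply: GF'; rewrite e.
  - by apply: GF; rewrite e.
  - by apply: GF; apply: (can_inj antipodeK).
  - by apply: GF'; rewrite e antipodeK.
apply: (has_order_cosets (IH Lu _) (r := alt F)).
- by move=> F' G' F'L G'L; apply: Lanti; rewrite inE ?F'L ?G'L orbT.
- by rewrite dFL; apply: par_mono => G; left.
- elim=> [|i IHi] ilt; first exact: subgroup1.
  apply: subgroupM; first by apply: IHi; apply: ltnW.
  by apply: mem_par; exists F; rewrite ?inE ?eqxx //; case: (odd i); [right|left].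
- rewrite dFL; apply: gen_ind => [_ [G _ <-]||_ _ [a [i [ha ilt ->]]] [G + <-]].
  + exact: sigma2.
  + by exists 1, 0; rewrite mulg1; split; [exact: subgroup1|rewrite double_gt0 ltnW|].
  + case=> [GL|GF].
      exists (a * sigma G), i; split=> //; first by apply: subgroupM => //; apply: mem_par.
      by rewrite -!mulgA (altC G i GL).
    have [i' i'lt e] := alt_next ilt GF.
    by exists a, i'; split=> //; rewrite -mulgA e.
- move=> a i j ha ilt jlt /(congr1 (pact (dih F) (start))).
  have fixa : pact (R := RW) (dih F) start a = start.
    move: a ha; apply: gen_ind => [_ [G _ <-]||g _ IHg [G /out[GF GF'] <-]].
    - exact: sigma2.
    - by apply: pact1; [exact: dihK|exact: dih_rel].
    - rewrite pactM ?pact_gen; try exact: dihK; try exact: dih_rel.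
      by rewrite IHg dih3.
  rewrite pactM ?fixa; try exact: dihK; try exact: dih_rel.
  have [i1 i2] := dih_alt F ilt; have [j1 j2] := dih_alt F jlt.
  move=> e; rewrite -(odd_double_half i) -(odd_double_half j).
  by rewrite -i1 -i2 -j1 -j2 e.
Qed.

(** The vertices whose last sign is positive represent the diagonals. *)
Lemma W_order : has_order [set: W] ((2 * s) ^ (2 ^ n.-1)).
Proof.
pose v (u : {ffun 'I_n.-1 -> bool}) (j : nat) : bool :=
  if insub j is Some i then u i else false.
have /choice[g gE] u := @signs_ex n (v u).
pose L := [seq vtx (g u) | u : {ffun 'I_n.-1 -> bool}].
have last0 u : signs (g u) n.-1 = false.
  rewrite gE; last by lia.
  by rewrite /v insubN // ltnn.
have vinj u u' : vtx (g u) = vtx (g u') -> u = u'.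
  move/vertex_eq => e; apply/ffunP => i.
  have := e i; rewrite !gE; try by have := ltn_ord i; lia.
  by rewrite /v valK.
have sL : size L = (2 ^ n.-1)%N by rewrite size_map -cardE card_ffun card_bool card_ord.
rewrite -sL; have -> : [set: W] = parabolic sigma (diag L).
  apply/seteqP; split=> // w _; apply: par_mono (pgen_full w) => F _.
  have [h ->] := vertex_ex F.
  pose u (h' : cube_group n) : {ffun 'I_n.-1 -> bool} := [ffun i : 'I_n.-1 => signs h' i].
  have cov (h' : cube_group n) : signs h' n.-1 = false -> vtx h' = vtx (g (u h')).
    move=> h0; apply: signs_inj => j jn; rewrite gE // /v.
    have [lt|ge] := ltnP j n.-1; first by rewrite insubT ffunE.
    by rewrite insubN -?leqNgt // -h0; congr signs; lia.
  have inL u' : vtx (g u') \in L by apply: map_f; rewrite mem_enum.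
  case: (boolP (signs h n.-1)) => h0; last first.
    by exists (vtx (g (u h))) => //; left; apply: cov; apply: negbTE.
  exists (vtx (g (u (h * beta n ^+ n)))) => //; right.
  rewrite -cov ?antipode_base -?mulgA ?alpha2 ?mulg1 // signs_alpha ?h0 //; lia.
apply: diag_order.
  by rewrite map_inj_uniq ?enum_uniq //; exact: vinj.
move=> F G /mapP[u _ ->] /mapP[u' _ ->]; rewrite antipode_base => /vertex_eq/(_ n.-1).
by rewrite signs_alpha ?last0 //; lia.
Qed.

End WGroup.

(** * The group of the polytope and its halving group *)

Section SemiDirectProduct.
Variables (n s : nat).

Notation Gh := (power2_group (cube n) s).
Notation W := (W_group (cube n) s).

Definition inW (w : W) : Gh := sd_inl (W_action (cube n) s) w.
Definition inG (g : cube_group n) : Gh := sd_inr (W_action (cube n) s) g.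

Lemma mulE (z z' : Gh) : z * z' = (z.1 * W_act z'.1 z.2^-1, z.2 * z'.2) :> Gh.
Proof. by []. Qed.

Lemma W_act1l g : W_act 1 g = 1 :> W.
Proof. exact: gact1l (W_action (cube n) s) g. Qed.

Lemma inWM : {morph inW : v w / v * w}.
Proof. by move=> v w; rewrite mulE /= invg1 W_act1 mulg1. Qed.

Lemma inGM : {morph inG : g h / g * h}.
Proof. by move=> g h; rewrite mulE /= W_act1l mulg1. Qed.

Lemma inW_inG w g : inW w * inG g = (w, g).
Proof. by rewrite mulE /= W_act1l mulg1 mul1g. Qed.

Lemma inW_inj : injective inW.
Proof. by move=> v w []. Qed.

Lemma inG_inj : injective inG.
Proof. by move=> v w []. Qed.

Lemma inW_conj w g : (inG g)^-1 * inW w * inG g = inW (W_act w g).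
Proof.
rewrite -(morphV inGM) !mulE /= invgK !W_act1l.
by rewrite !mulg1 mul1g mulVg.
Qed.

Lemma snd_morph : {morph (fun z : Gh => z.2) : z z' / z * z'}.
Proof. by []. Qed.

Definition vrefl (F : vertex (cube n)) : Gh := inW (sigma s F).

Lemma vrefl_conj g h : (inG g)^-1 * vrefl (vtx h) * inG g = vrefl (vtx (h * g)).
Proof. by rewrite inW_conj W_act_pi /= vtxM. Qed.

Lemma vrefl2 F : vrefl F * vrefl F = 1.
Proof. by rewrite -inWM sigma2. Qed.

Definition rho0 : Gh := vrefl (vtx 1).

Lemma rho0_2 : rho0 * rho0 = 1.
Proof. exact: vrefl2. Qed.

Lemma rho0_conj g : (inG g)^-1 * rho0 * inG g = vrefl (vtx g).
Proof. by rewrite vrefl_conj mul1g. Qed.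

Lemma rho0_stab u : u \inG base_vertex_stab (cube n) -> commute rho0 (inG u).
Proof.
move=> hu; have : (inG u)^-1 * rho0 * inG u = rho0.
  rewrite rho0_conj; congr vrefl; apply/vtx_eq; rewrite mul1g; exact: subgroupV.
by move=> e; rewrite /commute -{2}e !mulgA mulgV mul1g.
Qed.

Lemma seg_base_stab : base_vertex_stab (cube n) = seg n 1 n :> set _.
Proof.
apply/seteqP; split; apply: par_mono => i /=; first by rewrite lt0n => -> /=.
by rewrite lt0n => /andP[].
Qed.

Lemma tau_stab j : (0 < j)%N -> tau n j \inG base_vertex_stab (cube n).
Proof.
move=> j0; rewrite seg_base_stab; have [jn|nj] := ltnP j n.
  by apply: mem_seg; rewrite j0.
by rewrite tau_ge //; apply: subgroup1.
Qed.

(** The generators rho_j, and the generators x_j of the halving group below,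
    are indexed by nat to state their relations uniformly. *)
Definition rho (j : nat) : Gh := if j is j'.+1 then inG (tau n j') else rho0.

Lemma rhoE i : power2_rho (cube n) s i = rho i.
Proof.
rewrite /power2_rho; case: unliftP => [j ->|->] /=.
  by rewrite /rho /= -tau_ord.
by rewrite /rho /rho0 /vrefl vtx1.
Qed.

Lemma rho2 j : rho j * rho j = 1.
Proof. by case: j => [|j]; [exact: rho0_2|rewrite /rho -inGM tau2 (morph1 inGM)]. Qed.

Definition trho (j : nat) : Gh := if j is 0 then rho0 * rho 1 * rho0 else rho j.

Lemma trho2 j : trho j * trho j = 1.
Proof.
case: j => [|j]; last exact: rho2.
by rewrite /trho !mulgA -(mulgA _ rho0 rho0) rho0_2 mulg1 -(mulgA _ (rho 1) (rho 1)) rho2 mulg1 rho0_2.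
Qed.

Lemma rho0_comm j : (1 < j)%N -> commute rho0 (rho j).
Proof. by case: j => [|[|j]] // _; apply: rho0_stab; apply: tau_stab. Qed.

Lemma rho_comm k l : (0 < k)%N -> (k.+1 < l)%N -> commute (rho k) (rho l).
Proof.
case: k l => [//|k] [//|l] _ kl; rewrite /commute /rho -!inGM; congr inG.
exact: tau_comm.
Qed.

Lemma trho_comm k l : (k.+1 < l)%N -> (2 < l)%N -> commute (trho k) (trho l).
Proof.
case: k => [|k] kl l2; case: l kl l2 => // l kl l2; last exact: rho_comm.
have h1 : commute (trho l.+1) rho0 by apply/commute_sym/rho0_comm; apply: ltnW.
apply/commute_sym; apply: commuteM => //; apply: commuteM => //.
by apply/commute_sym/rho_comm.
Qed.

Lemma conj_rho0K z : rho0 * (rho0 * z * rho0) * rho0 = z.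
Proof. by rewrite !mulgA rho0_2 mul1g -mulgA rho0_2 mulg1. Qed.

Lemma conj_rho0M : {morph (fun z : Gh => rho0 * z * rho0) : a b / a * b}.
Proof. by move=> a b; rewrite !mulgA -(mulgA _ rho0 rho0) rho0_2 mulg1. Qed.

Lemma conj_rho0_trho j : rho0 * trho j * rho0 = trho (if j == 0 then 1 else if j == 1 then 0 else j)%N.
Proof.
case: j => [|[|j]] //=; first exact: conj_rho0K.
by rewrite (rho0_comm (j := j.+2)) // -mulgA rho0_2 mulg1.
Qed.

End SemiDirectProduct.

Section Halving.
Variables (n s : nat).
Hypothesis n1 : (1 < n)%N.
Hypothesis s1 : (1 < s)%N.

Notation Gh := (power2_group (cube n) s).
Notation trho := (@trho n s).
Notation rho0 := (@rho0 n s).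
Notation inG := (@inG n s).
Notation inW := (@inW n s).

Definition hgen : 'I_n.+1 -> Gh := halving_gen (@power2_rho n (cube n) s).

Let H := parabolic hgen setT.
Let Hi i := parabolic hgen [set j | j <> i].
Let o1 : 'I_n.+1 := inord 1.

Let o1E : o1 = 1%N :> nat.
Proof. by rewrite /o1 inordK // ltnW. Qed.

Lemma hgenE i : hgen i = trho i.
Proof.
rewrite /hgen /halving_gen; case: eqP => [->|i0]; first by rewrite !rhoE o1E.
by rewrite rhoE; case: i i0 => [[|i]] lt // i0; case: i0; apply: val_inj.
Qed.

Lemma hgen2 i : hgen i * hgen i = 1.
Proof. by rewrite hgenE trho2. Qed.

Lemma hgen_comm (k l : 'I_n.+1) : (k.+1 < l)%N -> (2 < l)%N -> commute (hgen k) (hgen l).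
Proof. by move=> kl l2; rewrite !hgenE; apply: trho_comm. Qed.

Lemma tau_neq1 j : (j < n)%N -> tau n j <> 1.
Proof.
move=> jn e; have := act_tau (j, false) jn; rewrite e act1.
by case: j {jn e} => [|j]; rewrite /signed //= eqxx => -[]; lia.
Qed.

Lemma hgen_neq1 i : hgen i <> 1.
Proof.
have R0 j : (j < n)%N -> rho n s j.+1 <> 1.
  by move=> jn; rewrite -(morph1 (@inGM n s)) => /inG_inj; apply: tau_neq1.
rewrite hgenE; case: i => [[|i] lt] /=; last exact: R0.
move=> e; apply: (R0 0); first exact: ltnW.
by rewrite -[rho _ _ _]conj_rho0K [rho0 * rho _ _ _ * rho0]e mulg1 rho0_2.
Qed.

Lemma trhoE j : (j < n.+1)%N -> trho j = hgen (inord j).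
Proof. by move=> jn; rewrite hgenE inordK. Qed.

Lemma mem_par_trho (J : set 'I_n.+1) j : (j < n.+1)%N -> J (inord j) -> trho j \inG parabolic hgen J.
Proof. by move=> jn Jj; rewrite trhoE //; apply: mem_par. Qed.

Lemma par_trho_ind (J : set 'I_n.+1) (Q : Gh -> Prop) : Q 1 ->
  (forall z (i : 'I_n.+1), Q z -> J i -> Q (z * trho i)) -> forall z, z \inG parabolic hgen J -> Q z.
Proof.
move=> Q1 QM; apply: gen_ind => // [_ [i _ <-]|z _ Qz [i Ji <-]]; first exact: hgen2.
by rewrite hgenE; apply: QM.
Qed.

Lemma inG_seg b a g : g \inG seg n b a -> inG g \inG parabolic hgen [set i | (b < i <= a)%N].
Proof.
move: g; apply: seg_ind => [|g j IH ja jn]; first by rewrite (morph1 (@inGM n s)); apply: subgroup1.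
rewrite inGM; apply: subgroupM => //; apply: (mem_par_trho (j := j.+1)) => //=.
by rewrite inordK.
Qed.

Lemma seg_inG b a z : z \inG parabolic hgen [set i | (b < i <= a)%N] ->
  exists2 g, g \inG seg n b a & z = inG g.
Proof.
move: z; apply: par_trho_ind => [|_ [[|i] lt] [g hg ->] /= ib] //.
  by exists 1; [apply: subgroup1|rewrite (morph1 (@inGM n s))].
exists (g * tau n i); last by rewrite inGM.
by apply: subgroupM => //; apply: mem_seg.
Qed.

Lemma H0E z : z \inG Hi ord0 -> exists g, z = inG g.
Proof.
move=> hz; have [|g _ ->] := @seg_inG 0 n z; last by exists g.
apply: par_mono hz => i /= i0; apply/andP; split; last by rewrite -ltnS.
by rewrite lt0n; apply/eqP => e; apply: i0; apply: val_inj.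
Qed.

(** Conjugation by rho_0 exchanges the generators 0 and 1 and fixes the
    others. *)
Lemma par_conj (J J' : set 'I_n.+1) z :
    (forall i : 'I_n.+1, J i -> J' (if (i == 0 :> nat)%N then o1 else if (i == 1 :> nat)%N then ord0 else i)) ->
  z \inG parabolic hgen J -> rho0 * z * rho0 \inG parabolic hgen J'.
Proof.
move=> JJ'; move: z; apply: par_morph => [|i Ji]; first exact: conj_rho0M.
rewrite hgenE conj_rho0_trho; have := JJ' i Ji.
case: eqP => [_ Ji'|_]; first by rewrite -[1%N]o1E -hgenE; apply: mem_par.
by case: eqP => [_ Ji'|_ Ji']; rewrite -1?[0%N]/(nat_of_ord (@ord0 n)) -hgenE; apply: mem_par.
Qed.

Lemma H1E z : z \inG Hi o1 -> exists g, z = rho0 * inG g * rho0.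
Proof.
move=> hz; have [|g e] := @H0E (rho0 * z * rho0); last by exists g; rewrite -e conj_rho0K.
apply: par_conj hz => i /= i1; case: eqP => [_ e|i0].
  by move: (congr1 val e); rewrite /= o1E.
by case: eqP => [e|_ e]; [case: i1; apply: val_inj; rewrite /= o1E|case: i0; rewrite e].
Qed.

Lemma H0_inG g : inG g \inG Hi ord0.
Proof.
apply: par_mono (inG_seg (seg_full g)) => i /= /andP[i0 _] e.
by rewrite e in i0.
Qed.

Lemma low_snd m z : (1 < m <= n.+1)%N -> z \inG parabolic hgen [set i | (i < m)%N] ->
  z.2 \inG seg n 0 m.-1.
Proof.
move=> /andP[m1 mn]; move: z; apply: par_trho_ind => [|z i IH im]; first exact: subgroup1.
rewrite snd_morph; apply: subgroupM => //.
case: i im => [[|i] lt] /= im; last by apply: mem_seg; lia.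
by rewrite mul1g mulg1; apply: mem_seg; lia.
Qed.

Lemma low_H0 (m : nat) g : (1 < m <= n.+1)%N ->
  g \inG parabolic hgen [set i | (i < m)%N] -> g \inG Hi ord0 ->
  g \inG parabolic hgen [set i | (0 < i < m)%N].
Proof.
move=> mn gm /H0E[h gE]; rewrite gE in gm *.
have := inG_seg (low_snd mn gm); apply: par_mono => i /=; lia.
Qed.

Lemma low_conj m z : (1 < m)%N -> z \inG parabolic hgen [set i | (i < m)%N] ->
  rho0 * z * rho0 \inG parabolic hgen [set i | (i < m)%N].
Proof.
move=> m1; apply: par_conj => i /= im; case: eqP => [_|_]; first by rewrite o1E.
by case: eqP => // _; apply: ltnW.
Qed.

Lemma low_H1 (m : nat) g : (1 < m <= n.+1)%N ->
  g \inG parabolic hgen [set i | (i < m)%N] -> g \inG Hi o1 ->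
  g \inG parabolic hgen [set i | i <> o1 /\ (i < m)%N].
Proof.
move=> mn gm /H1E[h gE]; have m1 : (1 < m)%N by case/andP: mn.
have := low_conj m1 gm; rewrite {1}gE conj_rho0K => hm.
have := low_H0 mn hm (H0_inG h).
rewrite gE; apply: par_conj => i /= /andP[i0 im].
rewrite gtn_eqF //; case: eqP => [_|i1]; last by split=> // e; apply: i1; rewrite e o1E.
by split; [move/(congr1 val); rewrite /= o1E|apply: ltnW].
Qed.

(** An element of H_0 and H_1 conjugates rho_0 to itself, so it fixes the
    base vertex, as distinct vertices have distinct reflections. *)
Lemma low_H01 (m : nat) g : (1 < m <= n.+1)%N ->
  g \inG parabolic hgen [set i | (i < m)%N] -> g \inG Hi ord0 -> g \inG Hi o1 ->
  g \inG parabolic hgen [set i | (1 < i < m)%N].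
Proof.
move=> mn gm /H0E[h gE] /H1E[h' gE']; rewrite gE in gm gE' *.
have hm := low_snd mn gm.
have : (inG h)^-1 * rho0 * inG h = inG (h^-1 * h') * rho0.
  by rewrite inGM (morphV (@inGM n s)) -!mulgA; congr (_ * _); rewrite gE' !mulgA rho0_2 mul1g.
rewrite rho0_conj => e.
have e2 : h^-1 * h' = 1.
  by move: (congr1 (fun z : Gh => z.2) e) => /=; rewrite mulg1 => <-.
move: e; rewrite e2 (morph1 (@inGM n s)) mul1g => /inW_inj/(sigma_inj n1 s1)/esym/vtx_eq.
rewrite invg1 mulg1 -[_ \inG _]/((_ : set _) h) seg_base_stab => h1.
have hS : h \inG seg n 1 m.-1 by apply: seg_inter => //; lia.
have := inG_seg hS; apply: par_mono => i /=; lia.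
Qed.

Lemma low_high (i m : nat) g : (1 < i < m)%N -> (m <= n.+1)%N ->
  g \inG parabolic hgen [set i | (i < m)%N] -> g \inG parabolic hgen [set j | (i < j)%N] ->
  g \inG parabolic hgen [set j | (i < j < m)%N].
Proof.
move=> im mn gm gi; have [|h hi gE] := @seg_inG i n g.
  by apply: par_mono gi => j /= ->; rewrite -ltnS /=.
rewrite gE in gm *; have hm : h \inG seg n 0 m.-1 by apply: (low_snd _ gm); lia.
have hS : h \inG seg n i m.-1.
  by case: i im gi hi => // i im gi hi; apply: seg_inter => //; lia.
have := inG_seg hS; apply: par_mono => j /=; lia.
Qed.

(** The base face of rank k of the cube, as an orbit of F_0, its stabilizer,
    and the extension of the latter by the reflections in the vertices of
    the face. *)
Let face k (F : vertex (cube n)) := exists2 u, u \inG seg n 0 k & F = vtx u.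
Let stab k := parabolic (@cube_tau n) [set j | (j != k :> nat)].

Lemma face_stab k g F : g \inG stab k -> face k F -> face k (@vertex_act n (cube n) g F).
Proof.
move=> hg [u hu ->]; rewrite vtxM.
have : exists2 v, v \inG seg n 0 k & vtx (u * g) = vtx v.
  move: g hg; apply: gen_ind => [_ [j _ <-]||g _ [v hv gE] [j jk <-]].
  - by rewrite -tau_ord tau2.
  - by exists u; rewrite ?mulg1.
  rewrite -tau_ord mulgA -vtxM gE vtxM.
  have [lt|gt|e] := ltngtP (nat_of_ord j) k; last by case/eqP: jk.
    by exists (v * tau n j) => //; apply: subgroupM => //; apply: mem_seg.
  exists v => //; have -> : v * tau n j = tau n j * v.
    apply/esym; move: v hv {gE}; apply: seg_ind => [|v i IH ik _].
      by rewrite mulg1 mul1g.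
    by rewrite mulgA IH -!mulgA (@tau_comm n i j) //; lia.
  apply/esym/vtx_eq; rewrite mulgK; apply: tau_stab; lia.
by move=> [v hv ->]; exists v.
Qed.

Lemma face_W_act k g w : g \inG stab k -> w \inG parabolic (sigma s) (face k) ->
  W_act w g \inG parabolic (sigma s) (face k).
Proof.
move=> hg; move: w; apply: (@par_morph _ _ (@sigma n s) _ (fun w => W_act w g) (face k)) => [a b|F Ff].
  exact: W_actMl.
rewrite /sigma W_act_pi; exact/mem_par/face_stab.
Qed.

Definition face_group (k : nat) : subgroup Gh.
Proof.
exists [set z : Gh | z.1 \inG parabolic (sigma s) (face k) /\ z.2 \inG stab k].
- by split; apply: subgroup1.
- move=> z z' [z1 z2] [z1' z2']; rewrite mulE /=; split; last exact: subgroupM.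
  by apply: subgroupM => //; apply: face_W_act => //; apply: subgroupV.
- move=> z [z1 z2]; split; last exact: subgroupV.
  by apply: face_W_act => //; apply: subgroupV.
Defined.

Lemma Hi_face (i : 'I_n.+1) z : (1 < i)%N -> z \inG Hi i -> z \inG face_group i.-1.
Proof.
move=> i1; have face1 : face i.-1 (vtx 1) by exists 1 => //; apply: subgroup1.
have cf : rho0 \inG face_group i.-1 by split; [apply: mem_par|apply: subgroup1].
have Rf j : (j != i.-1)%N -> (j < n)%N -> rho n s j.+1 \inG face_group i.-1.
  move=> ji jn; split; first exact: subgroup1.
  by rewrite /= (tau_ord (Ordinal jn)); apply: mem_par.
apply: par_sub => -[j jn] /= ji; rewrite hgenE /=.
case: j jn ji => [|j] jn ji.
  apply: subgroupM => //; apply: subgroupM => //; apply: Rf; lia.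
apply: Rf => //; apply/eqP => e; apply: ji; apply: val_inj => /=; lia.
Qed.

(** Elements of type 0 and 1 are the even and the odd vertices of the
    polytope, joined by an edge if they differ by some sigma_F. If both ends
    of the edge lie in a face of the polytope, then sigma_F preserves this
    face, and by sigma_in the vertex F belongs to the corresponding face of
    the cube; so the edge lies in the face. *)
Lemma H0_HiH1 (i : 'I_n.+1) p q : (1 < i)%N ->
  p \inG Hi i -> q \inG Hi o1 -> p * q \inG Hi ord0 ->
  exists u v, [/\ u \inG Hi i, v \inG parabolic hgen [set j | (1 < j)%N] & p * q = u * v].
Proof.
move=> i1 hp /H1E[g' qE] /H0E[g pqE].
pose d := g * g'^-1.
have pE : p = inW (sigma s (vtx g^-1) * sigma s (vtx d^-1)) * inG d.
  rewrite inWM -![inW (sigma _ _)]/(vrefl _ _) -!rho0_conj !(morphV (@inGM n s)) !invgK.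
  rewrite -mulgA mulgVK.
  have -> : inG d = inG g * (inG g')^-1 by rewrite /d inGM (morphV (@inGM n s)).
  have -> : p = inG g * (rho0 * inG g' * rho0)^-1 by rewrite -qE -pqE mulgK.
  by rewrite !invgM (mulg1_eq (rho0_2 _ _)) !mulgA mulgVK.
have [p1 p2] := Hi_face i1 hp.
have dE : d \inG stab i.-1 by move: p2; rewrite pE inW_inG.
have [|u hu gu] := @sigma_in n s n1 s1 (face i.-1) (vtx g^-1).
  have fd : face i.-1 (vtx d^-1).
    rewrite -[d^-1]mul1g -vtxM; apply: face_stab; first exact: subgroupV.
    by exists 1 => //; apply: subgroup1.
  move: p1; rewrite pE inW_inG /= => h.
  rewrite -[sigma _ _]mulg1 -(sigma2 s (vtx d^-1)) mulgA.
  by apply: subgroupM => //; apply: mem_par.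
have ug : u * g \inG seg n 1 n.
  move/vtx_eq: gu; rewrite invgK -[_ \inG _]/((_ : set _) (u * g)) seg_base_stab; exact.
exists (inG u^-1), (inG (u * g)); split.
- have := inG_seg (subgroupV hu); apply: par_mono => j /= ji e; move: ji; rewrite e; lia.
- by have := inG_seg ug; apply: par_mono => j /=; lia.
- by rewrite -inGM mulKg -pqE.
Qed.

Lemma halving_IP (J : set 'I_n.+1) g : g \inG H ->
  (forall j, J j -> g \inG Hi j) -> g \inG parabolic hgen (~` J).
Proof.
apply: fork_intersection => //; [exact: hgen_comm|exact: low_H0|exact: low_H1|exact: low_H01|].
exact: low_high.
Qed.

Lemma halving_FC (J : set 'I_n.+1) (d : 'I_n.+1 -> Gh) :
    (forall j, J j -> d j \inG H) ->
    (forall i j, J i -> J j -> exists z, rcoset (Hi i) (d i) z /\ rcoset (Hi j) (d j) z) ->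
  exists2 z, z \inG H & forall j, J j -> rcoset (Hi j) (d j) z.
Proof. apply: fork_common => //; [exact: hgen_comm|exact: H0_HiH1]. Qed.

End Halving.

(** * The order of the halving group *)

Section HalvingOrder.
Variables (n s : nat).
Hypothesis n1 : (1 < n)%N.
Hypothesis s1 : (1 < s)%N.

Notation Gh := (power2_group (cube n) s).
Notation trho := (@trho n s).
Notation rho0 := (@rho0 n s).
Notation inG := (@inG n s).
Notation inW := (@inW n s).
Let H := parabolic (@hgen n s) setT.

Definition odd_elt (z : Gh) : bool := parity false z.1.

Lemma parity_act w g : parity false (W_act w g) = @parity n s false w.
Proof.
move: w; apply: W_ind => [|w F IH]; first by rewrite W_act1l parity1.
by rewrite W_actMl /sigma W_act_pi !parity_sigma IH.
Qed.

Lemma odd_eltM z z' : odd_elt (z * z') = odd_elt z (+) odd_elt z'.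
Proof. by rewrite /odd_elt mulE /= parityM parity_act. Qed.

Lemma odd_rho0 : odd_elt rho0.
Proof. by rewrite /odd_elt /= -[sigma _ _]mul1g parity_sigma parity1. Qed.

Lemma odd_inG g : odd_elt (inG g) = false.
Proof. exact: parity1. Qed.

Lemma odd_trho j : odd_elt (trho j) = false.
Proof. by case: j => [|j]; rewrite /= ?odd_eltM ?odd_rho0 odd_inG. Qed.

Lemma trho_H j : (j < n.+1)%N -> trho j \inG H.
Proof. by move=> jn; apply: mem_par_trho. Qed.

Lemma rho_H j : (0 < j <= n)%N -> rho n s j \inG H.
Proof. by case: j => // j jn; apply: (trho_H (j := j.+1)). Qed.

(** Conjugation by rho_0 permutes the generators of H, so the union of H and
    H rho_0 is closed under multiplication by the generators of the whole
    group. *)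
Lemma halving_cover z : z \inG H \/ z * rho0 \inG H.
Proof.
pose Q (z : Gh) := z \inG H \/ z * rho0 \inG H.
have Qc y : Q y -> Q (y * rho0) by case=> h; [right; rewrite -mulgA rho0_2 mulg1|left].
have Qr y g : Q y -> Q (y * inG g).
  move=> Qy; move: g (seg_full g); apply: seg_ind => [|g j IH _ jn].
    by rewrite (morph1 (@inGM n s)) mulg1.
  have RH : rho n s j.+1 \inG H by apply: rho_H.
  rewrite inGM mulgA -[inG (tau n j)]/(rho n s j.+1); case: IH => h.
    by left; apply: subgroupM.
  right; have -> : y * inG g * rho n s j.+1 * rho0 = y * inG g * rho0 * (rho0 * rho n s j.+1 * rho0).
    by rewrite !mulgA -(mulgA _ rho0 rho0) rho0_2 mulg1.
  apply: subgroupM => //; case: j jn {RH} => [|j] jn; first exact: (trho_H (j := 0)).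
  by rewrite (rho0_comm n s (j := j.+2)) // -mulgA rho0_2 mulg1; apply: rho_H.
have Ql w : Q (inW w).
  move: w; apply: W_ind => [|w F IH]; first by left; rewrite (morph1 (@inWM n s)); apply: subgroup1.
  have [h ->] := vertex_ex F; rewrite inWM -[inW (sigma _ _)]/(vrefl _ _) -rho0_conj.
  by rewrite -(morphV (@inGM n s)) !mulgA; apply: (Qr); apply: Qc; apply: Qr.
have -> : z = inW z.1 * inG z.2 by rewrite inW_inG; case: (z).
exact: Qr.
Qed.

(** The parity of the component in W distinguishes H from its other coset. *)
Lemma halvingE z : z \inG H <-> odd_elt z = false.
Proof.
have even y : y \inG H -> odd_elt y = false.
  move: y; apply: (par_trho_ind n1) => [|y i IH _]; first by rewrite -(morph1 (@inGM n s)) odd_inG.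
  by rewrite odd_eltM IH odd_trho.
split; first exact: even.
by case: (halving_cover z) => // /even; rewrite odd_eltM odd_rho0 addbT => /negbFE ->.
Qed.

Lemma halving_order : has_order H ((2 * s) ^ (2 ^ n.-1) * 2 ^ n.-1 * n`!).
Proof.
have -> : ((2 * s) ^ (2 ^ n.-1) * 2 ^ n.-1 * n`! =
    ((2 * s) ^ (2 ^ n.-1) * (2 ^ n * n`!))./2)%N.
  case: n n1 => // m _; rewrite [in (2 ^ m.+1)%N]expnS -/(m.+1.-1) /=.
  move: ((2 * s) ^ (2 ^ m))%N (2 ^ m)%N (m.+1`!)%N => a b d; rewrite -[LHS]doubleK; congr _./2; lia.
apply: (@has_order_half _ _ rho0).
  have := has_order_prod (W_order n1 s1) (cube_order n).
  by congr has_order; apply/seteqP; split.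
by move=> z; rewrite !halvingE odd_eltM odd_rho0 addbT; case: (odd_elt z); split.
Qed.

End HalvingOrder.

(** * The presentation of the halving group *)

(** The common part rho_2 .. rho_n of beta and ~beta, for any family y in
    place of the generators. *)
Definition tail n (K : groupType) (y : 'I_n.+2 -> K) : K :=
  \prod_(i <- enum 'I_n) y (lift ord0 (lift ord0 i)).

Section BetaWords.
Variables (n : nat) (K : groupType) (y : 'I_n.+2 -> K).

Lemma wval_filter (P : pred 'I_n.+2) :
  wval y [seq (i, true) | i <- [seq i <- enum 'I_n.+2 | P i]] =
  (if P ord0 then y ord0 else 1) * ((if P (inord 1) then y (inord 1) else 1) *
    \prod_(i <- enum 'I_n | P (lift ord0 (lift ord0 i))) y (lift ord0 (lift ord0 i))).
Proof.
have -> : inord 1 = lift ord0 ord0 :> 'I_n.+2 by apply: val_inj; rewrite /= inordK.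
rewrite wval_seq big_filter big_mkcond enum_ordSl big_cons big_map.
by rewrite enum_ordSl big_cons big_map [in RHS]big_mkcond.
Qed.

Lemma wval_beta : wval y (beta_word n.+1) = y (inord 1) * tail y.
Proof. by rewrite wval_filter inordK //= mul1g. Qed.

Lemma wval_tbeta : wval y (tbeta_word n.+1) = y ord0 * tail y.
Proof. by rewrite wval_filter inordK //= mul1g. Qed.

End BetaWords.

Lemma halving_matrixC n (i j : 'I_n.+1) : halving_matrix i j = halving_matrix j i.
Proof. by rewrite /halving_matrix minnC maxnC. Qed.

Lemma commute_exp2 (K : groupType) (a b : K) : a * a = 1 -> b * b = 1 -> commute a b ->
  (a * b) ^+ 2 = 1.
Proof. by move=> a2 b2 ab; rewrite expg2 {1}ab -mulgA (mulgA a) a2 mul1g. Qed.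

Lemma exp_swap (K : groupType) (a b : K) k : (a * b) ^+ k = 1 -> (b * a) ^+ k = 1.
Proof.
move=> e; have -> : b * a = (a * b) ^ b^-1 by rewrite conjgE invgK !mulgA mulgK.
by rewrite -conjXg e conj1g.
Qed.

Section HalvingRelations.
Variables (n s : nat).
Hypothesis n1 : (1 < n)%N.

Notation trho := (@trho n s).
Notation rho0 := (@rho0 n s).

Lemma inG_exp g k : inG s g ^+ k = @inG n s (g ^+ k).
Proof. exact/esym/(morphX (@inGM n s)). Qed.

Lemma vrefl_comm F G : G <> F -> G <> antipode F -> commute (vrefl s F) (@vrefl n s G).
Proof. by move=> h1 h2; rewrite /commute /vrefl -!inWM sigma_comm. Qed.

Lemma signs1 j : signs (1 : cube_group n) j = false.
Proof. by rewrite /signs invg1 act1. Qed.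

(** For 0 < i < n the vertex F_0 beta^i has its first sign positive and its
    last one negative. *)
Lemma beta_vtx i : (0 < i < n)%N ->
  vtx (beta n ^+ i) <> vtx 1 /\ vtx (beta n ^+ i) <> antipode (vtx 1).
Proof.
move=> lti; split; first by move/vertex_eq/(_ n.-1); rewrite signs1 signs_beta //; lia.
rewrite antipode_base => /vertex_eq/(_ 0); rewrite signs_alpha ?signs1 ?signs_beta //; lia.
Qed.

Lemma trho_rel (i j : nat) : (i < j <= n)%N ->
  (trho i * trho j) ^+ (if (i < 2) && (j == 2) then 4 else if (2 <= i) && (j == i.+1) then 3 else 2) = 1.
Proof.
move=> /andP[ij jn].
have tau_rel k l m : (k < l < n)%N ->
    m = (if l == k.+1 then if k == 0 then 4 else 3 else 2)%N -> (trho k.+1 * trho l.+1) ^+ m = 1.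
  move=> /andP[kl ln] ->; rewrite -inGM inG_exp -[RHS](morph1 (@inGM n s)); congr (inG s _).
  have := cube_rel (Ordinal (ltn_trans kl ln)) (Ordinal ln).
  rewrite /string_matrix -val_eqE /= (ltn_eqF kl) (eq_sym k.+1).
  by have -> : (l.+1 == k) = false by lia.
case: i j ij jn => [|i] [|j] // ij jn; last first.
  apply: tau_rel; first by lia.
  by case: i {ij} => [|i]; rewrite /= !eqSS; case: ifP.
case: j ij jn => [|[|j]] ij jn.
- rewrite -[LHS]/((trho 0 * trho 1) ^+ 2); have -> : trho 0 * trho 1 = rho0 * vrefl s (vtx (tau n 0)).
    by rewrite -[in RHS](rho0_conj s) (mulg1_eq (rho2 n s 1)) !mulgA.
  apply: commute_exp2; try exact: vrefl2.
  apply: vrefl_comm; first by move/vertex_eq/(_ 0); rewrite -[tau n 0]mul1g signs_tau ?signs1 //; lia.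
  rewrite antipode_base => /vertex_eq/(_ n.-1); rewrite -[tau n 0]mul1g signs_tau ?(ltnW n1) //.
  by rewrite signs_alpha ?signs1 //; lia.
- rewrite -[LHS]/((trho 0 * trho 2) ^+ 4); have -> : trho 0 * trho 2 = (trho 1 * trho 2) ^ rho0.
    rewrite conjgE (mulg1_eq (rho0_2 n s)) -(mulgA (trho 1)) -[trho 2 * rho0](rho0_comm n s (j := 2)) //.
    by rewrite /= !mulgA.
  by rewrite -conjXg tau_rel ?conj1g.
- rewrite -[LHS]/((trho 0 * trho j.+3) ^+ 2).
  by apply: commute_exp2; try exact: trho2; apply: (trho_comm n s (k := 0) (l := j.+3)).
Qed.

End HalvingRelations.

(** The group that acts on the presented group by exchanging its generators
    0 and 1; true plays the role of rho_0. *)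
Definition two := bool.
HB.instance Definition _ := Choice.copy two bool.
HB.instance Definition _ :=
  isGroup.Build two addbA addFb addbF addbb addbb.

Section HalvingRels.
Variables (m s : nat).

Definition betav (K : groupType) (y : 'I_m.+2 -> K) : K := y (inord 1) * tail y.
Definition tbetav (K : groupType) (y : 'I_m.+2 -> K) : K := y ord0 * tail y.

Lemma halving_relsP (K : groupType) (y : 'I_m.+2 -> K) :
  (forall r, halving_rels m.+1 s r -> wval y r = 1) <->
  [/\ forall i j, (y i * y j) ^+ halving_matrix i j = 1,
      forall i, (2 <= i <= m)%N -> ((tbetav y)^-1 ^+ i * betav y ^+ i) ^+ 2 = 1
    & (tbetav y ^+ m.+1 * betav y ^+ m.+1) ^+ s = 1].
Proof.
have B i : wval y (wexp (wexp (winv (tbeta_word m.+1)) i ++ wexp (beta_word m.+1) i) 2) =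
    ((tbetav y)^-1 ^+ i * betav y ^+ i) ^+ 2.
  by rewrite wval_exp wval_cat !wval_exp wval_inv wval_beta wval_tbeta.
have E : wval y (wexp (wexp (tbeta_word m.+1) m.+1 ++ wexp (beta_word m.+1) m.+1) s) =
    (tbetav y ^+ m.+1 * betav y ^+ m.+1) ^+ s.
  by rewrite wval_exp wval_cat !wval_exp wval_beta wval_tbeta.
split=> [yR|[yC yB yE] r].
  split=> [i j|i im|].
  - by rewrite -wval_coxeter; apply: yR; left; left; exists i, j.
  - by rewrite -B; apply: yR; left; right; exists i.
  - by rewrite -E; apply: yR; right.
case=> [[[i [j ->]]|[i im ->]]|->]; first by rewrite wval_coxeter.
- by rewrite B yB.
- by rewrite E yE.
Qed.

Lemma halving_rels_pgen : let y := pgen (halving_rels m.+1 s) in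
  [/\ forall i j, (y i * y j) ^+ halving_matrix i j = 1,
      forall i, (2 <= i <= m)%N -> ((tbetav y)^-1 ^+ i * betav y ^+ i) ^+ 2 = 1
    & (tbetav y ^+ m.+1 * betav y ^+ m.+1) ^+ s = 1].
Proof.
apply/halving_relsP => r hr.
by rewrite -(wval_class (f := id)) //; apply: pi_relator.
Qed.

Lemma tail_morph (K L : groupType) (f : K -> L) (y : 'I_m.+2 -> K) :
  {morph f : a b / a * b} -> f (tail y) = tail (f \o y).
Proof. by move=> fM; rewrite /tail (big_morph f fM (morph1 fM)). Qed.

Lemma tail_eq (K : groupType) (y y' : 'I_m.+2 -> K) :
  (forall i : 'I_m.+2, (1 < i)%N -> y i = y' i) -> tail y = tail y'.
Proof. by move=> e; apply: eq_bigr => i _; apply: e. Qed.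

End HalvingRels.

Section HalvingPresentation.
Variables (m s : nat).
Hypothesis m0 : (0 < m)%N.
Hypothesis s1 : (1 < s)%N.

Local Notation n := m.+1.
Let n1 : (1 < n)%N.
Proof. by []. Qed.

Notation Gh := (power2_group (cube n) s).
Notation trho := (@trho n s).
Notation rho0 := (@rho0 n s).
Notation inG := (@inG n s).
Notation inW := (@inW n s).
Notation hgen := (@hgen n s).
Let o1 : 'I_m.+2 := inord 1.

Let o1E : o1 = 1%N :> nat.
Proof. by rewrite /o1 inordK. Qed.

Definition tau_tail : cube_group n := \prod_(i <- enum 'I_m) tau n i.+1.

Lemma beta_tail : beta n = tau n 0 * tau_tail.
Proof.
rewrite /beta big_ord_recl -(tau_ord ord0) /tau_tail [index_enum _]unlock -enumT.
by congr (_ * _); apply: eq_bigr => i _; rewrite -tau_ord.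
Qed.

Lemma tail_stab : tau_tail \inG base_vertex_stab (cube n).
Proof.
rewrite /tau_tail; elim/big_ind: _ => [|g h|i _]; [exact: subgroup1|exact: subgroupM|].
exact: tau_stab.
Qed.

Lemma tail_hgen : tail hgen = inG tau_tail.
Proof.
rewrite /tau_tail (big_morph inG (@inGM n s) (morph1 (@inGM n s))).
by apply: eq_bigr => i _; rewrite (hgenE s n1).
Qed.

Lemma betav_hgen : betav hgen = inG (beta n).
Proof. by rewrite /betav tail_hgen (hgenE s n1) inordK // -inGM beta_tail. Qed.

Lemma tbetav_hgen : tbetav hgen = rho0 * inG (beta n) * rho0.
Proof.
rewrite /tbetav tail_hgen (hgenE s n1) beta_tail inGM /= -!mulgA (rho0_stab s tail_stab).
by rewrite (mulgA rho0).
Qed.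

(** Since ~beta = rho_0 beta rho_0, this is rho_0 times its conjugate under
    beta^i. *)
Lemma tbetaV_beta i : (tbetav hgen)^-1 ^+ i * betav hgen ^+ i = rho0 * vrefl s (vtx (beta n ^+ i)).
Proof.
have E : (tbetav hgen)^-1 ^+ i = rho0 * (inG (beta n ^+ i))^-1 * rho0.
  rewrite tbetav_hgen expVgn -(morphX (@conj_rho0M n s)) -(morphV (@conj_rho0M n s)).
  by rewrite (morphX (@inGM n s)).
by rewrite E betav_hgen -(rho0_conj s) (morphX (@inGM n s)) !mulgA.
Qed.

Lemma hgen_rels r : halving_rels n s r -> wval hgen r = 1.
Proof.
move: r; apply/halving_relsP; split=> [i j|i /andP[i2 im]|].
- have lt (a b : 'I_n.+1) : (a < b)%N -> (hgen a * hgen b) ^+ halving_matrix a b = 1.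
    move=> ab; rewrite !(hgenE s n1) /halving_matrix.
    have -> : minn a b = a by apply/minn_idPl/ltnW.
    have -> : maxn a b = b by apply/maxn_idPr/ltnW.
    by rewrite ltn_eqF // (trho_rel s n1) // ab -ltnS /=.
  have [ij|ji|/val_inj ->] := ltngtP i j; first exact: lt.
    by rewrite halving_matrixC; apply: exp_swap; apply: lt.
  by rewrite /halving_matrix minnn maxnn eqxx expg1 (hgen2 s n1).
- rewrite tbetaV_beta; have [|b1 b2] := @beta_vtx n n1 i; first by rewrite (ltnW i2) ltnS.
  by apply: commute_exp2; try exact: vrefl2; apply: (vrefl_comm s).
- have -> : tbetav hgen ^+ n * betav hgen ^+ n = (tbetav hgen)^-1 ^+ n * betav hgen ^+ n.
    congr (_ * _); rewrite expVgn tbetav_hgen -(morphX (@conj_rho0M n s)) -(morphV (@conj_rho0M n s)).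
    rewrite -(morphX (@inGM n s)) -(morphV (@inGM n s)).
    by congr (_ * inG _ * _); rewrite (mulg1_eq (alpha2 n)).
  rewrite tbetaV_beta -(mul1g (beta n ^+ n)) -antipode_base.
  rewrite -[rho0 * _]/(inW (sigma s (vtx 1)) * inW (sigma s _)) -inWM -(morphX (@inWM n s)).
  by rewrite sigma_order; apply: morph1 (@inWM n s).
Qed.

Notation RP := (halving_rels n s).
Notation P := (presented RP).
Notation gen := (pgen RP).

Definition swap (i : 'I_n.+1) : 'I_n.+1 :=
  if i == ord0 then o1 else if i == o1 then ord0 else i.

Lemma swapE i : swap i = (if i == 0 :> nat then 1 else if i == 1 :> nat then 0 else i)%N :> nat.
Proof.
rewrite /swap -!val_eqE /= o1E.
by case: eqP => _; [rewrite o1E|case: eqP].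
Qed.

Lemma swapK : involutive swap.
Proof.
by move=> i; apply: val_inj; rewrite /= !swapE; case: (nat_of_ord i) => [|[|k]].
Qed.

Lemma halving_matrix_swap i j : halving_matrix (swap i) (swap j) = halving_matrix i j.
Proof.
rewrite /halving_matrix !swapE.
by case: (nat_of_ord i) => [|[|a]]; case: (nat_of_ord j) => [|[|b]].
Qed.

Lemma tail_swap (y : 'I_n.+1 -> P) : tail (y \o swap) = tail y.
Proof.
apply: tail_eq => i i1 /=; congr y; apply: val_inj; rewrite /= swapE.
by case: (nat_of_ord i) i1 => [|[|k]].
Qed.

Lemma swap0 : swap ord0 = o1. Proof. by []. Qed.

Lemma swap1 : swap o1 = ord0. Proof. by rewrite -swap0 swapK. Qed.

Lemma betav_swap (y : 'I_n.+1 -> P) : betav (y \o swap) = tbetav y.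
Proof. by rewrite /betav tail_swap /= swap1. Qed.

Lemma tbetav_swap (y : 'I_n.+1 -> P) : tbetav (y \o swap) = betav y.
Proof. by rewrite /tbetav tail_swap /= swap0. Qed.

(** Exchanging the generators 0 and 1 exchanges beta and ~beta, so it
    inverts the first extra relators and conjugates the last one. *)
Lemma swap_ex : exists theta : P -> P,
  {morph theta : a b / a * b} /\ forall i, theta (gen i) = gen (swap i).
Proof.
have [gC gB gE] := @halving_rels_pgen m s.
apply: (presented_lift (y := gen \o swap)); apply/halving_relsP; split=> [i j|i im|].
- by rewrite /= -(halving_matrix_swap i j) gC.
- rewrite betav_swap tbetav_swap -[RHS]invg1 -(gB i im) -expVgn; congr (_ ^+ 2).
  by rewrite [RHS]invgM !expVgn invgK.
- by rewrite betav_swap tbetav_swap; apply: exp_swap.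
Qed.

Section LeftInverse.
Variable theta : P -> P.
Hypothesis thetaM : {morph theta : a b / a * b}.
Hypothesis theta_gen : forall i, theta (gen i) = gen (swap i).

Lemma thetaK : involutive theta.
Proof.
apply: presented_morph_eq => // [a b|i]; first by rewrite !thetaM.
by rewrite !theta_gen swapK.
Qed.

Definition theta_act (p : P) (e : two) : P := if e then theta p else p.

Lemma theta_actMl e : {morph theta_act^~ e : p q / p * q}.
Proof. by case: e. Qed.

Lemma theta_actM p (d e : two) : theta_act p (d * e) = theta_act (theta_act p d) e.
Proof. by case: d; case: e; rewrite //= thetaK. Qed.

Definition theta_action : group_action P two :=
  GroupAction theta_actMl (fun p => erefl) theta_actM.

Notation PT := (semidirect theta_action).

Definition inP (p : P) : PT := (p, 1).
Definition kappa : PT := (1, true).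

Lemma inPM : {morph inP : p q / p * q}.
Proof. by []. Qed.

Lemma inP_inj : injective inP.
Proof. by move=> p q []. Qed.

Lemma kappa2 : kappa * kappa = 1.
Proof.
rewrite -[LHS]/(1 * theta 1, 1 : two) (morph1 thetaM) mulg1; exact.
Qed.

Lemma kappa_conj p : kappa * inP p * kappa = inP (theta p).
Proof.
rewrite -[LHS]/(1 * theta p * theta 1, 1 : two) (morph1 thetaM) mulg1 mul1g; exact.
Qed.

Lemma kappa_comm p : theta p = p -> commute kappa (inP p).
Proof.
move=> e; have e' : kappa * inP p * kappa = inP p by rewrite kappa_conj e.
by rewrite /commute -[in RHS]e' -mulgA kappa2 mulg1.
Qed.

Lemma cube_lift : exists gG : cube_group n -> PT, {morph gG : g h / g * h} /\
  forall j : 'I_n, gG (cube_tau j) = inP (gen (lift ord0 j)).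
Proof.
have [gC _ _] := @halving_rels_pgen m s.
apply: presented_lift => _ [i [j ->]]; rewrite wval_coxeter -inPM.
rewrite -(morphX inPM) -[RHS](morph1 inPM) -(gC (lift ord0 i) (lift ord0 j)).
congr (inP (_ ^+ _)); rewrite /halving_matrix /string_matrix -val_eqE /= /bump /= !add1n.
have E a b : (a < b)%N -> (if a.+1 == b then if a == 0 then 4 else 3 else 2)%N =
    (if a.+1 == b.+1 then 1 else if (a.+1 < 2) && (b.+1 == 2) then 4
     else if (2 <= a.+1) && (b.+1 == a.+2) then 3 else 2)%N.
  by case: a => [|a] ab; rewrite !eqSS (ltn_eqF ab) (eq_sym _ b) /=; case: ifP.
have [ij|ji|->] := ltngtP i j; last by rewrite minnn maxnn eqxx.
- have -> : (j.+1 == i) = false by lia.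
  have -> : minn i.+1 j.+1 = i.+1 by lia.
  have -> : maxn i.+1 j.+1 = j.+1 by lia.
  exact: E.
- have -> : (i.+1 == j) = false by lia.
  have -> : minn i.+1 j.+1 = j.+1 by lia.
  have -> : maxn i.+1 j.+1 = i.+1 by lia.
  exact: E.
Qed.

Section WLift.
Variable gG : cube_group n -> PT.
Hypothesis gGM : {morph gG : g h / g * h}.
Hypothesis gGtau : forall j : 'I_n, gG (cube_tau j) = inP (gen (lift ord0 j)).

Lemma gG_tau j (jn : (j.+1 < n.+1)%N) : gG (tau n j) = inP (gen (inord j.+1)).
Proof.
rewrite (tau_ord (Ordinal (jn : (j < n)%N))) gGtau; congr (inP (gen _)).
by apply: val_inj; rewrite /= inordK.
Qed.

Lemma gG_stab u : u \inG base_vertex_stab (cube n) -> commute kappa (gG u).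
Proof.
rewrite -[_ \inG _]/((_ : set _) u) seg_base_stab => hu.
move: u hu; apply: seg_ind => [|u j IH j1 jn]; first by rewrite (morph1 gGM); apply: commute1.
rewrite gGM; apply: commuteM => //; rewrite gG_tau //; apply: kappa_comm.
rewrite theta_gen; congr gen; apply: val_inj; rewrite /= swapE inordK //.
by case: j j1 {jn} => [|j].
Qed.

Lemma gG_beta : gG (beta n) = inP (betav gen).
Proof.
rewrite beta_tail gGM gG_tau // /betav inPM; congr (_ * _).
rewrite (tail_morph _ inPM) /tau_tail (big_morph gG gGM (morph1 gGM)).
apply: eq_bigr => i _; rewrite gG_tau ?ltnS //=; congr (inP (gen _)).
by apply: val_inj; rewrite /= inordK ?ltnS.
Qed.

Lemma theta_betav : theta (betav gen) = tbetav gen.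
Proof.
rewrite /betav thetaM theta_gen swap1 (tail_morph _ thetaM); congr (_ * _).
by rewrite -[RHS]tail_swap; apply: eq_bigr => i _; apply: theta_gen.
Qed.

(** The intended image of sigma_F, where F = F_0 h. *)
Definition refl h : PT := (gG h)^-1 * kappa * gG h.

Lemma reflM h k : refl (h * k) = (gG k)^-1 * refl h * gG k.
Proof. by rewrite /refl gGM invgM !mulgA. Qed.

Lemma refl_stab u h : u \inG base_vertex_stab (cube n) -> refl (u * h) = refl h.
Proof.
move=> hu; rewrite reflM {1}/refl -(mulgA _ kappa) (gG_stab hu) mulKg.
by rewrite -[in LHS](mulgA) mulgA.
Qed.

Lemma refl_eq h k : vtx h = vtx k -> refl h = refl k.
Proof. by move/vtx_eq => hk; rewrite -[k](mulgVK h) refl_stab. Qed.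

Lemma refl2 h : refl h * refl h = 1.
Proof.
by rewrite /refl !mulgA mulgK -(mulgA _ kappa kappa) kappa2 mulg1 mulVg.
Qed.

Lemma refl_pair h k : refl h * refl (k * h) = (gG h)^-1 * (kappa * refl k) * gG h.
Proof. by rewrite reflM /refl !mulgA mulgK. Qed.

Lemma kappa_refl_beta i : kappa * refl (beta n ^+ i) =
  inP ((tbetav gen)^-1 ^+ i * betav gen ^+ i).
Proof.
rewrite /refl (morphX gGM) gG_beta -(morphX inPM) -(morphV inPM) !mulgA kappa_conj -inPM.
by rewrite (morphV thetaM) (morphX thetaM) theta_betav expVgn.
Qed.

Lemma refl_comm i u : (0 < i < n)%N -> u \inG base_vertex_stab (cube n) ->
  (kappa * refl (beta n ^+ i * u)) ^+ 2 = 1.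
Proof.
move=> /andP[i0 lti] hu; have [gC gB _] := @halving_rels_pgen m s.
have -> : kappa * refl (beta n ^+ i * u) = (kappa * refl (beta n ^+ i)) ^ gG u.
  rewrite reflM conjgE !mulgA; congr (_ * _ * _ * _ * _).
  exact: commuteV (gG_stab hu).
rewrite -conjXg kappa_refl_beta -(morphX inPM).
have [i1|i2] := leqP i 1; last by rewrite gB ?i2 // (morph1 inPM) conj1g.
have -> : i = 1%N by lia.
have -> : (tbetav gen)^-1 ^+ 1 * betav gen ^+ 1 = (gen ord0 * gen o1) ^ tail gen.
  have g0 : gen ord0 * gen ord0 = 1 by have := gC ord0 ord0; rewrite /halving_matrix minnn maxnn.
  by rewrite !expg1 /tbetav invgM (mulg1_eq g0) conjgE !mulgA.
have := gC ord0 o1; rewrite /halving_matrix o1E /= -conjXg => ->.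
by rewrite conj1g (morph1 inPM) conj1g.
Qed.

(** The relator is a product of positive powers of ~beta and beta, but both
    have order dividing 2 n, so the n-th power of ~beta equals its inverse. *)
Lemma refl_alpha : (kappa * refl (beta n ^+ n)) ^+ s = 1.
Proof.
have [_ _ gE] := @halving_rels_pgen m s.
rewrite kappa_refl_beta -(morphX inPM) -[RHS](morph1 inPM) -gE; congr (inP ((_ * _) ^+ s)).
have b2 : betav gen ^+ n * betav gen ^+ n = 1.
  apply: inP_inj; rewrite inPM (morphX inPM) -gG_beta -(morphX gGM) -gGM alpha2.
  by rewrite (morph1 gGM).
have : tbetav gen ^+ n * tbetav gen ^+ n = 1.
  by rewrite -theta_betav -(morphX thetaM) -thetaM b2 (morph1 thetaM).
by rewrite expVgn => /mulg1_eq.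
Qed.

(** A relator that involves the vertices F_0 h and F_0 k h is conjugate to
    one that involves F_0 and F_0 k, and then F_0 and F_0 beta^i. *)
Lemma W_lift : exists gW : W_group (cube n) s -> PT, {morph gW : v w / v * w} /\
  forall h, gW (sigma s (vtx h)) = refl h.
Proof.
have /choice[r rE] := @vertex_ex n.
have rv h : refl (r (vtx h)) = refl h by apply: refl_eq.
have [|gW [gWM gWE]] := @presented_lift _ (@W_rels n (cube n) s) PT (refl \o r); last first.
  by exists gW; split=> // h; rewrite gWE /= rv.
move=> w; case=> [[F ->]|[F ->]|[F [G [h1 h2 ->]]]].
- by rewrite wval_exp wval_letter expg2 refl2.
- rewrite wval_coxeter /=; have [h ->] := vertex_ex F; rewrite antipode_base !rv.
  have -> : h * beta n ^+ n = beta n ^+ n * h by apply/esym/(cp_central (c := cube n)).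
  by rewrite refl_pair -[_ * gG h]mulgA -conjgE -conjXg refl_alpha conj1g.
- rewrite wval_coxeter /=; move: h1 h2; have [h ->] := vertex_ex F; have [k ->] := vertex_ex G.
  rewrite antipode_base !rv => h1 h2.
  have [i [u [lei hu kh]]] := vertex_beta (k * h^-1).
  have kE : refl k = refl (beta n ^+ i * u * h).
    by apply: refl_eq; rewrite -[k](mulgVK h) -(vtxM _ h) kh vtxM.
  rewrite kE refl_pair -[_ * gG h]mulgA -conjgE -conjXg refl_comm ?conj1g //.
  have kh' : vtx k = vtx (beta n ^+ i * u * h) by rewrite -[k](mulgVK h) -(vtxM _ h) kh vtxM.
  have stabl v l : v \inG base_vertex_stab (cube n) -> vtx (v * l) = vtx l.
    by move=> hv; apply/vtx_eq; rewrite invgM mulVKg; apply: subgroupV.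
  have central l : beta n ^+ n * l = l * beta n ^+ n by apply: (cp_central (c := cube n)).
  apply/andP; split; rewrite ?lt0n ?ltn_neqAle ?lei ?andbT; apply/eqP => ie.
    by apply: h1; rewrite kh' ie mul1g stabl.
  by apply: h2; rewrite kh' ie central -mulgA stabl // central.
Qed.

(** The morphisms on W and G are compatible with the action of G because an
    element of G conjugates the reflection in a vertex to that in its image. *)
Lemma power2_lift : exists Phi : Gh -> PT,
  {morph Phi : z z' / z * z'} /\ forall i, Phi (hgen i) = inP (gen i).
Proof.
have [gW [gWM gWE]] := W_lift.
have compat w g : gW (W_act w g) = (gG g)^-1 * gW w * gG g.
  move: w; apply: W_ind => [|w F IH].
    by rewrite W_act1l (morph1 gWM) mulg1 mulVg.
  have [h ->] := vertex_ex F.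
  rewrite W_actMl !gWM IH /sigma W_act_pi /= vtxM -[pclass _ _]/(sigma s _) !gWE reflM.
  by rewrite !mulgA mulgK.
pose Phi (z : Gh) := gW z.1 * gG z.2.
have PhiM : {morph Phi : z z' / z * z'}.
  move=> z z'; rewrite /Phi mulE /= gWM gGM compat (morphV gGM) invgK.
  by rewrite !mulgA mulgVK.
have Phic : Phi rho0 = kappa.
  by rewrite /Phi /= (morph1 gGM) mulg1 gWE /refl (morph1 gGM) invg1 mul1g mulg1.
have PhiR j : (j.+1 < n.+1)%N -> Phi (inG (tau n j)) = inP (gen (inord j.+1)).
  by move=> jn; rewrite /Phi /= (morph1 gWM) mul1g gG_tau.
exists Phi; split=> // i; rewrite (hgenE s n1); case: (posnP i) => [i0|].
  rewrite i0 /= !PhiM Phic PhiR // kappa_conj theta_gen; congr (inP (gen _)).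
  by apply: val_inj; rewrite /= swapE i0 inordK.
case: i => [[|i] lt] //= _; rewrite PhiR //; congr (inP (gen _)).
by apply: val_inj; rewrite /= inordK.
Qed.

End WLift.
End LeftInverse.

(** The composite P -> H -> P x| C_2 agrees with the inclusion of P on the
    generators, so P -> H is injective. *)
Theorem halving_presentation :
  has_presentation (parabolic hgen setT) hgen RP.
Proof.
have [f [fM fx]] := presented_lift hgen_rels.
have [theta [thetaM theta_gen]] := swap_ex.
have [gG [gGM gGtau]] := cube_lift thetaM theta_gen.
have [Phi [PhiM Phix]] := power2_lift gGM gGtau.
apply: (lift_presentation fM fx (hgen2 s n1)).
have e : Phi \o f =1 inP thetaM theta_gen.
  apply: presented_morph_eq => [a b|a b|i] //=; first by rewrite fM PhiM.
  by rewrite fx Phix.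
by move=> p q /(congr1 Phi); rewrite -![Phi (f _)]/((Phi \o f) _) !e => /inP_inj.
Qed.

End HalvingPresentation.

(** * The toroidal residue *)

Definition t0 : 'I_3 := Ordinal (isT : 0 < 3).
Definition t1 : 'I_3 := Ordinal (isT : 1 < 3).
Definition t2 : 'I_3 := Ordinal (isT : 2 < 3).

Lemma I3P (Q : 'I_3 -> Prop) : Q t0 -> Q t1 -> Q t2 -> forall i, Q i.
Proof.
move=> q0 q1 q2 [[|[|[|i]]] lt] //.
- by rewrite (_ : Ordinal lt = t0) //; apply: val_inj.
- by rewrite (_ : Ordinal lt = t1) //; apply: val_inj.
- by rewrite (_ : Ordinal lt = t2) //; apply: val_inj.
Qed.

Lemma map44_relsP (K : groupType) (y : 'I_3 -> K) :
  (forall r, map44_22_rels r -> wval y r = 1) <->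
  (forall i j, (y i * y j) ^+ string_matrix (fun=> 4) i j = 1) /\
  (y t0 * y t1 * y t2) ^+ 4 = 1.
Proof.
have E : wval y (wexp [seq (i, true) | i <- enum 'I_3] 4) = (y t0 * y t1 * y t2) ^+ 4.
  rewrite wval_exp wval_seq !enum_ordSl /= !big_cons.
  have -> : enum 'I_0 = [::] by apply: size0nil; rewrite size_enum_ord.
  rewrite big_nil mulg1 mulgA.
  congr ((_ * y _ * y _) ^+ 4); [congr y| |]; exact: val_inj.
split=> [yR|[yC yE] r].
  split=> [i j|]; last by rewrite -E; apply: yR; right.
  by rewrite -wval_coxeter; apply: yR; left; exists i, j.
by case=> [[i [j ->]]|->]; [rewrite wval_coxeter|rewrite E].
Qed.

Notation P3 := (presented map44_22_rels).
Notation gen := (pgen map44_22_rels).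

Lemma square_prod3 (K : groupType) (a b d : K) : d * a = a * d ->
  (a * b * d) ^+ 2 = a * b * a * (d * b * d).
Proof. by move=> e; rewrite expg2 !mulgA -(mulgA (a * b) d a) e !mulgA. Qed.

(** In the group of the map {4,4}_(2,2), with generators a, b, d, the products
    e1 = a d, e2 = b a d b and e3 = (a b a) (d b d) generate a normal
    elementary abelian subgroup of order 8, with complement the dihedral group
    <b, d> of order 8. They correspond to the products of the reflection in
    the base vertex of a square with those in its other vertices. *)
Section Toroidal.

Let a : P3 := gen t0.
Let b : P3 := gen t1.
Let d : P3 := gen t2.
Let e1 := a * d.
Let e2 := b * e1 * b.
Let e3 := a * b * a * (d * b * d).

Let rels : (forall i j, (gen i * gen j) ^+ string_matrix (fun=> 4) i j = 1) /\
  (a * b * d) ^+ 4 = 1.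
Proof.
apply/map44_relsP => r hr.
by rewrite -(wval_class (f := id)) //; apply: pi_relator.
Qed.

Let a2 : a * a = 1. Proof. by have := rels.1 t0 t0. Qed.
Let b2 : b * b = 1. Proof. by have := rels.1 t1 t1. Qed.
Let d2 : d * d = 1. Proof. by have := rels.1 t2 t2. Qed.
Let ad : a * d = d * a. Proof. by apply: (inv_comm a2 d2); have := rels.1 t0 t2. Qed.
Let abab : a * b * a * b = b * a * b * a.
Proof. by apply: (inv_quad a2 b2); have := rels.1 t0 t1. Qed.
Let dbdb : d * b * d * b = b * d * b * d.
Proof. by apply/esym/(inv_quad b2 d2); have := rels.1 t1 t2. Qed.

Let cancel2 (u z : P3) : u * u = 1 -> z * u * u = z.
Proof. by move=> u2; rewrite -mulgA u2 mulg1. Qed.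

Let e1_2 : e1 * e1 = 1.
Proof. by rewrite /e1 {1}ad mulgA (cancel2 _ a2) d2. Qed.

Let conj2 (u z : P3) : u * u = 1 -> z * z = 1 -> (u * z * u) * (u * z * u) = 1.
Proof. by move=> u2 z2; rewrite !mulgA (cancel2 _ u2) (cancel2 _ z2). Qed.

Let e2_2 : e2 * e2 = 1.
Proof. exact: conj2. Qed.

Let e3_2 : e3 * e3 = 1.
Proof.
have -> : e3 = (a * b * d) ^+ 2 by rewrite square_prod3.
by rewrite -expgnDr; exact: rels.2.
Qed.

Let de1d : d * e1 * d = e1.
Proof. by rewrite /e1 ad mulgA d2 mul1g. Qed.

Let de2d : d * e2 * d = e1 * e3.
Proof.
rewrite /e2 /e3 /e1 !mulgA; congr (_ * _ * _ * _ * _).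
by rewrite -(mulgA a d a) -ad !mulgA a2 mul1g.
Qed.

Let de3d : d * e3 * d = e1 * e2.
Proof. by rewrite /e2 /e3 /e1 !mulgA (cancel2 _ d2) ad. Qed.

Let be2b : b * e2 * b = e1.
Proof. by rewrite /e2 !mulgA b2 mul1g (cancel2 _ b2). Qed.

Let be3b : b * e3 * b = e3.
Proof.
have -> : b * e3 * b = (b * a * b * a) * (d * b * d * b) by rewrite /e3 !mulgA.
by rewrite -abab dbdb /e3 !mulgA (cancel2 _ b2).
Qed.

Let c13 : commute e1 e3.
Proof. by apply: inv_comm => //; rewrite -de2d expg2; apply: conj2. Qed.

Let c12 : commute e1 e2.
Proof. by apply: inv_comm => //; rewrite -de3d expg2; apply: conj2. Qed.

Let c23 : commute e2 e3.
Proof.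
apply: inv_comm => //; have -> : e2 * e3 = b * (e1 * e3) * b.
  by rewrite -[in LHS]be3b /e2 !mulgA (cancel2 _ b2).
rewrite expg2; apply: conj2 => //.
by rewrite -de2d; apply: conj2.
Qed.

Definition torus_normal (p : P3) := exists i j k : bool, p = e1 ^+ i * e2 ^+ j * e3 ^+ k.

Let normal1 : torus_normal 1.
Proof. by exists false, false, false; rewrite !expg0 !mulg1. Qed.

Let normalM (p e : P3) : e = e1 \/ e = e2 \/ e = e3 -> torus_normal p -> torus_normal (p * e).
Proof.
move=> he [i [j [k ->]]]; case: he => [->|[->|->]].
- exists (~~ i), j, k; have -> : e1 ^+ (~~ i) = e1 ^+ i * e1.
    by case: i; rewrite /= ?expg0 ?expg1 ?mul1g ?e1_2.
  rewrite -[LHS]mulgA -(commuteX k c13) mulgA -[in LHS](mulgA _ (e2 ^+ j)).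
  by rewrite -(commuteX j c12) !mulgA.
- exists i, (~~ j), k; have -> : e2 ^+ (~~ j) = e2 ^+ j * e2.
    by case: j; rewrite /= ?expg0 ?expg1 ?mul1g ?e2_2.
  by rewrite -[LHS]mulgA -(commuteX k c23) !mulgA.
- exists i, j, (~~ k); have -> : e3 ^+ (~~ k) = e3 ^+ k * e3.
    by case: k; rewrite /= ?expg0 ?expg1 ?mul1g ?e3_2.
  by rewrite !mulgA.
Qed.

Let normalMM p q : torus_normal p -> torus_normal q -> torus_normal (p * q).
Proof.
have nX u (h : bool) e : e = e1 \/ e = e2 \/ e = e3 -> torus_normal u -> torus_normal (u * e ^+ h).
  by move=> he hu; case: h; rewrite ?expg1 ?expg0 ?mulg1 //; apply: normalM.
move=> hp [i [j [k ->]]]; rewrite !mulgA.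
by apply: (nX _ _ e3); [auto|apply: (nX _ _ e2); [auto|apply: (nX _ _ e1); [auto|]]].
Qed.

Let normalJ (u p : P3) : u = b \/ u = d -> torus_normal p -> torus_normal (u * p * u).
Proof.
move=> hu [i [j [k ->]]].
have u2 : u * u = 1 by case: hu => ->.
have E q r : u * (q * r) * u = (u * q * u) * (u * r * u).
  by rewrite !mulgA (cancel2 _ u2).
have X1 (e : P3) (h : bool) : torus_normal (u * e * u) -> torus_normal (u * e ^+ h * u).
  by case: h; rewrite ?expg1 // expg0 mulg1 u2.
have n1 : torus_normal e1 by rewrite -[e1]mul1g; apply: normalM; auto.
have n2 : torus_normal e2 by rewrite -[e2]mul1g; apply: normalM; auto.
have n3 : torus_normal e3 by rewrite -[e3]mul1g; apply: normalM; auto.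
rewrite !E; apply: normalMM; [apply: normalMM|]; apply: X1.
- by case: hu => ->; rewrite ?de1d // -/e2.
- by case: hu => ->; rewrite ?de2d ?be2b //; apply: normalMM.
- by case: hu => ->; rewrite ?de3d ?be3b //; apply: normalMM.
Qed.

Definition torus_dihedral (p : P3) :=
  exists (i : 'I_4) (j : bool), p = (b * d) ^+ i * b ^+ j.

Let dihedral_word (k : nat) (j : bool) : torus_dihedral ((b * d) ^+ k * b ^+ j).
Proof.
exists (inord (k %% 4)), j; rewrite inordK ?ltn_mod //; congr (_ * _).
have bd4 : (b * d) ^+ 4 = 1 by exact: (rels.1 t1 t2).
by rewrite [in LHS](divn_eq k 4) expgnDr mulnC expgnA bd4 expg1n mul1g.
Qed.

Let dihedralM p u : u = b \/ u = d -> torus_dihedral p -> torus_dihedral (p * u).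
Proof.
move=> hu [i [j ->]]; case: hu => ->.
  by case: j; rewrite ?expg1 ?(cancel2 _ b2) ?expg0 ?mulg1;
    [have := dihedral_word i false; rewrite expg0 mulg1|have := dihedral_word i true].
case: j; rewrite ?expg1 ?expg0 ?mulg1.
  by have := dihedral_word i.+1 false; rewrite expg0 mulg1 expgSr mulgA.
have bd4 : (b * d) ^+ 4 = 1 by exact: (rels.1 t1 t2).
have e : (b * d) ^+ i = (b * d) ^+ (i + 3) * (b * d).
  by rewrite -expgSr -addnS expgnDr bd4 mulg1.
by have := dihedral_word (i + 3) true; rewrite expg1 e mulgA (cancel2 _ d2).
Qed.

(** The generator a equals e1 d, and the normal subgroup absorbs the
    conjugate of e1 by the dihedral part. *)
Lemma torus_decomposition p : exists q g, [/\ torus_normal q, torus_dihedral g & p = q * g].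
Proof.
pose Q g := torus_dihedral g /\ forall q, torus_normal q -> torus_normal (g * q * g^-1).
have QM g u : u = b \/ u = d -> Q g -> Q (g * u).
  move=> hu [hg nq]; split=> [|q hq]; first exact: dihedralM.
  have uV : u^-1 = u by apply: mulg1_eq; case: hu => ->.
  by rewrite invgM uV mulgA -(mulgA g u q) -(mulgA g (u * q)); apply/nq/normalJ.
suff [q [g [hq [hg _] ->]]] : exists q g, [/\ torus_normal q, Q g & p = q * g].
  by exists q, g.
move: p (pgen_full p); apply: gen_ind => [_ [i _ <-]||_ _ [q [g [hq hg ->]]] [i _ <-]].
- by move: i; apply: I3P.
- exists 1, 1; rewrite mulg1; split=> //; split=> [|q hq]; last by rewrite invg1 mulg1 mul1g.
  by have := dihedral_word 0 false; rewrite !expg0 mulg1.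
have QMR u : u = b \/ u = d -> exists q' g', [/\ torus_normal q', Q g' & q * g * u = q' * g'].
  by move=> hu; exists q, (g * u); split=> //; [apply: QM|rewrite mulgA].
move: i; apply: I3P; [|by apply: QMR; left|by apply: QMR; right].
exists (q * (g * e1 * g^-1)), (g * d); split; last first.
- by rewrite /e1 !mulgA mulgVK (cancel2 _ d2).
- by apply: QM => //; right.
- by apply: normalMM => //; apply: hg.2; rewrite -[e1]mul1g; apply: normalM; auto.
Qed.

End Toroidal.

Section ToroidalImage.
Variables (n s : nat).
Hypothesis n2 : (2 < n)%N.
Hypothesis s1 : (1 < s)%N.

Notation Gh := (power2_group (cube n) s).
Notation trho := (@trho n s).
Notation rho0 := (@rho0 n s).
Notation inG := (@inG n s).
Notation inW := (@inW n s).
Notation g0 := (tau n 0).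
Notation g1 := (tau n 1).

Let n1 : (1 < n)%N.
Proof. exact: ltnW. Qed.

Let y (j : 'I_3) : Gh := @hgen n s (toroidal_type n j).

Lemma yE : [/\ y t0 = trho 0, y t1 = trho 2 & y t2 = trho 1].
Proof. by split; rewrite /y (hgenE s n1) /toroidal_type /= inordK //; apply: ltnW. Qed.

Lemma y_e1 : trho 0 * trho 1 = rho0 * vrefl s (vtx g0).
Proof. by rewrite -(rho0_conj s g0) (mulg1_eq (rho2 n s 1)) !mulgA. Qed.

Lemma y_e2 : trho 2 * (trho 0 * trho 1) * trho 2 = rho0 * vrefl s (vtx (g0 * g1)).
Proof.
rewrite y_e1 -(vrefl_conj s g1) (mulg1_eq (rho2 n s 2)) !mulgA.
by rewrite -[trho 2 * rho0](rho0_comm n s (j := 2)).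
Qed.

Lemma y_e3 : trho 0 * trho 2 * trho 0 * (trho 1 * trho 2 * trho 1) = rho0 * vrefl s (vtx (g0 * g1 * g0)).
Proof.
have E : trho 0 * trho 2 * trho 0 = rho0 * (trho 1 * trho 2 * trho 1) * rho0.
  rewrite /= !mulgA -(mulgA _ rho0 (rho n s 2)) (rho0_comm n s (j := 2)) //.
  by rewrite !mulgA -(mulgA _ rho0 rho0) rho0_2 mulg1.
have V : (inG (g0 * g1 * g0))^-1 = trho 1 * trho 2 * trho 1.
  by rewrite -(morphV (@inGM n s)) !invgM !tauV !inGM mulgA.
by rewrite E -(rho0_conj s) V !inGM -!mulgA.
Qed.

(** The vertices 1, g0, g0 g1 and g0 g1 g0 are those of a square. *)
Lemma square_signs j : (j < 2)%N ->
  [/\ signs g0 j = (j == 0), signs (g0 * g1) j = (j == 1)%N & signs (g0 * g1 * g0) j = true].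
Proof.
case: j => [|[|//]] _; rewrite /signs !invgM !tauV !actM !act_tau; try by [];
  by apply: ltnW.
Qed.

Lemma last_sign : signs (g0 * g1 * g0) 2 = false.
Proof. by rewrite /signs !invgM !tauV !actM !act_tau //; apply: ltnW => //; apply: ltnW. Qed.

Lemma y_rels r : map44_22_rels r -> wval y r = 1.
Proof.
have [y0 y1 y2] := yE.
have rel i j := @trho_rel n s n1 i j.
move: r; apply/map44_relsP; split.
  have r02 : (trho 0 * trho 2) ^+ 4 = 1 by exact: (rel 0 2 n1).
  have r12 : (trho 1 * trho 2) ^+ 4 = 1 by exact: (rel 1%N 2%N n1).
  have r01 : (trho 0 * trho 1) ^+ 2 = 1 by exact: (rel 0 1%N (ltnW n1)).
  apply: I3P; apply: I3P; rewrite ?y0 ?y1 ?y2.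
  - exact: (trho2 n s 0).
  - exact: r02.
  - exact: r01.
  - exact: (exp_swap r02).
  - exact: (trho2 n s 2).
  - exact: (exp_swap r12).
  - exact: (exp_swap r01).
  - exact: r12.
  - exact: (trho2 n s 1).
have -> : y t0 * y t1 * y t2 = trho 0 * trho 2 * trho 1 by rewrite y0 y1 y2.
have comm : trho 1 * trho 0 = trho 0 * trho 1.
  by apply/esym; apply: (inv_comm (trho2 n s 0) (trho2 n s 1)); exact: (rel 0 1%N (ltnW n1)).
rewrite (expgnA _ 2 2).
have -> : (trho 0 * trho 2 * trho 1) ^+ 2 = rho0 * vrefl s (vtx (g0 * g1 * g0)).
  by rewrite -y_e3; apply: square_prod3.
apply: commute_exp2; try exact: vrefl2.
apply: (vrefl_comm s); first by move/vertex_eq/(_ 0); rewrite signs1; have [_ _ ->] := @square_signs 0 isT.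
by rewrite antipode_base => /vertex_eq/(_ 2); rewrite last_sign signs_alpha // signs1.
Qed.

Lemma sigma_last (Q : set (vertex (cube n))) u F :
  u \inG parabolic (sigma s) Q -> u * sigma s F = 1 -> Q F.
Proof.
move=> hu e; apply: (sigma_in n1 s1); rewrite -(mulKg u (sigma s F)) e mulg1.
exact: subgroupV.
Qed.

(** The image of a normal form has the image of the dihedral part as its
    component in G, and the dihedral group of the square acts faithfully on
    the first two coordinates. Its component in W is a product of
    reflections in the vertices of the square. *)
Lemma toroidal_kernel (f : P3 -> Gh) : {morph f : p q / p * q} -> (forall j, f (gen j) = y j) ->
  forall p, f p = 1 -> p = 1.
Proof.
move=> fM fy p; have [y0 y1 y2] := yE.
have [q [g [[i [j [k ->]]] [l [h ->]] ->]]] := torus_decomposition p.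
set v1 := vtx g0; set v2 := vtx (g0 * g1); set v3 := vtx (g0 * g1 * g0).
pose w : W_group (cube n) s := (sigma s (vtx 1) * sigma s v1) ^+ i *
  (sigma s (vtx 1) * sigma s v2) ^+ j * (sigma s (vtx 1) * sigma s v3) ^+ k.
pose e := (g1 * g0) ^+ l * g1 ^+ h.
rewrite fM.
have -> : f ((gen t1 * gen t2) ^+ l * gen t1 ^+ h) = inG e.
  by rewrite fM !(morphX fM) fM !fy y1 y2 /e inGM !(morphX (@inGM n s)) inGM.
rewrite !fM !(morphX fM) !fM !fy y0 y1 y2 y_e2 y_e3 y_e1.
have -> : (rho0 * vrefl s v1) ^+ i * (rho0 * vrefl s v2) ^+ j * (rho0 * vrefl s v3) ^+ k = inW w.
  by rewrite /w !inWM !(morphX (@inWM n s)) !inWM.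
rewrite inW_inG => -[]; rewrite /w {w} => w1 e0.
have {e0} [l0 h0] : l = ord0 /\ h = false.
  have A p0 : act p0 e = p0 by rewrite e0 act1.
  have n0 : (0 < n)%N by apply: ltnW.
  have A0 := A (0, false); have A1 := A (1%N, false).
  move: A0 A1; rewrite /e; case: l {e e0 A} => [[|[|[|[|l]]]] lt] //; case: h => /=;
    rewrite ?expg0 ?expg1 ?mul1g ?mulg1 ?expgSr ?expg0 ?mul1g ?actM ?act_tau ?act1 //= => A0 A1 //.
  by split=> //; apply: val_inj.
have s0 (Q : set (vertex (cube n))) F : Q (vtx 1) -> Q F ->
    sigma s (vtx 1) * sigma s F \inG parabolic (sigma s) Q.
  by move=> Q0 QF; apply: subgroupM; apply: mem_par.
have sX (Q : set (vertex (cube n))) F (o : bool) : Q (vtx 1) -> Q F ->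
    (sigma s (vtx 1) * sigma s F) ^+ o \inG parabolic (sigma s) Q.
  by move=> Q0 QF; case: o; rewrite ?expg0 ?expg1; [apply: s0|apply: subgroup1].
have sigma0 (Q : set (vertex (cube n))) : Q (vtx 1) -> sigma s (vtx 1) \inG parabolic (sigma s) Q.
  by move=> Q0; apply: mem_par.
(* Each exponent vanishes, the last one first: otherwise the reflection in
   one vertex of the square is a product of those in the preceding vertices. *)
have [S10 S11 S12] := @square_signs 0 isT; have [S20 S21 S22] := @square_signs 1 isT.
have k0 : k = false.
  case: k w1 => // w1; suff : [set vtx 1; v1; v2] v3.
    by case=> [[]|] /vertex_eq v3E; have := v3E 0; have := v3E 1%N;
      rewrite ?signs1 S12 S22 ?S10 ?S11 ?S20 ?S21.
  apply: (sigma_last _ (u := (sigma s (vtx 1) * sigma s v1) ^+ i *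
    (sigma s (vtx 1) * sigma s v2) ^+ j * sigma s (vtx 1))); last first.
    by rewrite -[RHS]w1 expg1 !mulgA.
  by apply: subgroupM; [apply: subgroupM; apply: sX|apply: sigma0];
    rewrite /=; auto.
have j0 : j = false.
  case: j w1 => // w1; suff : [set vtx 1; v1] v2.
    by case=> /vertex_eq v2E; have := v2E 0; have := v2E 1%N;
      rewrite ?signs1 S11 S21 ?S10 ?S20.
  apply: (sigma_last _ (u := (sigma s (vtx 1) * sigma s v1) ^+ i * sigma s (vtx 1))); last first.
    by rewrite -[RHS]w1 k0 expg0 mulg1 expg1 !mulgA.
  by apply: subgroupM; [apply: sX|apply: sigma0]; rewrite /=; auto.
have i0 : i = false.
  case: i w1 => // w1; suff : [set vtx 1] v1.
    by move=> /vertex_eq v1E; have := v1E 0; rewrite ?signs1 S10.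
  apply: (sigma_last _ (u := sigma s (vtx 1))); last first.
    by rewrite -[RHS]w1 k0 j0 !expg0 !mulg1 expg1.
  exact: sigma0.
by rewrite i0 j0 k0 l0 h0 !expg0 !mulg1.
Qed.

Theorem toroidal_presentation : has_presentation (parabolic y setT) y map44_22_rels.
Proof.
have [f [fM fy]] := presented_lift y_rels.
apply: (lift_presentation fM fy) => [j|]; first exact: (hgen2 s n1).
by apply: (morph_injP fM); apply: toroidal_kernel.
Qed.

End ToroidalImage.

Lemma toroidal_typeE n (j : 'I_3) : (2 < n)%N -> toroidal_type n j = nth 0%N [:: 0; 2; 1]%N j :> nat.
Proof. by move=> n2; rewrite /toroidal_type inordK //; case: j => [[|[|[|j]]]] //= _; lia. Qed.

Lemma toroidal_type_inj n : (2 < n)%N -> injective (toroidal_type n).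
Proof.
move=> n2 i j /(congr1 val) /=; rewrite !toroidal_typeE // => e; apply: val_inj.
by case: i j e => [[|[|[|i]]] ?] [[|[|[|j]]] ?].
Qed.

Lemma toroidal_type_range n : (2 < n)%N ->
  ~` [set i : 'I_n.+1 | (3 <= i)%N] = range (toroidal_type n).
Proof.
move=> n2; apply/seteqP; split=> [i /negP|_ [j _ <-]] /=; last first.
  by apply/negP; rewrite toroidal_typeE //; case: j => [[|[|[|j]]]].
rewrite -ltnNge => i3.
have [j jE] : exists j : 'I_3, nth 0%N [:: 0; 2; 1]%N j = i.
  by case: (nat_of_ord i) i3 => [|[|[|k]]] // _; [exists t0|exists t2|exists t1].
by exists j => //; apply: val_inj; rewrite /= toroidal_typeE.
Qed.

Theorem proposition3p9 (n s : nat) (hn : (3 <= n)%N) (hs : (2 <= s)%N) :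
  let x : 'I_n.+1 -> power2_group (cube n) s :=
    halving_gen (@power2_rho n (cube n) s) in
  let H := parabolic x setT in
  let Hi := fun i : 'I_n.+1 => parabolic x [set j | j <> i] in
  let Gamma := coset_system H Hi in
  [/\ regular_hypertope Gamma,
      automorphism_group_is H Hi,
      (H #= `I_((2 * s) ^ (2 ^ n.-1) * 2 ^ n.-1 * n`!))%card,
      has_presentation H x (halving_rels n s)
    & let y := fun j : 'I_3 => x (toroidal_type n j) in
      let residue_flag : set Gamma :=
        [set base_elt H Hi i | i in [set i : 'I_n.+1 | (3 <= i)%N]] in
      has_presentation (parabolic y setT) y map44_22_rels /\
      iso_along (toroidal_type n) (residue residue_flag) map44_22].
Proof.
move=> x H Hi Gamma; have n1 : (1 < n)%N by apply: ltnW.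
have x2 := @hgen2 n s n1.
have IP := @halving_IP n s n1 hs.
have FC := @halving_FC n s n1 hs.
have tor := @toroidal_presentation n s hn hs.
split.
- exact: coset_regular_hypertope x2 (@hgen_neq1 n s n1 hs) IP FC.
- exact: coset_automorphism_group x2 (@hgen_neq1 n s n1 hs) IP FC.
- exact: has_order_card (halving_order n1 hs).
- have pres m : (1 < m)%N -> has_presentation (parabolic (@hgen m s) setT) (@hgen m s) (halving_rels m s).
    by case: m => // m m0; apply: halving_presentation.
  exact: pres.
- split=> //; have [f [fM fy finj _]] := tor.
  exact: (coset_residue x2 IP FC (toroidal_type_inj hn) (toroidal_type_range hn) fM finj fy
    (@pgen_full _ _)).
Qed.
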